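(* Let $(\mathcal X_1,\mathcal X_2,\mathcal Y,P_{Y|X_1,X_2})$ be a memoryless multiple access channel with finite alphabets, used without feedback, with unreliable causal cribbing from Encoder 1 to Encoder 2. Let $\mathcal I_{\text{mac}}$ be the convex hull of all nonnegative rate quadruples $(R_1,R_1',R_2,R_2'')$ satisfying $$R_1\le I(V;Y|X_2),$$ $$R_2\le I(X_2;Y|V),$$ $$R_1+R_2\le I(V,X_2;Y),$$ $$R_1'\le H(X_1|V),$$ $$R_2''\le I(X_2'';Y''|V,X_1),$$ $$R_1'+R_2''\le I(X_1,X_2'';Y''|V),$$ $$R_1+R_1'+R_2''\le I(X_1,X_2'';Y''),$$ for some joint distribution $P_{V,X_1,X_2,X_2'',Y,Y''}$ of the form $$P_{V,X_1}P_{X_2}P_{Y|X_1,X_2}P_{X_2''|X_1}P_{Y''|X_1,X_2''},$$ where $V$ takes values in a finite set $\mathcal V$ with $|\mathcal V|\le\min\{|\mathcal X_1||\mathcal X_2|+4,|\mathcal Y|+5\}$. Then $$\mathcal I_{\text{mac}}\subseteq\mathcal C_{\text{mac}},$$ where $\mathcal C_{\text{mac}}$ is the capacity region of the channel with unreliable causal cribbing.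
   Context: Logarithms, entropies and mutual informations are in nats. A multiple access channel (MAC) is a transition probability $P_{Y|X_1,X_2}$ from $\mathcal X_1\times\mathcal X_2$ to $\mathcal Y$ (finite sets), memoryless without feedback: given input sequences $x_1^n,x_2^n$ the output has law $\prod_iP_{Y|X_1,X_2}(y_i|x_{1,i},x_{2,i})$. In joint distributions, $X_2''$ takes values in $\mathcal X_2$, $Y''$ in $\mathcal Y$, and $P_{Y''|X_1,X_2''}$ is the same MAC transition law with $X_2''$ as the second input ($Y''$ is the output when cribbing is present, $Y$ when it is absent). Code. For positive integers $\nu_1,\nu_1',\nu_2,\nu_2''$ let $\mathcal N_1=\{1,\dots,\nu_1\}$, $\mathcal N_1'=\{1,\dots,\nu_1'\}$, $\mathcal N_2=\{1,\dots,\nu_2\}$, $\mathcal N_2''=\{1,\dots,\nu_2''\}$. An $(n,\nu_1,\nu_1',\nu_2,\nu_2'',\epsilon)$ code for the MAC with unreliable causal cribbing consists of encoding maps $f_1:\mathcal N_1\times\mathcal N_1'\to\mathcal X_1^n$, $f_2:\mathcal N_2\to\mathcal X_2^n$ (used by Encoder 2 if cribbing is absent), $f_{2,i}'':\mathcal N_2''\times\mathcal X_1^{i}\to\mathcal X_2$, $i=1,\dots,n$ (used by Encoder 2 if cribbing is present), and decoding maps $g:\mathcal Y^n\to\mathcal N_1\times\mathcal N_2$ (cribbing absent) and $g':\mathcal Y^n\to\mathcal N_1\times\mathcal N_1'\times\mathcal N_2''$ (cribbing present), such that $P_e\le\epsilon$ and $P_e'\le\epsilon$. Here $P_e$ is the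 average over uniform $(m_1,m_1',m_2)\in\mathcal N_1\times\mathcal N_1'\times\mathcal N_2$ of the probability that $g(Y^n)\ne(m_1,m_2)$ when the inputs are $f_1(m_1,m_1')$ and $f_2(m_2)$; and $P_e'$ is the average over uniform $(m_1,m_1',m_2'')\in\mathcal N_1\times\mathcal N_1'\times\mathcal N_2''$ of the probability that $g'(Y^n)\ne(m_1,m_1',m_2'')$ when the inputs are $x_1^n=f_1(m_1,m_1')$ and the sequence with $i$-th entry $f_{2,i}''(m_2'',x_1^{i})$. Achievability. A quadruple $(R_1,R_1',R_2,R_2'')$ of nonnegative reals is achievable if for every $\epsilon>0,\gamma>0$ and all sufficiently large $n$ there is an $(n,\nu_1,\nu_1',\nu_2,\nu_2'',\epsilon)$ code with $\nu_1\ge e^{n(R_1-\gamma)}$, $\nu_1'\ge e^{n(R_1'-\gamma)}$, $\nu_2\ge e^{n(R_2-\gamma)}$, $\nu_2''\ge e^{n(R_2''-\gamma)}$. $\mathcal C_{\text{mac}}$ is the closure of the set of achievable quadruples. *)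

(* Defs.v *)
(* Information quantities are in nats (natural logarithm). *)
From HB Require Import structures.
From mathcomp Require Import all_boot all_order all_algebra.
From mathcomp Require Import all_classical all_reals all_analysis.

Set Implicit Arguments.
Unset Strict Implicit.
Unset Printing Implicit Defensive.

Import Order.TTheory GRing.Theory Num.Theory.
Import numFieldNormedType.Exports.

Local Open Scope classical_set_scope.
Local Open Scope ring_scope.

Definition is_dist (R : realType) (A : finType) (p : A -> R) : Prop :=
  (forall a, 0 <= p a) /\ \sum_(a : A) p a = 1.

Definition is_channel (R : realType) (A B : finType) (Q : A -> B -> R) : Prop :=
  forall a, is_dist (Q a).

Definition is_mac (R : realType) (X1 X2 Y : finType)
    (W : X1 -> X2 -> Y -> R) : Prop :=
  forall x1 x2, is_dist (W x1 x2).

(* Random variables are functions on a finite space T with mass function P.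
   Since ln 0 = 0 and x / 0 = 0, terms of probability zero contribute 0. *)
Section information.
Variables (R : realType) (T : finType) (P : T -> R).
Variables (A B C : finType).

Definition law (D : finType) (X : T -> D) (d : D) : R :=
  \sum_(w : T | X w == d) P w.

Definition rvpair (X : T -> A) (Y : T -> B) : T -> A * B :=
  fun w => (X w, Y w).

(* H(X | Z) *)
Definition cond_entropy (X : T -> A) (Z : T -> B) : R :=
  - \sum_(a : A) \sum_(b : B)
      law (fun w => (X w, Z w)) (a, b) *
      ln (law (fun w => (X w, Z w)) (a, b) / law Z b).

(* I(X; Y) *)
Definition mutual_info (X : T -> A) (Y : T -> B) : R :=
  \sum_(a : A) \sum_(b : B)
    law (fun w => (X w, Y w)) (a, b) *
    ln (law (fun w => (X w, Y w)) (a, b) / (law X a * law Y b)).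

(* I(X; Y | Z) *)
Definition cond_mutual_info (X : T -> A) (Y : T -> B) (Z : T -> C) : R :=
  \sum_(a : A) \sum_(b : B) \sum_(c : C)
    law (fun w => (X w, Y w, Z w)) (a, b, c) *
    ln ((law Z c * law (fun w => (X w, Y w, Z w)) (a, b, c)) /
        (law (fun w => (X w, Z w)) (a, c) * law (fun w => (Y w, Z w)) (b, c))).

End information.

Section inner_region.
Variables (R : realType) (X1 X2 Y : finType) (W : X1 -> X2 -> Y -> R).

Section joint_law.
Variable V : finType.

(* Sample points are tuples (v, x1, x2, x2'', y, y''). *)
Definition outcome : finType := (V * X1 * X2 * X2 * Y * Y)%type.

Definition joint (PVX1 : V * X1 -> R) (PX2 : X2 -> R) (Q : X1 -> X2 -> R)
    (w : outcome) : R :=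
  let: (v, x1, x2, x2'', y, y'') := w in
  PVX1 (v, x1) * PX2 x2 * W x1 x2 y * Q x1 x2'' * W x1 x2'' y''.

Definition rvV (w : outcome) : V := let: (v, _, _, _, _, _) := w in v.
Definition rvX1 (w : outcome) : X1 := let: (_, x1, _, _, _, _) := w in x1.
Definition rvX2 (w : outcome) : X2 := let: (_, _, x2, _, _, _) := w in x2.
Definition rvX2'' (w : outcome) : X2 := let: (_, _, _, x2'', _, _) := w in x2''.
Definition rvY (w : outcome) : Y := let: (_, _, _, _, y, _) := w in y.
Definition rvY'' (w : outcome) : Y := let: (_, _, _, _, _, y'') := w in y''.

Definition rate_bounds (PVX1 : V * X1 -> R) (PX2 : X2 -> R) (Q : X1 -> X2 -> R)
    (R1 R1' R2 R2'' : R) : Prop :=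
  let P := joint PVX1 PX2 Q in
  [/\ R1 <= cond_mutual_info P rvV rvY rvX2,
      R2 <= cond_mutual_info P rvX2 rvY rvV &
      R1 + R2 <= mutual_info P (rvpair rvV rvX2) rvY] /\
  [/\ R1' <= cond_entropy P rvX1 rvV,
      R2'' <= cond_mutual_info P rvX2'' rvY'' (rvpair rvV rvX1),
      R1' + R2'' <= cond_mutual_info P (rvpair rvX1 rvX2'') rvY'' rvV &
      R1 + R1' + R2'' <= mutual_info P (rvpair rvX1 rvX2'') rvY''].

End joint_law.

(* Rate quadruples are ordered (R1, R1', R2, R2''). *)
Definition inner_rates : set (R * R * R * R) :=
  [set r | let: (R1, R1', R2, R2'') := r in
    [/\ 0 <= R1, 0 <= R1', 0 <= R2 & 0 <= R2''] /\
    exists V : finType,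
      (#|V| <= minn (#|X1| * #|X2| + 4) (#|Y| + 5))%N /\
      exists (PVX1 : V * X1 -> R) (PX2 : X2 -> R) (Q : X1 -> X2 -> R),
        [/\ is_dist PVX1, is_dist PX2, is_channel Q &
            rate_bounds PVX1 PX2 Q R1 R1' R2 R2'']].

Definition convex_hull (M : lmodType R) (A : set M) : set M :=
  smallest (@convex_set R M) A.

Definition inner_region : set (R * R * R * R) := convex_hull inner_rates.

End inner_region.

Section codes.
Variables (R : realType) (X1 X2 Y : finType) (W : X1 -> X2 -> Y -> R).

(* Probability of the output word y when the input words are x1 and x2. *)
Definition word_law (n : nat) (x1 : n.-tuple X1) (x2 : n.-tuple X2)
    (y : n.-tuple Y) : R :=
  \prod_(i < n) W (tnth x1 i) (tnth x2 i) (tnth y i).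

(* Positions are numbered from 0: the letters of x at positions 0, ..., i,
   the current letter included (causal cribbing). *)
Definition prefix_incl (n : nat) (x : n.-tuple X1) (i : 'I_n) : i.+1.-tuple X1 :=
  [tuple tnth x (widen_ord (ltn_ord i) j) | j < i.+1].

Record cribbing_code (n nu1 nu1' nu2 nu2'' : nat) := CribbingCode {
  enc1 : 'I_nu1 -> 'I_nu1' -> n.-tuple X1 ;
  enc2 : 'I_nu2 -> n.-tuple X2 ;
  enc2'' : forall i : 'I_n, 'I_nu2'' -> i.+1.-tuple X1 -> X2 ;
  dec : n.-tuple Y -> 'I_nu1 * 'I_nu2 ;
  dec' : n.-tuple Y -> 'I_nu1 * 'I_nu1' * 'I_nu2'' }.

Section error_probabilities.
Variables (n nu1 nu1' nu2 nu2'' : nat).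
Variable c : cribbing_code n nu1 nu1' nu2 nu2''.

(* The word sent by Encoder 2 when it cribs x1. *)
Definition cribbing_word (m2 : 'I_nu2'') (x1 : n.-tuple X1) : n.-tuple X2 :=
  [tuple enc2'' c m2 (prefix_incl x1 i) | i < n].

Definition error_prob : R :=
  (nu1 * nu1' * nu2)%:R^-1 *
  \sum_(m1 : 'I_nu1) \sum_(m1' : 'I_nu1') \sum_(m2 : 'I_nu2)
    \sum_(y : n.-tuple Y | dec c y != (m1, m2))
      word_law (enc1 c m1 m1') (enc2 c m2) y.

Definition error_prob' : R :=
  (nu1 * nu1' * nu2'')%:R^-1 *
  \sum_(m1 : 'I_nu1) \sum_(m1' : 'I_nu1') \sum_(m2 : 'I_nu2'')
    \sum_(y : n.-tuple Y | dec' c y != (m1, m1', m2))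
      word_law (enc1 c m1 m1') (cribbing_word m2 (enc1 c m1 m1')) y.

End error_probabilities.

Definition exists_code (n nu1 nu1' nu2 nu2'' : nat) (eps : R) : Prop :=
  [/\ (0 < nu1)%N, (0 < nu1')%N, (0 < nu2)%N & (0 < nu2'')%N] /\
  exists c : cribbing_code n nu1 nu1' nu2 nu2'',
    error_prob c <= eps /\ error_prob' c <= eps.

Definition achievable (R1 R1' R2 R2'' : R) : Prop :=
  [/\ 0 <= R1, 0 <= R1', 0 <= R2 & 0 <= R2''] /\
  forall eps gamma : R, 0 < eps -> 0 < gamma ->
    \forall n \near \oo, exists nu1 nu1' nu2 nu2'' : nat,
      exists_code n nu1 nu1' nu2 nu2'' eps /\
      [/\ expR (n%:R * (R1 - gamma)) <= nu1%:R,
          expR (n%:R * (R1' - gamma)) <= nu1'%:R,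
          expR (n%:R * (R2 - gamma)) <= nu2%:R &
          expR (n%:R * (R2'' - gamma)) <= nu2''%:R].

Definition achievable_rates : set (R * R * R * R) :=
  [set r | let: (R1, R1', R2, R2'') := r in achievable R1 R1' R2 R2''].

Definition capacity_region : set (R * R * R * R) := closure achievable_rates.

End codes.

(* Main.v *)
(* Random coding, with one idea beyond superposition coding. Encoder 1 uses clouds
   v(m1) and satellites x1(m1, m1'); without cribbing the decoder finds
   (m1, m2) from v and x2(m2). With cribbing, Encoder 2 uses a random tree code:
   its i-th letter is drawn from P(x2''|x1_i) independently for every message and
   every prefix x1^i. If a wrong codeword x1' first leaves x1 at position j, then
   agreement up to j has probability about exp (- j H(X1|V)), and what follows is
   as good as independent, so it is accepted with probability about
   exp (- (n - j) I(X1, X2''; Y''|V)). As R1' is at most both H(X1|V) and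
   I(X1, X2''; Y''|V), the sum over j is small. A wrong m1 is treated likewise,
   with H(X1) in place of H(X1|V), and R1 + R1' <= H(X1) because
   I(V; Y|X2) <= I(V; X1). Concatenating codes gives convexity. *)
Require Import Defs.
From mathcomp Require Import all_boot all_order all_algebra.
From mathcomp Require Import all_classical all_reals all_analysis.
From mathcomp Require Import ring lra zify.

Set Implicit Arguments.
Unset Strict Implicit.
Unset Printing Implicit Defensive.

Import Order.TTheory GRing.Theory Num.Theory.
Import numFieldNormedType.Exports.

Local Open Scope classical_set_scope.
Local Open Scope ring_scope.

(** * Product laws *)

(** A decoder accepts when every relevant information density, multiplied along the word, passes a
    threshold. Wrong codewords are then controlled by Markov's inequality and a change of measure,
    without counting types, and the true one by a Chernoff bound. The obstacle is a wrong codeword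
    that shares the message of Encoder 2: its cribbing word coincides with the true one up to the
    unknown position j where the inputs of Encoder 1 separate, so the letters before j carry no
    evidence against it. Hence all prefixes and suffixes are tested. The suffix test is read on the
    wrong codeword. The prefix test is read on the true one, where it caps pointwise the chance that
    a fresh codeword repeats its first j letters. Short blocks do not concentrate at their own
    scale, so the slack is n delta for every j; the union over j costs only a factor n + 1. Encoder
    1 does not know whether cribbing takes place, so clouds and satellites serve both decoders, and
    the two mean errors are added before a codebook is chosen. *)

Lemma le_of_eq (R : realType) (a b : R) : a = b -> a <= b.
Proof. by move->. Qed.

Section product_law.
Variables (R : realType) (I A : finType).
Implicit Types (p : I -> A -> R) (f : {ffun I -> A}).

Definition prod_law p f : R := \prod_i p i (f i).

Lemma prod_law_ge0 p f : (forall i a, 0 <= p i a) -> 0 <= prod_law p f.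
Proof. by move=> p0; apply: prodr_ge0 => i _; exact: p0. Qed.

Lemma sum_prod_law p : (forall i, \sum_a p i a = 1) ->
  \sum_f prod_law p f = 1.
Proof.
by move=> p1; rewrite /prod_law -bigA_distr_bigA big1// => i _; exact: p1.
Qed.

(** Each coordinate collects the factors that [e] attaches to it: at most one by injectivity.
    Coordinates that collect none sum to 1. *)
Lemma sum_prod_law_prod (J : finType) (P : pred J) (e : J -> I)
    (g : J -> A -> R) p :
  (forall i, \sum_a p i a = 1) -> {in P &, injective e} ->
  \sum_f prod_law p f * \prod_(j | P j) g j (f (e j)) =
  \prod_(j | P j) \sum_a p (e j) a * g j a.
Proof.
move=> p1 einj.
transitivity (\sum_(f : {ffun I -> A}) \prod_i (p i (f i) * \prod_(j | P j && (e j == i)) g j (f i))).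
  apply: eq_bigr => f _; rewrite big_split/=; congr (_ * _).
  rewrite (partition_big e xpredT)//=; apply: eq_bigr => i _.
  by apply: eq_bigr => j /andP[_ /eqP ->].
rewrite -(bigA_distr_bigA (fun i a => p i a * \prod_(j | P j && (e j == i)) g j a)).
rewrite [RHS](partition_big e xpredT)//=; apply: eq_bigr => i _.
have [j /andP[Pj /eqP ej]|no] := pickP [pred j | P j && (e j == i)]; last first.
  under eq_bigr do rewrite big_pred0 ?mulr1//.
  by rewrite p1 big_pred0.
have ji : [pred k | P k && (e k == i)] =1 pred1 j.
  move=> k /=; apply/andP/eqP => [[Pk /eqP ek]|->]; last by rewrite ej.
  by apply: einj; rewrite // ek ej.
rewrite (big_pred1 j)//=.
by rewrite -ej; apply: eq_bigr => a _; rewrite (big_pred1 j)// => k; rewrite -(ji k) -ej.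
Qed.

(** Along an injection the marginal of a product law is again a product law. This reads off one
    branch of a random tree. *)
Lemma sum_prod_law_comp (J : finType) (e : J -> I) (G : {ffun J -> A} -> R) p :
  (forall i, \sum_a p i a = 1) -> injective e ->
  \sum_f prod_law p f * G [ffun j => f (e j)] =
  \sum_(g : {ffun J -> A}) (\prod_j p (e j) (g j)) * G g.
Proof.
move=> p1 einj.
(* Splitting by the value [g] of the subfamily makes [G] constant and leaves a product of
   indicators, which factors over coordinates. *)
transitivity (\sum_(f : {ffun I -> A}) \sum_(g : {ffun J -> A})
    prod_law p f * \prod_(j | true) (f (e j) == g j)%:R * G g).
  apply: eq_bigr => f _; rewrite (bigD1 [ffun j => f (e j)])//= [X in _ = _ + X]big1.
    by rewrite addr0 big1 ?mulr1// => j _; rewrite ffunE eqxx.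
  move=> g /eqP gf; rewrite [X in _ * X * _](_ : _ = 0) ?mulr0 ?mul0r//.
  apply/eqP/prodf_eq0; have [/forallP h|] := boolP [forall j, f (e j) == g j].
    by exfalso; apply: gf; apply/ffunP => j; rewrite ffunE (eqP (h j)).
  by rewrite negb_forall => /existsP[j jg]; exists j; rewrite // (negbTE jg).
rewrite exchange_big/=; apply: eq_bigr => g _; rewrite -mulr_suml; congr (_ * _).
rewrite (sum_prod_law_prod (fun j a => (a == g j)%:R))//; last by move=> ? ? _ _ /einj.
apply: eq_bigr => j _; rewrite (bigD1 (g j))//= eqxx mulr1 big1 ?addr0// => a /negbTE ->.
by rewrite mulr0.
Qed.

Lemma sum_prod_law1 p i (G : A -> R) : (forall i, \sum_a p i a = 1) ->
  \sum_f prod_law p f * G (f i) = \sum_a p i a * G a.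
Proof.
move=> p1.
have := @sum_prod_law_prod unit xpredT (fun=> i) (fun=> G) p p1.
rewrite (big_pred1 tt); last by case.
move=> <-; last by move=> [] [].
by apply: eq_bigr => f _; rewrite (big_pred1 tt)// => -[].
Qed.

Lemma sum_prod_law2 p i j (G : A -> A -> R) : (forall i, \sum_a p i a = 1) ->
  i != j ->
  \sum_f prod_law p f * G (f i) (f j) =
  \sum_a p i a * \sum_b p j b * G a b.
Proof.
move=> p1 ij.
transitivity (\sum_f \sum_a \sum_b
    G a b * (prod_law p f * ((f i == a)%:R * (f j == b)%:R))).
  apply: eq_bigr => f _; rewrite (bigD1 (f i))//= (bigD1 (f j))//= !eqxx !mulr1.
  rewrite mulrC big1 ?addr0 => [|b /negbTE jb]; last first.
    by rewrite [f j == b]eq_sym jb !mulr0.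
  rewrite big1 ?addr0// => a /negbTE ia; rewrite big1// => b _.
  by rewrite [f i == a]eq_sym ia mul0r !mulr0.
rewrite exchange_big/=; apply: eq_bigr => a _.
rewrite exchange_big/= mulr_sumr; apply: eq_bigr => b _.
rewrite -mulr_sumr mulrA mulrC; congr (_ * _).
have := @sum_prod_law_prod bool xpredT (fun t => if t then i else j)
  (fun t c => (c == if t then a else b)%:R) p p1.
rewrite big_bool/= => H.
have -> : p i a * p j b = (\sum_c p i c * (c == a)%:R) * (\sum_c p j c * (c == b)%:R).
  congr (_ * _); [rewrite (bigD1 a)//=|rewrite (bigD1 b)//=];
  rewrite eqxx mulr1 big1 ?addr0// => c /negbTE ->; exact: mulr0.
rewrite -H; first by apply: eq_bigr => f _; rewrite big_bool.
move=> [] [] _ _ //= /eqP; first by rewrite (negbTE ij).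
by rewrite eq_sym (negbTE ij).
Qed.

End product_law.

(** A kernel applied letter by letter to a product law gives a product law on pairs. Iterated, this
    fuses cloud, input and output words into a single word of tuples. *)
Lemma sum_prod_law_pair (R : realType) (I A B : finType) (p : I -> A -> R)
    (q : I -> A -> B -> R) (G : {ffun I -> A} -> {ffun I -> B} -> R) :
  \sum_(a : {ffun I -> A}) prod_law p a *
    (\sum_(b : {ffun I -> B}) prod_law (fun i => q i (a i)) b * G a b) =
  \sum_(w : {ffun I -> A * B})
    prod_law (fun i c => p i c.1 * q i c.1 c.2) w *
    G [ffun i => (w i).1] [ffun i => (w i).2].
Proof.
under eq_bigr do rewrite mulr_sumr.
rewrite pair_bigA/=.
rewrite [RHS](reindex (fun c : {ffun I -> A} * {ffun I -> B} => [ffun i => (c.1 i, c.2 i)]))/=.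
  apply: eq_bigr => -[a b] _ /=; rewrite mulrA; congr (_ * _).
    by rewrite /prod_law -big_split/=; apply: eq_bigr => i _; rewrite ffunE.
  by congr G; apply/ffunP => i; rewrite !ffunE.
exists (fun w => ([ffun i => (w i).1], [ffun i => (w i).2])) => [[a b]|w] _ /=.
  by congr pair; apply/ffunP => i; rewrite !ffunE.
by apply/ffunP => i; rewrite !ffunE; case: (w i).
Qed.

(** * Chernoff bound *)

(** Inverting [1 - x <= expR (- x)] bounds the left side by [(1 - x)^-1], and [(1 + x + 2 * x ^+ 2)
    * (1 - x) = 1 + x ^+ 2 * (1 - 2 * x)]. *)
Lemma expR_le_quadratic (R : realType) (x : R) : x <= 2^-1 ->
  expR x <= 1 + x + 2 * x ^+ 2.
Proof.
move=> x2; have x1 : 0 < 1 - x by lra.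
have h : 1 - x <= expR (- x) by have := expR_ge1Dx (- x).
have e0 := expR_gt0 x.
apply: (@le_trans _ _ (1 - x)^-1).
  by rewrite -[expR x]invrK -expRN lef_pV2// posrE ?expR_gt0.
rewrite -[X in X <= _]mul1r ler_pdivrMr//.
rewrite (_ : (_ + _) * _ = 1 + x ^+ 2 * (1 - 2 * x)); last by ring.
by rewrite lerDl mulr_ge0 ?sqr_ge0//; lra.
Qed.

Definition mean_ln (R : realType) (T : finType) (P d : T -> R) : R :=
  \sum_w P w * ln (d w).

(** Chernoff's method for the centred log-density. The slack is [n%:R * delta] for every set [J] of
    positions, however small; this is what allows a single rate [kappa] for all prefixes and
    suffixes. *)
Lemma chernoff_density (R : realType) (T : finType) (P d : T -> R) (delta : R) :
  is_dist P -> (forall w, 0 < P w -> 0 < d w) -> 0 < delta ->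
  exists2 kappa : R, 0 < kappa & forall n (J : pred 'I_n),
    \sum_(w : {ffun 'I_n -> T}) prod_law (fun=> P) w *
      (~~ (expR (\sum_(i | J i) mean_ln P d - n%:R * delta) <=
             \prod_(i | J i) d (w i)))%:R
    <= expR (- (n%:R * kappa)).
Proof.
move=> [P0 P1] dpos delta0; set mu := mean_ln P d.
pose g w := ln (d w) - mu.
pose B := 1 + \sum_w `|g w|.
have B1 : 1 <= B by rewrite lerDl sumr_ge0.
have gB w : `|g w| <= B.
  rewrite /B (bigD1 w)//= addrCA lerDl addr_ge0// sumr_ge0//.
have B0 : 0 < B by lra.
(* The first bound gives [s * B <= 2^-1], the range of the quadratic estimate. The second keeps the
   second-order term [2 * (s * B) ^+ 2] below half of the gain [s * delta]; the other half is
   [kappa]. *)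
pose s := Num.min (2 * B)^-1 (delta / (4 * B ^+ 2)).
have s0 : 0 < s by rewrite /s lt_min invr_gt0 mulr_gt0//= divr_gt0// mulr_gt0// exprn_gt0.
have sB : s * B <= 2^-1.
  apply: (@le_trans _ _ ((2 * B)^-1 * B)).
    by rewrite ler_wpM2r ?(ltW B0)// /s ge_min lexx.
  by rewrite invfM -mulrA mulVf ?mulr1// gt_eqF.
have sB2 : 2 * (s * B ^+ 2) <= delta / 2.
  apply: (@le_trans _ _ (2 * (delta / (4 * B ^+ 2) * B ^+ 2))).
    by rewrite ler_wpM2l// ler_wpM2r ?sqr_ge0// /s ge_min lexx orbT.
  apply: le_of_eq; field.
  by rewrite gt_eqF.
have mgf : \sum_w P w * expR (- (s * g w)) <= expR (2 * (s * B) ^+ 2).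
  apply: (@le_trans _ _ (\sum_w P w * (1 - s * g w + 2 * (s * B) ^+ 2))).
    apply: ler_sum => w _; rewrite ler_wpM2l//.
    have sg : `|s * g w| <= s * B by rewrite normrM gtr0_norm// ler_wpM2l ?gB ?(ltW s0).
    apply: (le_trans (expR_le_quadratic _)).
      have : `|s * g w| <= 2^-1 by lra.
      by rewrite ler_norml => /andP[? ?]; lra.
    rewrite sqrrN lerD2l ler_wpM2l// -[X in X <= _]real_normK ?num_real//.
    by apply: lerXn2r; rewrite ?nnegrE//; exact: le_trans (normr_ge0 _) sg.
  have Pg : \sum_w P w * g w = 0.
    under eq_bigr do rewrite mulrBr.
    by rewrite sumrB -mulr_suml P1 mul1r subrr.
  rewrite (_ : \sum_w _ = 1 + 2 * (s * B) ^+ 2); first exact: expR_ge1Dx.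
  transitivity (\sum_w P w - s * \sum_w P w * g w + (\sum_w P w) * (2 * (s * B) ^+ 2)).
    rewrite mulr_sumr mulr_suml -sumrB -big_split/=.
    by apply: eq_bigr => w _; ring.
  by rewrite P1 Pg mulr0 subr0 mul1r.
exists (s * delta / 2); first by rewrite divr_gt0// mulr_gt0.
move=> n J.
apply: (@le_trans _ _ (\sum_(w : {ffun 'I_n -> T}) prod_law (fun=> P) w *
   (expR (- (s * (n%:R * delta))) * \prod_(i | J i) expR (- (s * g (w i)))))).
  apply: ler_sum => w _.
  (* A word with a null letter has weight zero. On the others every density is positive, so its
     logarithm is genuine. *)
  have [Pw0|] := boolP [forall i, 0 < P (w i)]; last first.
    rewrite negb_forall => /existsP[i]; rewrite lt_neqAle P0 andbT negbK eq_sym => /eqP Pi.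
    by rewrite /prod_law (bigD1 i)//= Pi !mul0r.
  have dw i : 0 < d (w i) by apply: dpos; apply: (forallP Pw0).
  rewrite ler_wpM2l ?prod_law_ge0// -ltNge.
  have -> : \prod_(i | J i) d (w i) = expR (\sum_(i | J i) ln (d (w i))).
    by rewrite expR_sum; apply: eq_bigr => i _; rewrite lnK// posrE.
  rewrite -expR_sum -expRD ltr_expR; case: ltP => /= h; last exact: expR_ge0.
  rewrite -[X in X <= _]expR0 ler_expR sumrN -mulr_sumr -opprD -mulrDr oppr_ge0.
  rewrite pmulr_rle0// /g sumrB. lra.
under eq_bigr do rewrite mulrCA.
rewrite -mulr_sumr (sum_prod_law_prod (e := id) (fun _ a => expR (- (s * g a))))//.
have -> : - (n%:R * (s * delta / 2)) = - (s * (n%:R * delta)) + n%:R * (s * (delta / 2)) :> R.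
  by field.
rewrite expRD ler_wpM2l ?expR_ge0//.
apply: (@le_trans _ _ (\prod_(i < n | J i) expR (2 * (s * B) ^+ 2))).
  apply: ler_prod => i _; rewrite mgf andbT sumr_ge0// => a _.
  by rewrite mulr_ge0 ?expR_ge0.
rewrite -expR_sum ler_expR.
apply: (@le_trans _ _ (\sum_(i < n) 2 * (s * B) ^+ 2)).
  rewrite [X in _ <= X](bigID J)/= lerDl sumr_ge0// => i _.
  by rewrite mulr_ge0// sqr_ge0.
rewrite sumr_const card_ord -[X in X <= _]mulr_natl ler_wpM2l//.
rewrite (_ : 2 * _ = s * (2 * (s * B ^+ 2))); last by ring.
by rewrite ler_wpM2l// ltW.
Qed.

(** * Information densities *)

Section densities.
Variables (R : realType) (T : finType) (P : T -> R).
Hypothesis Pdist : is_dist P.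

Lemma law_ge0 (D : finType) (X : T -> D) d : 0 <= law P X d.
Proof. by apply: sumr_ge0 => w _; exact: Pdist.1. Qed.

Lemma law_gt0 (D : finType) (X : T -> D) w : 0 < P w -> 0 < law P X (X w).
Proof.
move=> Pw; rewrite /law (bigD1 w)//= ltr_wpDr//.
by apply: sumr_ge0 => i _; exact: Pdist.1.
Qed.

Lemma sum_law (D : finType) (X : T -> D) (F : D -> R) :
  \sum_d law P X d * F d = \sum_w P w * F (X w).
Proof.
rewrite [RHS](partition_big X xpredT)//=; apply: eq_bigr => d _.
by rewrite mulr_suml; apply: eq_bigr => w /eqP ->.
Qed.

Variables A B C : finType.

Definition cmi_density (X : T -> A) (Y : T -> B) (Z : T -> C) a b c : R :=
  law P Z c * law P (fun w => (X w, Y w, Z w)) (a, b, c) /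
  (law P (fun w => (X w, Z w)) (a, c) * law P (fun w => (Y w, Z w)) (b, c)).

Definition mi_density (X : T -> A) (Y : T -> B) a b : R :=
  law P (fun w => (X w, Y w)) (a, b) / (law P X a * law P Y b).

Lemma cmi_density_ge0 X Y Z a b c : 0 <= cmi_density X Y Z a b c.
Proof. by rewrite divr_ge0// mulr_ge0// law_ge0. Qed.

Lemma mi_density_ge0 X Y a b : 0 <= mi_density X Y a b.
Proof. by rewrite divr_ge0 ?mulr_ge0// law_ge0. Qed.

Lemma cmi_density_gt0 X Y Z w : 0 < P w -> 0 < cmi_density X Y Z (X w) (Y w) (Z w).
Proof.
move=> Pw; rewrite divr_gt0 ?mulr_gt0//.
- exact: law_gt0.
- exact: (law_gt0 (fun w => (X w, Y w, Z w))).
- exact: (law_gt0 (fun w => (X w, Z w))).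
- exact: (law_gt0 (fun w => (Y w, Z w))).
Qed.

Lemma mi_density_gt0 X Y w : 0 < P w -> 0 < mi_density X Y (X w) (Y w).
Proof.
move=> Pw; rewrite divr_gt0 ?mulr_gt0// ?law_gt0//.
Qed.

Lemma cond_mutual_infoE X Y Z : cond_mutual_info P X Y Z =
  mean_ln P (fun w => cmi_density X Y Z (X w) (Y w) (Z w)).
Proof.
rewrite /mean_ln -(sum_law (fun w => (X w, Y w, Z w))
  (fun t => ln (cmi_density X Y Z t.1.1 t.1.2 t.2))).
rewrite /cond_mutual_info.
under eq_bigr do rewrite pair_bigA.
rewrite pair_bigA (reindex (fun t : A * B * C => (t.1.1, (t.1.2, t.2))))/=.
  by apply: eq_bigr => -[[]].
by exists (fun t => (t.1, t.2.1, t.2.2)) => [[[]]|[? []]].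
Qed.

Lemma mutual_infoE X Y : mutual_info P X Y =
  mean_ln P (fun w => mi_density X Y (X w) (Y w)).
Proof.
rewrite /mean_ln -(sum_law (fun w => (X w, Y w))
  (fun t => ln (mi_density X Y t.1 t.2))).
by rewrite /mutual_info pair_bigA; apply: eq_bigr => -[].
Qed.

(* Change of measure: [q] is the conditional law of [X] given [Z], and the
   inequality can only be strict because of null events. *)
Lemma cmi_density_le1 X Y Z (q : A -> C -> R) : (forall a c, 0 <= q a c) ->
  (forall a c, law P (fun w => (X w, Z w)) (a, c) = law P Z c * q a c) ->
  \sum_w P w * (\sum_a q a (Z w) * cmi_density X Y Z a (Y w) (Z w)) <= 1.
Proof.
move=> q0 qE.
rewrite -(sum_law (fun w => (Y w, Z w))
  (fun t => \sum_a q a t.2 * cmi_density X Y Z a t.1 t.2)).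
apply: (@le_trans _ _ (\sum_t \sum_a law P (fun w => (X w, Y w, Z w)) (a, t.1, t.2))).
  apply: ler_sum => -[b c] _ /=; rewrite mulr_sumr; apply: ler_sum => a _.
  rewrite /cmi_density.
  have [->|bc0] := eqVneq (law P (fun w => (Y w, Z w)) (b, c)) 0.
    by rewrite mul0r law_ge0.
  have [->|ac0] := eqVneq (law P (fun w => (X w, Z w)) (a, c)) 0.
    by rewrite mul0r invr0 !mulr0 law_ge0.
  move: (ac0); rewrite qE mulf_eq0 negb_or => /andP[c0 qac0].
  apply: le_of_eq.
  by field; rewrite c0 bc0 qac0.
rewrite exchange_big/= pair_bigA/=.
rewrite (reindex (fun t : A * B * C => (t.1.1, (t.1.2, t.2))))/=; last first.
  by exists (fun t => (t.1, t.2.1, t.2.2)) => [[[]]|[? []]].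
under eq_bigr do rewrite -[law _ _ _]mulr1.
rewrite (eq_bigr (fun t => law P (fun w => (X w, Y w, Z w)) t * 1)); last by move=> [[]].
rewrite sum_law -mulr_suml Pdist.2 mulr1//.
Qed.

(** Off null events the density turns the product of the marginals into the joint law, whose total
    mass is 1. *)
Lemma mi_density_le1 X Y :
  \sum_w P w * (\sum_a law P X a * mi_density X Y a (Y w)) <= 1.
Proof.
rewrite -(sum_law Y (fun b => \sum_a law P X a * mi_density X Y a b)).
apply: (@le_trans _ _ (\sum_b \sum_a law P (fun w => (X w, Y w)) (a, b))).
  apply: ler_sum => b _; rewrite mulr_sumr; apply: ler_sum => a _.
  rewrite /mi_density.
  have [->|b0] := eqVneq (law P Y b) 0; first by rewrite mul0r law_ge0.
  have [->|a0] := eqVneq (law P X a) 0; first by rewrite mul0r mulr0 law_ge0.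
  apply: le_of_eq.
  by field; rewrite a0 b0.
rewrite exchange_big/= pair_bigA/=.
rewrite (eq_bigr (fun t => law P (fun w => (X w, Y w)) t * 1)).
  by rewrite sum_law -mulr_suml Pdist.2 mulr1.
by move=> [a b] _; rewrite mulr1.
Qed.

End densities.

(** * Invariance of information quantities under a change of sample space *)

Section pushforward.
Variables (R : realType) (T T' : finType) (P : T -> R) (P' : T' -> R).
Variable h : T -> T'.
Hypothesis hP : forall F : T' -> R, \sum_w P w * F (h w) = \sum_t P' t * F t.

Lemma law_pushforward (D : finType) (X : T -> D) (X' : T' -> D) :
  X =1 X' \o h -> law P X =1 law P' X'.
Proof.
move=> XX' d; rewrite /law big_mkcond [RHS]big_mkcond/=.
transitivity (\sum_w P w * (X' (h w) == d)%:R).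
  by apply: eq_bigr => w _; rewrite XX'/=; case: eqP => _; rewrite ?mulr1 ?mulr0.
rewrite (hP (fun t => (X' t == d)%:R)).
by apply: eq_bigr => t _; case: eqP => _; rewrite ?mulr1 ?mulr0.
Qed.

Variables A B C : finType.

Lemma cond_mutual_info_pushforward (X : T -> A) (Y : T -> B) (Z : T -> C) X' Y' Z' :
  X =1 X' \o h -> Y =1 Y' \o h -> Z =1 Z' \o h ->
  cond_mutual_info P X Y Z = cond_mutual_info P' X' Y' Z'.
Proof.
move=> XX YY ZZ; apply: eq_bigr => a _; apply: eq_bigr => b _; apply: eq_bigr => c _.
rewrite (law_pushforward ZZ).
rewrite (law_pushforward (X := fun w => (X w, Y w, Z w))
  (X' := fun t => (X' t, Y' t, Z' t))); last by move=> w; rewrite /= XX YY ZZ.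
rewrite (law_pushforward (X := fun w => (X w, Z w))
  (X' := fun t => (X' t, Z' t))); last by move=> w; rewrite /= XX ZZ.
by rewrite (law_pushforward (X := fun w => (Y w, Z w))
  (X' := fun t => (Y' t, Z' t))) => [//|w]; rewrite /= YY ZZ.
Qed.

Lemma mutual_info_pushforward (X : T -> A) (Y : T -> B) X' Y' :
  X =1 X' \o h -> Y =1 Y' \o h ->
  mutual_info P X Y = mutual_info P' X' Y'.
Proof.
move=> XX YY; apply: eq_bigr => a _; apply: eq_bigr => b _.
rewrite (law_pushforward XX) (law_pushforward YY).
by rewrite (law_pushforward (X := fun w => (X w, Y w))
  (X' := fun t => (X' t, Y' t))) => [//|w]; rewrite /= XX YY.
Qed.

End pushforward.

Lemma sum_pair (R : nmodType) (A B : finType) (F : A * B -> R) :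
  \sum_p F p = \sum_a \sum_b F (a, b).
Proof. by rewrite pair_bigA; apply: eq_bigr => -[]. Qed.

(** * The law of a single channel use *)

Section letter_law.
Variables (R : realType) (V X1 X2 Y : finType).
Variables (pv : V -> R) (k : V -> X1 -> R) (Q : X1 -> X2 -> R) (W : X1 -> X2 -> Y -> R).
Hypotheses (pvd : is_dist pv) (kd : is_channel k) (Qd : is_channel Q) (Wd : is_mac W).

(** [Q] is the law of the second input given the first. The constant kernel [fun=> p2] describes the
    channel without cribbing, so both cases share these lemmas. *)
Definition letter_law (w : V * X1 * X2 * Y) : R :=
  pv w.1.1.1 * k w.1.1.1 w.1.1.2 * Q w.1.1.2 w.1.2 * W w.1.1.2 w.1.2 w.2.

Definition letV (w : V * X1 * X2 * Y) : V := w.1.1.1.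
Definition letX1 (w : V * X1 * X2 * Y) : X1 := w.1.1.2.
Definition letX2 (w : V * X1 * X2 * Y) : X2 := w.1.2.
Definition letY (w : V * X1 * X2 * Y) : Y := w.2.

Definition marg1 (x : X1) : R := \sum_v pv v * k v x.

Lemma sum_fst_kernel (A B : finType) (P : A -> R) (K : A -> B -> R) (F : A -> R) :
  (forall a, \sum_b K a b = 1) ->
  \sum_(w : A * B) P w.1 * K w.1 w.2 * F w.1 = \sum_a P a * F a.
Proof.
move=> K1; rewrite sum_pair/=.
by apply: eq_bigr => a _; rewrite -mulr_suml -mulr_sumr K1 mulr1.
Qed.

Lemma letter_law_dist : is_dist letter_law.
Proof.
split=> [w|]; first by rewrite !mulr_ge0 ?(pvd.1) ?((kd _).1) ?((Qd _).1) ?((Wd _ _).1).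
under eq_bigr do rewrite -[letter_law _]mulr1.
rewrite (@sum_fst_kernel _ _ (fun c : V * X1 * X2 => pv c.1.1 * k c.1.1 c.1.2 * Q c.1.2 c.2)
  (fun c y => W c.1.2 c.2 y) (fun=> 1)); last by move=> c; case: (Wd c.1.2 c.2).
rewrite (@sum_fst_kernel _ _ (fun c : V * X1 => pv c.1 * k c.1 c.2)
  (fun c z => Q c.2 z) (fun=> 1)); last by move=> c; case: (Qd c.2).
rewrite (@sum_fst_kernel _ _ pv k (fun=> 1)); last by move=> v; case: (kd v).
by under eq_bigr do rewrite mulr1; case: pvd.
Qed.

Lemma law_letVX1X2 (D : finType) (g : V * X1 * X2 -> D) (X : _ -> D) :
  X =1 (fun w => g w.1) ->
  law letter_law X =1 law (fun c => pv c.1.1 * k c.1.1 c.1.2 * Q c.1.2 c.2) g.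
Proof.
move=> Xg; apply: (law_pushforward (h := fst) _ Xg) => F.
apply: (@sum_fst_kernel _ _ (fun c : V * X1 * X2 => pv c.1.1 * k c.1.1 c.1.2 * Q c.1.2 c.2)
  (fun c y => W c.1.2 c.2 y) F) => c.
by case: (Wd c.1.2 c.2).
Qed.

Lemma law_letVX1 (D : finType) (g : V * X1 -> D) (X : _ -> D) :
  X =1 (fun w => g w.1.1) ->
  law letter_law X =1 law (fun c => pv c.1 * k c.1 c.2) g.
Proof.
move=> Xg d; rewrite (@law_letVX1X2 _ (g \o fst))//.
apply: (law_pushforward (h := fst)) => // F.
apply: (@sum_fst_kernel _ _ (fun c : V * X1 => pv c.1 * k c.1 c.2) (fun c z => Q c.2 z) F) => c.
by case: (Qd c.2).
Qed.

Lemma law_letV : law letter_law letV =1 pv.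
Proof.
move=> v; rewrite (@law_letVX1 _ fst)//.
rewrite (@law_pushforward _ _ _ _ (pv) (fst) _ _ _ id)//; last first.
  by move=> F; apply: (@sum_fst_kernel _ _ pv k F) => c; case: (kd c).
by rewrite /law big_pred1_eq.
Qed.

Lemma law_injective (A D : finType) (P : A -> R) (g : A -> D) a :
  injective g -> law P g (g a) = P a.
Proof. by move=> ginj; rewrite /law (big_pred1 a)// => b; rewrite /= (inj_eq ginj). Qed.

Lemma sum_letter_law (F : V * X1 * X2 * Y -> R) :
  \sum_w letter_law w * F w =
  \sum_v pv v * \sum_x k v x * \sum_z Q x z * \sum_y W x z y * F (v, x, z, y).
Proof.
rewrite sum_pair/=.
rewrite sum_pair/=.
rewrite sum_pair/=.
apply: eq_bigr => v _; rewrite mulr_sumr; apply: eq_bigr => x _.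
rewrite mulrA mulr_sumr; apply: eq_bigr => z _; rewrite mulrA mulr_sumr.
by apply: eq_bigr => y _; rewrite /letter_law/= !mulrA.
Qed.

Lemma marg1_dist : is_dist marg1.
Proof.
split=> [x|]; first by apply: sumr_ge0 => v _; rewrite mulr_ge0 ?(pvd.1) ?((kd _).1).
rewrite exchange_big/= -[RHS]pvd.2; apply: eq_bigr => v _.
by rewrite -mulr_sumr (kd v).2 mulr1.
Qed.

Lemma law_letX1X2 x z :
  law letter_law (fun w => (letX1 w, letX2 w)) (x, z) = marg1 x * Q x z.
Proof.
rewrite (@law_letVX1X2 _ (fun c => (c.1.2, c.2)))//.
rewrite (@law_pushforward _ _ _ _ (fun c => marg1 c.1 * Q c.1 c.2) (fun c => (c.1.2, c.2)) _ _ _ id)//; first by rewrite /law big_pred1_eq.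
move=> F.
rewrite sum_pair/=.
rewrite sum_pair/=.
rewrite sum_pair/=.
rewrite exchange_big/=; apply: eq_bigr => a _.
rewrite exchange_big/=; apply: eq_bigr => b _.
by rewrite -!mulr_suml.
Qed.

Lemma law_letVX1E v x :
  law letter_law (fun w => (letV w, letX1 w)) (v, x) = pv v * k v x.
Proof.
by rewrite (@law_letVX1 _ id) => [|[[[]]]//]; rewrite /law big_pred1_eq.
Qed.

Lemma law_letX1V v x :
  law letter_law (fun w => (letX1 w, letV w)) (x, v) = pv v * k v x.
Proof.
rewrite (@law_letVX1 _ (fun c => (c.2, c.1)))//.
by rewrite (@law_injective _ _ _ (fun c : V * X1 => (c.2, c.1)) (v, x))// => -[? ?] [? ?] [-> ->].
Qed.

Lemma law_letX2_VX1 v x z :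
  law letter_law (fun w => (letX2 w, (letV w, letX1 w))) (z, (v, x)) =
  pv v * k v x * Q x z.
Proof.
rewrite (@law_letVX1X2 _ (fun c => (c.2, c.1)))//; last by move=> [[[]]].
by rewrite (@law_injective _ _ _ (fun c : V * X1 * X2 => (c.2, c.1)) (v, x, z))// => -[? ?] [? ?] [-> ->].
Qed.

Lemma law_letX1X2_V v x z :
  law letter_law (fun w => (letX1 w, letX2 w, letV w)) (x, z, v) =
  pv v * k v x * Q x z.
Proof.
rewrite (@law_letVX1X2 _ (fun c => (c.1.2, c.2, c.1.1)))//.
rewrite (@law_injective _ _ _ (fun c : V * X1 * X2 => (c.1.2, c.2, c.1.1)) (v, x, z))//.
by move=> [[? ?] ?] [[? ?] ?] [-> -> ->].
Qed.

End letter_law.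

Arguments letV {V X1 X2 Y}.
Arguments letX1 {V X1 X2 Y}.
Arguments letX2 {V X1 X2 Y}.
Arguments letY {V X1 X2 Y}.

Section independent_letter_law.
Variables (R : realType) (V X1 X2 Y : finType).
Variables (pv : V -> R) (k : V -> X1 -> R) (p2 : X2 -> R) (W : X1 -> X2 -> Y -> R).
Hypotheses (pvd : is_dist pv) (kd : is_channel k) (p2d : is_dist p2) (Wd : is_mac W).

Let P := letter_law pv k (fun=> p2) W.

Lemma law_indep_letVX2 v z : law P (fun w => (letV w, letX2 w)) (v, z) = pv v * p2 z.
Proof.
rewrite (@law_letVX1X2 _ _ _ _ _ _ _ _ _ Wd _ (fun c => (c.1.1, c.2)))//.
rewrite (@law_pushforward _ _ _ _ (fun c => pv c.1 * p2 c.2) (fun c => (c.1.1, c.2)) _ _ _ id)//; first by rewrite /law big_pred1_eq.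
move=> F.
rewrite sum_pair/=.
rewrite sum_pair/=.
rewrite sum_pair/=.
apply: eq_bigr => a _; rewrite exchange_big/=; apply: eq_bigr => b _.
by rewrite -!mulr_suml -mulr_sumr (kd a).2 mulr1.
Qed.

Lemma law_indep_letX2V v z : law P (fun w => (letX2 w, letV w)) (z, v) = pv v * p2 z.
Proof.
rewrite -law_indep_letVX2; apply: eq_bigl => w /=.
by rewrite !xpair_eqE andbC.
Qed.

Lemma law_indep_letX2 z : law P letX2 z = p2 z.
Proof.
rewrite -[RHS]mul1r -pvd.2 mulr_suml /law (partition_big (@letV V X1 X2 Y) xpredT)//=.
apply: eq_bigr => v _; rewrite -law_indep_letVX2; apply: eq_bigl => w /=.
by rewrite xpair_eqE andbC.
Qed.

End independent_letter_law.

(** * Random tree codes *)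

Lemma prodr_indicator (R : realType) (I : finType) (P : pred I) (b : I -> bool) :
  \prod_(i | P i) (b i)%R%:R = [forall (i | P i), b i]%:R :> R.
Proof.
case: forall_inP => h; first by rewrite big1// => i Pi; rewrite h.
apply/eqP/prodf_eq0; move/forall_inP: h; rewrite negb_forall_in => /existsP[i /andP[Pi bi]].
by exists i; rewrite // (negbTE bi).
Qed.

Lemma markov_indicator (R : realType) (a b : R) : 0 < a -> 0 <= b ->
  (a <= b)%R%:R <= a^-1 * b.
Proof.
move=> a0 b0; case: (leP a b) => h /=; last by rewrite mulr_ge0// invr_ge0 ltW.
by rewrite -(mulVf (lt0r_neq0 a0)) ler_wpM2l// invr_ge0 ltW.
Qed.

Section tree_code.
Variables (R : realType) (V X1 X2 Y M : finType) (n : nat).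
Variables (pv : V -> R) (k : V -> X1 -> R) (Q : X1 -> X2 -> R) (W : X1 -> X2 -> Y -> R).
Hypotheses (pvd : is_dist pv) (kd : is_channel k) (Qd : is_channel Q) (Wd : is_mac W).
Variable x0 : X1.

Local Notation word A := {ffun 'I_n -> A}.

(* A prefix is encoded as a word of full length, padded with [x0], so that the
   index type of the tree code is not dependent. *)
Definition mask (i : 'I_n) (x : word X1) : word X1 :=
  [ffun l : 'I_n => if (l <= i)%N then x l else x0].

Definition tree_index : finType := (M * 'I_n * word X1)%type.

(** At index [(m, i, p)] the expression [s.2 s.1.2] is [p i], the last letter of the cribbed prefix;
    the stored letter depends on the prefix in law only through it. *)
Definition tree_law (t : {ffun tree_index -> X2}) : R :=
  prod_law (fun s : tree_index => Q (s.2 s.1.2)) t.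

Definition tree_word (t : {ffun tree_index -> X2}) (m : M) (x : word X1) : word X2 :=
  [ffun i => t (m, i, mask i x)].

Lemma mask_last i x : mask i x i = x i.
Proof. by rewrite ffunE leqnn. Qed.

Lemma sum_tree_law : forall s : tree_index, \sum_a Q (s.2 s.1.2) a = 1.
Proof. by move=> s; case: (Qd (s.2 s.1.2)). Qed.

Lemma tree_law_ge0 t : 0 <= tree_law t.
Proof. by apply: prod_law_ge0 => s a; case: (Qd (s.2 s.1.2)). Qed.

Lemma tree_word_law m x (G : word X2 -> R) :
  \sum_t tree_law t * G (tree_word t m x) =
  \sum_(z : word X2) prod_law (fun i => Q (x i)) z * G z.
Proof.
rewrite (sum_prod_law_comp (e := fun i : 'I_n => (m, i, mask i x) : tree_index)).
- apply: eq_bigr => z _; congr (_ * _); apply: eq_bigr => i _.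
  by rewrite /= mask_last.
- exact: sum_tree_law.
- by move=> i i' [].
Qed.

(** From [j] on the two branches read disjoint coordinates of the tree, hence independent letters.
    Before [j] only the first branch contributes factors, so a shared beginning does no harm. *)
Lemma tree_word_pair_law (j : nat) m x m' x' (g h : 'I_n -> X2 -> R) :
  (forall i : 'I_n, (j <= i)%N -> (m, mask i x) != (m', mask i x')) ->
  \sum_t tree_law t * ((\prod_i g i (tree_word t m x i)) *
     \prod_(i < n | (j <= i)%N) h i (tree_word t m' x' i)) =
  (\prod_i \sum_z Q (x i) z * g i z) *
  \prod_(i < n | (j <= i)%N) \sum_z Q (x' i) z * h i z.
Proof.
move=> sep.
(* Both branches as one family of coordinates. [P] drops the beginning of the second branch, which
   makes the family injective. *)
pose e (s : 'I_n + 'I_n) : tree_index :=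
  match s with inl i => (m, i, mask i x) | inr i => (m', i, mask i x') end.
pose P (s : 'I_n + 'I_n) := if s is inr i then (j <= i)%N else true.
have := @sum_prod_law_prod R tree_index X2 _ P e
  (fun s a => match s with inl i => g i a | inr i => h i a end)
  (fun s : tree_index => Q (s.2 s.1.2)) sum_tree_law.
rewrite big_sumType/=; under [X in X * _]eq_bigr do under eq_bigr do rewrite mask_last.
under [X in _ * X]eq_bigr do under eq_bigr do rewrite mask_last.
move=> <-.
  apply: eq_bigr => t _; congr (_ * _); rewrite big_sumType/=.
  by congr (_ * _); apply: eq_bigr => i _; rewrite ffunE.
move=> [i|i] [i'|i']; rewrite !unfold_in /P/e/= => ji ji'.
- by case=> ->.
- case=> mm ii mk; move: (sep i' ji').
  by rewrite mm -[in mask i' x]ii mk eqxx.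
- case=> mm ii mk; move: (sep i ji).
  by rewrite -mm [in mask i x]ii -mk eqxx.
- by case=> ->.
Qed.

(** Mean of the density when the output is caused by [x], while the tested second input is drawn
    independently given [x']. *)
Definition letter_gain (d : V -> X1 -> X2 -> Y -> R) v x x' : R :=
  \sum_y (\sum_z Q x z * W x z y) * (\sum_z Q x' z * d v x' z y).

Section density.
Variable d : V -> X1 -> X2 -> Y -> R.
Hypothesis d0 : forall v x z y, 0 <= d v x z y.

Lemma letter_gain_ge0 v x x' : 0 <= letter_gain d v x x'.
Proof.
apply: sumr_ge0 => y _; rewrite mulr_ge0//; apply: sumr_ge0 => z _.
  by rewrite mulr_ge0 ?((Qd _).1) ?((Wd _ _).1).
by rewrite mulr_ge0 ?((Qd _).1).
Qed.

(** Markov's inequality replaces the test by the product of densities. Its mean factors over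
    positions since the branches are independent from [j] on, and before [j] the inputs and outputs
    sum to 1. *)
Lemma tree_word_false_accept (j : nat) m v x m' x' (tau : R) :
  (forall i : 'I_n, (j <= i)%N -> (m, mask i x) != (m', mask i x')) ->
  \sum_t tree_law t *
    (\sum_y prod_law (fun i => W (x i) (tree_word t m x i)) y *
      (expR tau <= \prod_(i < n | (j <= i)%N)
          d (v i) (x' i) (tree_word t m' x' i) (y i))%R%:R) <=
  expR (- tau) * \prod_(i < n | (j <= i)%N) letter_gain d (v i) (x i) (x' i).
Proof.
move=> sep.
apply: (@le_trans _ _ (\sum_t tree_law t *
    (\sum_y prod_law (fun i => W (x i) (tree_word t m x i)) y *
      ((expR tau)^-1 * \prod_(i < n | (j <= i)%N)
          d (v i) (x' i) (tree_word t m' x' i) (y i))))).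
  apply: ler_sum => t _; rewrite ler_wpM2l ?tree_law_ge0//.
  apply: ler_sum => y _; rewrite ler_wpM2l//.
    by apply: prod_law_ge0 => i a; case: (Wd (x i) (tree_word t m x i)).
  by apply: markov_indicator; rewrite ?expR_gt0// prodr_ge0.
rewrite -expRN.
under eq_bigr do rewrite mulr_sumr.
rewrite exchange_big/=.
under eq_bigr => y _.
  rewrite (eq_bigr (fun t => expR (- tau) * (tree_law t *
    ((\prod_i W (x i) (tree_word t m x i) (y i)) *
      \prod_(i < n | (j <= i)%N) d (v i) (x' i) (tree_word t m' x' i) (y i))))); last first.
    by move=> t _; rewrite [RHS]mulrCA; congr (_ * _); rewrite [RHS]mulrCA.
  rewrite -mulr_sumr (tree_word_pair_law (fun i z => W (x i) z (y i))
    (fun i z => d (v i) (x' i) z (y i)) sep).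
  over.
rewrite -mulr_sumr ler_wpM2l ?expR_ge0//.
under [X in X <= _]eq_bigr => y _ do
  rewrite [X in _ * X]big_mkcond/= -big_split/=.
rewrite -(bigA_distr_bigA (fun i y => (\sum_z Q (x i) z * W (x i) z y) *
   (if (j <= i)%N then \sum_z Q (x' i) z * d (v i) (x' i) z y else 1))).
rewrite [X in _ <= X]big_mkcond; apply: le_of_eq.
apply: eq_bigr => i _; case: ifP => // _.
under eq_bigr do rewrite mulr1.
rewrite exchange_big/= -[RHS](Qd (x i)).2; apply: eq_bigr => z _.
by rewrite -mulr_sumr (Wd _ _).2 mulr1.
Qed.

Section wrong_word.
Variable kap : V -> X1 -> R.
Hypothesis kap0 : forall v x, 0 <= kap v x.
Hypothesis gain_le1 :
  \sum_(c : V * X1) pv c.1 * k c.1 c.2 *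
    (\sum_x' kap c.1 x' * letter_gain d c.1 c.2 x') <= 1.

Local Notation average F := (\sum_(v : word V) prod_law (fun=> pv) v *
  \sum_(x : word X1) prod_law (fun i => k (v i)) x *
    \sum_(x' : word X1) prod_law (fun i => kap (v i)) x' * F v x x').

Lemma average_le F G : (forall v x x', F v x x' <= G v x x') ->
  average F <= average G.
Proof.
move=> FG; apply: ler_sum => v _; rewrite ler_wpM2l//.
  by apply: prod_law_ge0 => i a; case: pvd.
apply: ler_sum => x _; rewrite ler_wpM2l//.
  by apply: prod_law_ge0 => i a; case: (kd (v i)).
by apply: ler_sum => x' _; rewrite ler_wpM2l// prod_law_ge0.
Qed.

(** Repeating the first [j] letters of [x] has probability [\prod kap] at [x] itself, which the
    indicator caps by [a]; each later position has mean gain at most 1. The letter law [kap] of the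
    wrong word will be [k] in the same cloud and the marginal of X1 in another cloud. *)
Lemma agreeing_word_gain (j : nat) (a : R) : 0 <= a ->
  average (fun (v : word V) (x x' : word X1) => [forall (i : 'I_n | (i < j)%N), x i == x' i]%:R *
     (\prod_(i < n | (i < j)%N) kap (v i) (x i) <= a)%R%:R *
     \prod_(i < n | (j <= i)%N) letter_gain d (v i) (x i) (x' i)) <= a.
Proof.
move=> a0.
pose g v x := \sum_x' kap v x' * letter_gain d v x x'.
have g0 v x : 0 <= g v x by apply: sumr_ge0 => x' _; rewrite mulr_ge0// letter_gain_ge0.
apply: (@le_trans _ _ (\sum_(v : word V) prod_law (fun=> pv) v *
  \sum_(x : word X1) prod_law (fun i => k (v i)) x *
    (a * \prod_(i < n | (j <= i)%N) g (v i) (x i)))).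
  apply: ler_sum => v _; rewrite ler_wpM2l//.
    by apply: prod_law_ge0 => i b; case: pvd.
  apply: ler_sum => x _; rewrite ler_wpM2l//.
    by apply: prod_law_ge0 => i b; case: (kd (v i)).
  rewrite [X in X <= _](_ : _ = (\prod_(i < n | (i < j)%N) kap (v i) (x i) <= a)%R%:R *
     (\prod_(i < n | (i < j)%N) kap (v i) (x i)) *
     \prod_(i < n | (j <= i)%N) g (v i) (x i)).
    rewrite ler_wpM2r ?prodr_ge0//.
    set b := \prod_(i < n | _) _.
    by case: (leP b a); rewrite ?mul1r ?mul0r.
  under eq_bigr do rewrite mulrAC mulrA mulrC.
  rewrite -mulr_sumr -mulrA; congr (_ * _).
  (* The sum over the wrong word factors: a position forced to agree leaves [kap] at the true
     letter, a free one leaves [g]. *)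
  transitivity (\prod_i \sum_x' kap (v i) x' *
     (if (i < j)%N then (x i == x')%R%:R else letter_gain d (v i) (x i) x')).
    rewrite (bigA_distr_bigA (fun i x' => kap (v i) x' *
      (if (i < j)%N then (x i == x')%R%:R else letter_gain d (v i) (x i) x'))).
    apply: eq_bigr => x' _; rewrite -prodr_indicator big_split/=; congr (_ * _).
    rewrite [RHS](bigID (fun i : 'I_n => (i < j)%N))/=; congr (_ * _).
      by apply: eq_bigr => i ->.
    by apply: eq_big => [i|i ij]; [rewrite leqNgt|rewrite ltnNge ij].
  rewrite (bigID (fun i : 'I_n => (i < j)%N))/=; congr (_ * _).
    apply: eq_bigr => i ->; rewrite (bigD1 (x i))//= eqxx mulr1 big1 ?addr0//.
    by move=> x' /negbTE; rewrite eq_sym => ->; rewrite mulr0.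
  by apply: eq_big => [i|i /negbTE ->]; rewrite -?leqNgt.
under eq_bigr do under eq_bigr do rewrite mulrCA.
under eq_bigr do rewrite -mulr_sumr mulrCA.
rewrite -mulr_sumr -[X in _ <= X]mulr1 ler_wpM2l//.
rewrite (sum_prod_law_pair (fun=> pv) (fun=> k)
  (fun v x => \prod_(i < n | (j <= i)%N) g (v i) (x i))).
under eq_bigr do under eq_bigr do rewrite !ffunE.
rewrite (sum_prod_law_prod (e := id) (fun _ c => g c.1 c.2))//; last first.
  by move=> _; rewrite sum_pair/= -[RHS]pvd.2; apply: eq_bigr => v _; rewrite -mulr_sumr (kd v).2 mulr1.
apply: prodr_ile1 => i _; rewrite gain_le1 andbT.
by apply: sumr_ge0 => c _; rewrite !mulr_ge0 ?pvd.1 ?(kd _).1.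
Qed.

(** Different messages of Encoder 2 separate the branches at once, whatever the two inputs of
    Encoder 1: this is divergence at position 0, with an empty prefix and [a = 1]. *)
Lemma wrong_word_accept m m' (tau : R) : m != m' ->
  average (fun (v : word V) (x x' : word X1) => \sum_t tree_law t *
    (\sum_y prod_law (fun i => W (x i) (tree_word t m x i)) y *
      (expR tau <= \prod_i d (v i) (x' i) (tree_word t m' x' i) (y i))%R%:R))
  <= expR (- tau).
Proof.
move=> mm'.
apply: (@le_trans _ _ (expR (- tau) * average (fun (v : word V) (x x' : word X1) =>
     [forall (i : 'I_n | (i < 0)%N), x i == x' i]%:R *
     (\prod_(i < n | (i < 0)%N) kap (v i) (x i) <= 1)%R%:R *
     \prod_(i < n | (0 <= i)%N) letter_gain d (v i) (x i) (x' i)))); last first.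
  by rewrite -[X in _ <= X]mulr1 ler_wpM2l ?expR_ge0// agreeing_word_gain.
rewrite [X in _ <= X]mulr_sumr; under [X in _ <= X]eq_bigr do rewrite mulrCA mulr_sumr.
under [X in _ <= X]eq_bigr do under eq_bigr do rewrite mulrCA mulr_sumr.
under [X in _ <= X]eq_bigr do under eq_bigr do under eq_bigr do rewrite mulrCA.
apply: average_le => v x x'.
have -> : [forall (i : 'I_n | (i < 0)%N), x i == x' i] by apply/forall_inP.
have -> : \prod_(i < n | (i < 0)%N) kap (v i) (x i) = 1 by rewrite big_pred0.
rewrite lexx !mul1r.
apply: (@tree_word_false_accept 0) => i _.
by rewrite xpair_eqE (negbTE mm').
Qed.

(** [j] is the first differing position; every later prefix contains it, so the branches never meet
    again. The value [n], whence ['I_n.+1], covers equal words: two satellites of a random codebook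
    may coincide. *)
Lemma divergence (x x' : word X1) : exists j : 'I_n.+1,
  [forall (i : 'I_n | (i < j)%N), x i == x' i] /\
  forall i : 'I_n, (j <= i)%N -> mask i x != mask i x'.
Proof.
have [/forallP xx|] := boolP [forall i, x i == x' i].
  exists ord_max; split; first by apply/forall_inP => i _; exact: xx.
  by move=> i /=; rewrite leqNgt ltn_ord.
rewrite negb_forall => /existsP[i0 xi0].
case: (arg_minnP (fun i : 'I_n => i : nat) (xi0 : [pred i | x i != x' i] i0)) => j /= xj jmin.
exists (widen_ord (leqnSn n) j); split.
  by apply/forall_inP => i /=; apply: contraTT => /jmin; rewrite -leqNgt.
move=> i /= ji; apply/eqP => /ffunP/(_ j); rewrite !ffunE ji => /eqP.
by rewrite (negbTE xj).
Qed.

(** Union bound over the position of divergence: the prefix test pays for the agreement before it,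
    the suffix test for the acceptance after it. *)
Lemma wrong_word_accept_same m (a tau : 'I_n.+1 -> R) : (forall j, 0 <= a j) ->
  average (fun (v : word V) (x x' : word X1) => \sum_t tree_law t *
    (\sum_y prod_law (fun i => W (x i) (tree_word t m x i)) y *
      ([forall j : 'I_n.+1, \prod_(i < n | (i < j)%N) kap (v i) (x i) <= a j] &&
       [forall j : 'I_n.+1, expR (tau j) <= \prod_(i < n | (j <= i)%N)
          d (v i) (x' i) (tree_word t m x' i) (y i)])%R%:R))
  <= \sum_j expR (- tau j) * a j.
Proof.
move=> a0.
apply: (@le_trans _ _ (\sum_j expR (- tau j) * average (fun (v : word V) (x x' : word X1) =>
     [forall (i : 'I_n | (i < j)%N), x i == x' i]%:R *
     (\prod_(i < n | (i < j)%N) kap (v i) (x i) <= a j)%R%:R *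
     \prod_(i < n | (j <= i)%N) letter_gain d (v i) (x i) (x' i)))); last first.
  by apply: ler_sum => j _; rewrite ler_wpM2l ?expR_ge0// agreeing_word_gain.
under [X in _ <= X]eq_bigr => j _ do rewrite mulr_sumr.
rewrite exchange_big/=.
under [X in _ <= X]eq_bigr => v _.
  under eq_bigr do rewrite mulrCA mulr_sumr.
  rewrite -mulr_sumr exchange_big/=.
  under eq_bigr => x _.
    under eq_bigr do rewrite mulrCA mulr_sumr.
    rewrite -mulr_sumr exchange_big/=.
    under eq_bigr => x' _.
      under eq_bigr do rewrite mulrCA.
      rewrite -mulr_sumr.
      over.
    over.
  over.
apply: average_le => v x x'.
have [j [agree sep]] := divergence x x'.
(* Only the term of the actual divergence is kept; the others are nonnegative. *)
rewrite (bigD1 j)//= [X in _ <= X + _]mulrCA -[X in X <= _]addr0 lerD//; last first.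
  apply: sumr_ge0 => l _; rewrite !mulr_ge0 ?expR_ge0// prodr_ge0// => i _.
  exact: letter_gain_ge0.
rewrite agree mul1r.
apply: (@le_trans _ _ ((\prod_(i < n | (i < j)%N) kap (v i) (x i) <= a j)%R%:R *
  \sum_t tree_law t *
    (\sum_y prod_law (fun i => W (x i) (tree_word t m x i)) y *
      (expR (tau j) <= \prod_(i < n | (j <= i)%N)
          d (v i) (x' i) (tree_word t m x' i) (y i))%R%:R))).
  rewrite mulr_sumr; apply: ler_sum => t _; rewrite mulrCA ler_wpM2l ?tree_law_ge0//.
  rewrite mulr_sumr; apply: ler_sum => y _; rewrite mulrCA ler_wpM2l//.
    by apply: prod_law_ge0 => i b; case: (Wd (x i) (tree_word t m x i)).
  rewrite -natrM ler_nat mulnb.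
  by case: andP => // -[/forallP/(_ j) -> /forallP/(_ j) ->].
rewrite ler_wpM2l//; apply: tree_word_false_accept => i ji.
by rewrite xpair_eqE negb_and sep// orbT.
Qed.

End wrong_word.
End density.
End tree_code.

(** * Random codebooks *)

Section word_sums.
Variables (R : realType) (V X1 X2 Y : finType) (n : nat).
Variables (pv : V -> R) (k : V -> X1 -> R) (Q : X1 -> X2 -> R) (W : X1 -> X2 -> Y -> R).
Hypotheses (pvd : is_dist pv) (kd : is_channel k) (Qd : is_channel Q) (Wd : is_mac W).

Local Notation word A := {ffun 'I_n -> A}.

Lemma sum_word_letter_law (G : word V -> word X1 -> word X2 -> word Y -> R) :
  \sum_v prod_law (fun=> pv) v * (\sum_x prod_law (fun i => k (v i)) x *
    (\sum_z prod_law (fun i => Q (x i)) z *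
      (\sum_y prod_law (fun i => W (x i) (z i)) y * G v x z y))) =
  \sum_(w : word (V * X1 * X2 * Y)) prod_law (fun=> letter_law pv k Q W) w *
    G [ffun i => letV (w i)] [ffun i => letX1 (w i)]
      [ffun i => letX2 (w i)] [ffun i => letY (w i)].
Proof.
rewrite (sum_prod_law_pair (fun=> pv) (fun=> k) (fun v x =>
  \sum_z prod_law (fun i => Q (x i)) z *
      (\sum_y prod_law (fun i => W (x i) (z i)) y * G v x z y))).
pose G2 (c : word (V * X1)) z y := G [ffun i => (c i).1] [ffun i => (c i).2] z y.
transitivity (\sum_c prod_law (fun=> fun a => pv a.1 * k a.1 a.2) c *
  \sum_z prod_law (fun i => Q (c i).2) z *
     \sum_y prod_law (fun i => W (c i).2 (z i)) y * G2 c z y).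
  apply: eq_bigr => c _; congr (_ * _); apply: eq_bigr => z _; congr (_ * _).
    by apply: eq_bigr => i _; rewrite ffunE.
  apply: eq_bigr => y _; congr (_ * _).
  by apply: eq_bigr => i _; rewrite ffunE.
rewrite (sum_prod_law_pair (fun=> fun a => pv a.1 * k a.1 a.2) (fun=> fun a z => Q a.2 z)
  (fun c z => \sum_y prod_law (fun i => W (c i).2 (z i)) y * G2 c z y)).
transitivity (\sum_(c : word (V * X1 * X2))
  prod_law (fun=> fun a => pv a.1.1 * k a.1.1 a.1.2 * Q a.1.2 a.2) c *
     \sum_y prod_law (fun i => W (c i).1.2 (c i).2) y *
       G [ffun i => (c i).1.1] [ffun i => (c i).1.2] [ffun i => (c i).2] y).
  apply: eq_bigr => c _; congr (_ * _); apply: eq_bigr => y _; congr (_ * _).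
    by apply: eq_bigr => i _; rewrite !ffunE.
  by congr G; apply/ffunP => i; rewrite !ffunE.
rewrite (sum_prod_law_pair (fun=> fun a => pv a.1.1 * k a.1.1 a.1.2 * Q a.1.2 a.2)
  (fun=> fun a y => W a.1.2 a.2 y) (fun c y =>
   G [ffun i => (c i).1.1] [ffun i => (c i).1.2] [ffun i => (c i).2] y)).
apply: eq_bigr => w _; congr (_ * _).
by congr G; apply/ffunP => i; rewrite !ffunE.
Qed.

(** Markov's inequality again: the mean of the product is a product of single-letter means, each at
    most 1 by change of measure. *)
Lemma independent_word_accept (A : finType) (q : A -> R)
    (d : A -> V * X1 * X2 * Y -> R) (tau : R) :
  (forall a, 0 <= q a) -> (forall a w, 0 <= d a w) ->
  \sum_w letter_law pv k Q W w * (\sum_a q a * d a w) <= 1 ->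
  \sum_(w : word (V * X1 * X2 * Y)) prod_law (fun=> letter_law pv k Q W) w *
    (\sum_(a : word A) prod_law (fun=> q) a *
      (expR tau <= \prod_i d (a i) (w i))%R%:R) <= expR (- tau).
Proof.
move=> q0 d0 le1.
have [P0 P1] := letter_law_dist pvd kd Qd Wd.
apply: (@le_trans _ _ (\sum_(w : word (V * X1 * X2 * Y))
    prod_law (fun=> letter_law pv k Q W) w * (expR (- tau) *
      \prod_i \sum_a q a * d a (w i)))).
  apply: ler_sum => w _; rewrite ler_wpM2l ?prod_law_ge0//.
  rewrite (bigA_distr_bigA (fun i a => q a * d a (w i))) mulr_sumr.
  apply: ler_sum => a _; rewrite big_split/= mulrCA ler_wpM2l ?prod_law_ge0//.
  by rewrite expRN; apply: markov_indicator; rewrite ?expR_gt0// prodr_ge0.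
under eq_bigr do rewrite mulrCA.
rewrite -mulr_sumr -[X in _ <= X]mulr1 ler_wpM2l ?expR_ge0//.
rewrite (sum_prod_law_prod (e := id) (fun _ c => \sum_a q a * d a c))//.
apply: prodr_ile1 => i _; rewrite le1 andbT.
by apply: sumr_ge0 => c _; rewrite mulr_ge0 ?P0// sumr_ge0// => a _; rewrite mulr_ge0.
Qed.

(** The case where only the message of Encoder 2 is wrong: the tested first input is the true [x],
    yet its two branches are independent at every position. *)
Lemma wrong_tree_accept (M : finType) (x0 : X1) (d : V -> X1 -> X2 -> Y -> R)
    (m m' : M) (tau : R) :
  (forall v x z y, 0 <= d v x z y) ->
  \sum_(c : V * X1) pv c.1 * k c.1 c.2 * letter_gain Q W d c.1 c.2 c.2 <= 1 ->
  m != m' ->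
  \sum_(v : word V) prod_law (fun=> pv) v *
  (\sum_(x : word X1) prod_law (fun i => k (v i)) x *
   (\sum_t tree_law Q t *
    (\sum_y prod_law (fun i => W (x i) (tree_word x0 t m x i)) y *
      (expR tau <= \prod_i d (v i) (x i) (tree_word x0 t m' x i) (y i))%R%:R)))
  <= expR (- tau).
Proof.
move=> d0 le1 mm'.
apply: (@le_trans _ _ (\sum_(v : word V) prod_law (fun=> pv) v *
  (\sum_(x : word X1) prod_law (fun i => k (v i)) x *
    (expR (- tau) * \prod_i letter_gain Q W d (v i) (x i) (x i))))).
  apply: ler_sum => v _; rewrite ler_wpM2l//.
    by apply: prod_law_ge0 => i a; case: pvd.
  apply: ler_sum => x _; rewrite ler_wpM2l//.
    by apply: prod_law_ge0 => i a; case: (kd (v i)).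
  apply: (@tree_word_false_accept R V X1 X2 Y M n Q W Qd Wd x0 d d0 0) => i _.
  by rewrite xpair_eqE (negbTE mm').
under eq_bigr do under eq_bigr do rewrite mulrCA.
under eq_bigr do rewrite -mulr_sumr mulrCA.
rewrite -mulr_sumr -[X in _ <= X]mulr1 ler_wpM2l ?expR_ge0//.
rewrite (sum_prod_law_pair (fun=> pv) (fun=> k)
  (fun v x => \prod_(i < n) letter_gain Q W d (v i) (x i) (x i))).
under eq_bigr do under eq_bigr do rewrite !ffunE.
rewrite (sum_prod_law_prod (e := id) (fun _ c => letter_gain Q W d c.1 c.2 c.2))//; last first.
  by move=> _; rewrite sum_pair/= -[RHS]pvd.2; apply: eq_bigr => v _; rewrite -mulr_sumr (kd v).2 mulr1.
apply: prodr_ile1 => i _; rewrite le1 andbT.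
by apply: sumr_ge0 => c _; rewrite !mulr_ge0 ?pvd.1 ?(kd _).1 ?letter_gain_ge0.
Qed.

End word_sums.

(** * Superposition codebooks: clouds and satellites *)

Section codebook.
Variables (R : realType) (V X1 M1 M1' : finType) (n : nat).
Variables (pv : V -> R) (k : V -> X1 -> R).
Hypotheses (pvd : is_dist pv) (kd : is_channel k).

Local Notation word A := {ffun 'I_n -> A}.

Definition cloud_law (vb : {ffun M1 -> word V}) : R :=
  prod_law (fun=> prod_law (fun=> pv)) vb.

Definition satellite_law (vb : {ffun M1 -> word V})
    (xb : {ffun M1 * M1' -> word X1}) : R :=
  prod_law (fun m => prod_law (fun i => k (vb m.1 i))) xb.

Lemma cloud_law_ge0 vb : 0 <= cloud_law vb.
Proof. by apply: prod_law_ge0 => m v; apply: prod_law_ge0 => i a; case: pvd. Qed.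

Lemma satellite_law_ge0 vb xb : 0 <= satellite_law vb xb.
Proof.
by apply: prod_law_ge0 => m x; apply: prod_law_ge0 => i a; case: (kd (vb m.1 i)).
Qed.

Lemma sum_cloud : forall m : M1, \sum_(v : word V) prod_law (fun=> pv) v = 1.
Proof. by move=> _; apply: sum_prod_law => _; case: pvd. Qed.

Lemma sum_satellite (vb : {ffun M1 -> word V}) : forall m : M1 * M1',
  \sum_(x : word X1) prod_law (fun i => k (vb m.1 i)) x = 1.
Proof. by move=> m; apply: sum_prod_law => i; case: (kd (vb m.1 i)). Qed.

Lemma codebook_law m1 m1' (G : word V -> word X1 -> R) :
  \sum_vb cloud_law vb * (\sum_xb satellite_law vb xb * G (vb m1) (xb (m1, m1'))) =
  \sum_v prod_law (fun=> pv) v * (\sum_x prod_law (fun i => k (v i)) x * G v x).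
Proof.
under eq_bigr => vb _ do rewrite /satellite_law
  (sum_prod_law1 (m1, m1') (G (vb m1)) (sum_satellite vb)).
exact: (sum_prod_law1 m1 (fun v : word V => \sum_x prod_law (fun i => k (v i)) x * G v x) sum_cloud).
Qed.

Lemma codebook_law_same m1 m1' m2' (G : word V -> word X1 -> word X1 -> R) :
  m1' != m2' ->
  \sum_vb cloud_law vb * (\sum_xb satellite_law vb xb *
     G (vb m1) (xb (m1, m1')) (xb (m1, m2'))) =
  \sum_v prod_law (fun=> pv) v * (\sum_x prod_law (fun i => k (v i)) x *
    (\sum_x' prod_law (fun i => k (v i)) x' * G v x x')).
Proof.
move=> mm'.
have ne : (m1, m1') != (m1, m2') by rewrite xpair_eqE eqxx.
under eq_bigr => vb _ do rewrite /satellite_law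
  (sum_prod_law2 (G (vb m1)) (sum_satellite vb) ne).
exact: (sum_prod_law1 m1 (fun v : word V => \sum_x prod_law (fun i => k (v i)) x *
    (\sum_x' prod_law (fun i => k (v i)) x' * G v x x')) sum_cloud).
Qed.

Lemma codebook_law_diff m1 m2 m1' m2' (G : word V -> word V -> word X1 -> word X1 -> R) :
  m1 != m2 ->
  \sum_vb cloud_law vb * (\sum_xb satellite_law vb xb *
     G (vb m1) (vb m2) (xb (m1, m1')) (xb (m2, m2'))) =
  \sum_v prod_law (fun=> pv) v * (\sum_v' prod_law (fun=> pv) v' *
   (\sum_x prod_law (fun i => k (v i)) x *
    (\sum_x' prod_law (fun i => k (v' i)) x' * G v v' x x'))).
Proof.
move=> mm.
have ne : (m1, m1') != (m2, m2') by rewrite xpair_eqE (negbTE mm).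
under eq_bigr => vb _ do rewrite /satellite_law
  (sum_prod_law2 (G (vb m1) (vb m2)) (sum_satellite vb) ne).
exact: (sum_prod_law2 (fun v v' : word V => \sum_x prod_law (fun i => k (v i)) x *
    (\sum_x' prod_law (fun i => k (v' i)) x' * G v v' x x')) sum_cloud mm).
Qed.

(** Averaging over an independent cloud centre leaves its satellite with the i.i.d. marginal law of
    X1. This is where H(X1) replaces H(X1|V). *)
Lemma codebook_law_diff_satellite m1 m2 m1' m2' (G : word V -> word X1 -> word X1 -> R) :
  m1 != m2 ->
  \sum_vb cloud_law vb * (\sum_xb satellite_law vb xb *
     G (vb m1) (xb (m1, m1')) (xb (m2, m2'))) =
  \sum_v prod_law (fun=> pv) v * (\sum_x prod_law (fun i => k (v i)) x *
    (\sum_x' prod_law (fun=> marg1 pv k) x' * G v x x')).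
Proof.
move=> mm; rewrite (codebook_law_diff _ _ (fun v _ x x' => G v x x') mm).
apply: eq_bigr => v _; congr (_ * _).
under eq_bigr do rewrite mulr_sumr.
rewrite exchange_big/=; apply: eq_bigr => x _.
under eq_bigr do rewrite mulrCA.
rewrite -mulr_sumr; congr (_ * _).
under [LHS]eq_bigr do rewrite mulr_sumr.
rewrite exchange_big/=; apply: eq_bigr => x' _.
under [LHS]eq_bigr do rewrite mulrA.
rewrite -mulr_suml; congr (_ * _).
rewrite /prod_law (bigA_distr_bigA (fun i v' => pv v' * k v' (x' i))).
by apply: eq_bigr => v' _; rewrite big_split.
Qed.

Lemma codebook_law_diff_cloud m1 m2 m1' (G : word V -> word V -> word X1 -> R) :
  m1 != m2 ->
  \sum_vb cloud_law vb * (\sum_xb satellite_law vb xb *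
     G (vb m1) (vb m2) (xb (m1, m1'))) =
  \sum_v prod_law (fun=> pv) v * (\sum_v' prod_law (fun=> pv) v' *
   (\sum_x prod_law (fun i => k (v i)) x * G v v' x)).
Proof.
move=> mm; rewrite (codebook_law_diff m1' m1' (fun v v' x _ => G v v' x) mm).
apply: eq_bigr => v _; congr (_ * _); apply: eq_bigr => v' _; congr (_ * _).
apply: eq_bigr => x _; congr (_ * _); rewrite -mulr_suml sum_prod_law ?mul1r// => i.
by case: (kd (v' i)).
Qed.

End codebook.

Definition decode (M : finType) (m0 : M) (acc : pred M) : M :=
  odflt m0 [pick m | acc m].

(** The terms of the union bound keep [acc m] beside [acc m']: the tests passed by the true
    codeword, its prefix tests above all, remain available when a wrong one is bounded. *)
Lemma decode_error (R : realType) (M : finType) (m0 m : M) (acc : pred M) :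
  (decode m0 acc != m)%:R <=
  (~~ acc m)%:R + \sum_(m' | m' != m) (acc m && acc m')%:R :> R.
Proof.
have s0 : 0 <= \sum_(m' | m' != m) (acc m && acc m')%:R :> R by apply: sumr_ge0.
have [am|am] := boolP (acc m); last first.
  by rewrite /= (le_trans (y := 1)) ?lern1 ?leq_b1// lerDl sumr_ge0.
rewrite /= add0r /decode; case: pickP => [m' am'|/(_ m)]; last by rewrite am.
rewrite /=; have [_|m'm] := eqVneq m' m => /=.
  exact: sumr_ge0.
by rewrite (bigD1 m')//= am' lerDl sumr_ge0.
Qed.

Lemma random_decoding_error (R : realType) (B M Y : finType) (w : B -> R)
    (L : B -> Y -> R) (m0 m : M) (acc : B -> Y -> pred M) :
  (forall b, 0 <= w b) -> (forall b y, 0 <= L b y) ->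
  \sum_b w b * (\sum_y L b y * (decode m0 (acc b y) != m)%:R) <=
  \sum_b w b * (\sum_y L b y * (~~ acc b y m)%:R) +
  \sum_(m' | m' != m) \sum_b w b * (\sum_y L b y * (acc b y m && acc b y m')%:R).
Proof.
move=> w0 L0; rewrite exchange_big/= -big_split/=; apply: ler_sum => b _.
rewrite -mulr_sumr -mulrDr ler_wpM2l// exchange_big/= -big_split/=.
apply: ler_sum => y _; rewrite -mulr_sumr -mulrDr ler_wpM2l//.
exact: decode_error.
Qed.

Lemma sum_eq1 (R : realType) (M : finType) (m : M) : \sum_a (a == m)%:R = 1 :> R.
Proof. by rewrite (bigD1 m)//= eqxx big1 ?addr0// => a /negbTE ->. Qed.

Lemma sum_neq1 (R : realType) (M : finType) (m : M) :
  \sum_a (a != m)%:R = #|M|%:R - 1 :> R.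
Proof.
rewrite -[#|M|%:R]sumr_const -[X in _ - X](sum_eq1 R m) -sumrB.
by apply: eq_bigr => a _; case: eqP; rewrite ?subrr ?subr0.
Qed.

Lemma sum_pair_prod (R : realType) (A B : finType) (f : A -> R) (g : B -> R) :
  \sum_(m : A * B) f m.1 * g m.2 = (\sum_a f a) * (\sum_b g b).
Proof.
rewrite sum_pair/= mulr_suml; apply: eq_bigr => a _; rewrite mulr_sumr//.
Qed.

(** * Decoding error with cribbing *)

Section cribbing_error.
Variables (R : realType) (V X1 X2 Y M1 M1' M2 : finType) (n : nat).
Variables (pv : V -> R) (k : V -> X1 -> R) (Q : X1 -> X2 -> R) (W : X1 -> X2 -> Y -> R).
Hypotheses (pvd : is_dist pv) (kd : is_channel k) (Qd : is_channel Q) (Wd : is_mac W).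
Variable x0 : X1.

Local Notation word A := {ffun 'I_n -> A}.
Local Notation tree := {ffun tree_index X1 M2 n -> X2}.

Definition crib_book : finType :=
  ({ffun M1 -> word V} * {ffun M1 * M1' -> word X1} * tree)%type.

Definition crib_weight (b : crib_book) : R :=
  cloud_law pv b.1.1 * satellite_law k b.1.1 b.1.2 * tree_law Q b.2.

Definition crib_input (b : crib_book) (m : M1 * M1' * M2) : word X2 :=
  tree_word x0 b.2 m.2 (b.1.2 m.1).

Definition crib_output (b : crib_book) (m : M1 * M1' * M2) (y : word Y) : R :=
  prod_law (fun i => W (b.1.2 m.1 i) (crib_input b m i)) y.

Lemma crib_weight_ge0 b : 0 <= crib_weight b.
Proof.
by rewrite /crib_weight !mulr_ge0 ?cloud_law_ge0 ?satellite_law_ge0 ?tree_law_ge0.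
Qed.

Lemma crib_output_ge0 b m y : 0 <= crib_output b m y.
Proof. by apply: prod_law_ge0 => i a; case: (Wd (b.1.2 m.1 i) (crib_input b m i)). Qed.

Lemma sum_crib_weight (F : crib_book -> R) :
  \sum_b crib_weight b * F b =
  \sum_vb cloud_law pv vb * (\sum_xb satellite_law k vb xb *
    (\sum_t tree_law Q t * F (vb, xb, t))).
Proof.
rewrite sum_pair/= sum_pair/=; apply: eq_bigr => vb _; rewrite mulr_sumr.
apply: eq_bigr => xb _; rewrite mulrA mulr_sumr; apply: eq_bigr => t _.
by rewrite mulrA.
Qed.

Variable accept : word V -> word X1 -> word X2 -> word Y -> bool.

Definition crib_accept (b : crib_book) (y : word Y) : pred (M1 * M1' * M2) :=
  fun m => accept (b.1.1 m.1.1) (b.1.2 m.1) (crib_input b m) y.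

Lemma sum_crib_reject m :
  \sum_b crib_weight b * (\sum_y crib_output b m y * (~~ crib_accept b y m)%:R) =
  \sum_v prod_law (fun=> pv) v * (\sum_x prod_law (fun i => k (v i)) x *
    (\sum_z prod_law (fun i => Q (x i)) z *
      (\sum_y prod_law (fun i => W (x i) (z i)) y * (~~ accept v x z y)%:R))).
Proof.
rewrite sum_crib_weight; case: m => [[m1 m1'] m2].
rewrite (codebook_law pvd kd m1 m1' (fun v x => \sum_t tree_law Q t *
   \sum_y prod_law (fun i => W (x i) (tree_word x0 t m2 x i)) y *
     (~~ accept v x (tree_word x0 t m2 x) y)%:R)).
apply: eq_bigr => v _; congr (_ * _); apply: eq_bigr => x _; congr (_ * _).
by rewrite (tree_word_law Qd x0 m2 x (fun z => \sum_y prod_law (fun i => W (x i) (z i)) y *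
     (~~ accept v x z y)%:R)).
Qed.

Definition crib_confusion m m' : R :=
  \sum_b crib_weight b *
    (\sum_y crib_output b m y * (crib_accept b y m && crib_accept b y m')%:R).

Variables (dA dB : V -> X1 -> X2 -> Y -> R) (dC : X1 -> X2 -> Y -> R) (tauA : R) (tauB tauC aB aC : 'I_n.+1 -> R).
Hypothesis dA0 : forall v x z y, 0 <= dA v x z y.
Hypothesis dB0 : forall v x z y, 0 <= dB v x z y.
Hypothesis dC0 : forall x z y, 0 <= dC x z y.
Hypothesis aB0 : forall j, 0 <= aB j.
Hypothesis aC0 : forall j, 0 <= aC j.
Let q := marg1 pv k.
Hypothesis gainA :
  \sum_(c : V * X1) pv c.1 * k c.1 c.2 * letter_gain Q W dA c.1 c.2 c.2 <= 1.
Hypothesis gainB : \sum_(c : V * X1) pv c.1 * k c.1 c.2 *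
    (\sum_x' k c.1 x' * letter_gain Q W dB c.1 c.2 x') <= 1.
Hypothesis gainC : \sum_(c : V * X1) pv c.1 * k c.1 c.2 *
    (\sum_x' q x' * letter_gain Q W (fun=> dC) c.1 c.2 x') <= 1.
Hypothesis acceptA : forall v x z y, accept v x z y ->
  expR tauA <= \prod_i dA (v i) (x i) (z i) (y i).
Hypothesis acceptB : forall v x z y, accept v x z y -> forall j : 'I_n.+1,
  expR (tauB j) <= \prod_(i < n | (j <= i)%N) dB (v i) (x i) (z i) (y i) /\
  \prod_(i < n | (i < j)%N) k (v i) (x i) <= aB j.
Hypothesis acceptC : forall v x z y, accept v x z y -> forall j : 'I_n.+1,
  expR (tauC j) <= \prod_(i < n | (j <= i)%N) dC (x i) (z i) (y i) /\
  \prod_(i < n | (i < j)%N) q (x i) <= aC j.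

(** A: only the message of Encoder 2 is wrong. B: right cloud, wrong satellite. C: wrong cloud. In B
    and C the prime marks a right message of Encoder 2, where the branches may share a beginning. *)
Let errA := expR (- tauA).
Let errB := expR (- tauB ord0).
Let errB' := \sum_j expR (- tauB j) * aB j.
Let errC := expR (- tauC ord0).
Let errC' := \sum_j expR (- tauC j) * aC j.

Lemma crib_confusion_le (F : word V -> word X1 -> word X2 -> word X1 -> word X2 -> word Y -> bool) m m' :
  (forall b y, crib_accept b y m -> crib_accept b y m' ->
     F (b.1.1 m.1.1) (b.1.2 m.1) (crib_input b m) (b.1.2 m'.1) (crib_input b m') y) ->
  crib_confusion m m' <=
  \sum_vb cloud_law pv vb * (\sum_xb satellite_law k vb xb *
    (\sum_t tree_law Q t * (\sum_y prod_law
       (fun i => W (xb m.1 i) (tree_word x0 t m.2 (xb m.1) i)) y *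
      (F (vb m.1.1) (xb m.1) (tree_word x0 t m.2 (xb m.1))
         (xb m'.1) (tree_word x0 t m'.2 (xb m'.1)) y)%:R))).
Proof.
move=> FP; rewrite /crib_confusion sum_crib_weight.
apply: ler_sum => vb _; rewrite ler_wpM2l ?cloud_law_ge0//.
apply: ler_sum => xb _; rewrite ler_wpM2l ?satellite_law_ge0//.
apply: ler_sum => t _; rewrite ler_wpM2l ?tree_law_ge0//.
apply: ler_sum => y _; rewrite ler_wpM2l ?crib_output_ge0// ler_nat.
case: andP => // -[a a']; by have := FP (vb, xb, t) y a a'; rewrite /crib_input/= => ->.
Qed.

Lemma confusion_cribber m1 m1' m2 m2' : m2 != m2' ->
  crib_confusion (m1, m1', m2) (m1, m1', m2') <= errA.
Proof.
move=> mm'.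
apply: (le_trans (crib_confusion_le (F := fun v x z x' z' y =>
  expR tauA <= \prod_i dA (v i) (x i) (z' i) (y i)) _)).
  by move=> b y _ /acceptA.
rewrite (codebook_law pvd kd m1 m1' (fun v x => \sum_t tree_law Q t *
   (\sum_y prod_law (fun i => W (x i) (tree_word x0 t m2 x i)) y *
     (expR tauA <= \prod_i dA (v i) (x i) (tree_word x0 t m2' x i) (y i))%R%:R))).
exact: wrong_tree_accept.
Qed.

Lemma confusion_satellite m1 m1' m2' m2 m2'' : m1' != m2' -> m2 != m2'' ->
  crib_confusion (m1, m1', m2) (m1, m2', m2'') <= errB.
Proof.
move=> mm' mm2.
apply: (le_trans (crib_confusion_le (F := fun v x z x' z' y =>
  expR (tauB ord0) <= \prod_i dB (v i) (x' i) (z' i) (y i)) _)).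
  by move=> b y _ /acceptB/(_ ord0)[].
rewrite (codebook_law_same pvd kd m1 (fun v x x' => \sum_t tree_law Q t *
   (\sum_y prod_law (fun i => W (x i) (tree_word x0 t m2 x i)) y *
     (expR (tauB ord0) <= \prod_i dB (v i) (x' i) (tree_word x0 t m2'' x' i) (y i))%R%:R)) mm').
apply: wrong_word_accept => // v x; exact: (kd v).1.
Qed.

(** The prefix condition comes from acceptance of the true message, the suffix condition from
    acceptance of the wrong one. *)
Lemma confusion_satellite_same m1 m1' m2' m2 : m1' != m2' ->
  crib_confusion (m1, m1', m2) (m1, m2', m2) <= errB'.
Proof.
move=> mm'.
apply: (le_trans (crib_confusion_le (F := fun v x z x' z' y =>
  [forall j : 'I_n.+1, \prod_(i < n | (i < j)%N) k (v i) (x i) <= aB j] &&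
  [forall j : 'I_n.+1, expR (tauB j) <= \prod_(i < n | (j <= i)%N)
    dB (v i) (x' i) (z' i) (y i)]) _)).
  by move=> b y /acceptB a /acceptB a'; apply/andP; split; apply/forallP => j;
    [case: (a j)|case: (a' j)].
rewrite (codebook_law_same pvd kd m1 (fun v x x' => \sum_t tree_law Q t *
   (\sum_y prod_law (fun i => W (x i) (tree_word x0 t m2 x i)) y *
   ([forall j : 'I_n.+1, \prod_(i < n | (i < j)%N) k (v i) (x i) <= aB j] &&
  [forall j : 'I_n.+1, expR (tauB j) <= \prod_(i < n | (j <= i)%N)
    dB (v i) (x' i) (tree_word x0 t m2 x' i) (y i)])%:R)) mm').
apply: wrong_word_accept_same => // v x; exact: (kd v).1.
Qed.

Lemma marg1_ge0 x : 0 <= q x.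
Proof. by case: (marg1_dist pvd kd). Qed.

Lemma confusion_cloud m1 m1' m2 n1 n1' n2 : m1 != n1 -> m2 != n2 ->
  crib_confusion (m1, m1', m2) (n1, n1', n2) <= errC.
Proof.
move=> mm' mm2.
apply: (le_trans (crib_confusion_le (F := fun v x z x' z' y =>
  expR (tauC ord0) <= \prod_i dC (x' i) (z' i) (y i)) _)).
  by move=> b y _ /acceptC/(_ ord0)[].
rewrite (codebook_law_diff_satellite pvd kd m1' n1' (fun v x x' => \sum_t tree_law Q t *
   (\sum_y prod_law (fun i => W (x i) (tree_word x0 t m2 x i)) y *
     (expR (tauC ord0) <= \prod_i dC (x' i) (tree_word x0 t n2 x' i) (y i))%R%:R)) mm').
apply: (@wrong_word_accept R V X1 X2 Y M2 n pv k Q W pvd kd Qd Wd x0 (fun=> dC) _ (fun=> q)) => //.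
by move=> _ x; exact: marg1_ge0.
Qed.

Lemma confusion_cloud_same m1 m1' m2 n1 n1' : m1 != n1 ->
  crib_confusion (m1, m1', m2) (n1, n1', m2) <= errC'.
Proof.
move=> mm'.
apply: (le_trans (crib_confusion_le (F := fun v x z x' z' y =>
  [forall j : 'I_n.+1, \prod_(i < n | (i < j)%N) q (x i) <= aC j] &&
  [forall j : 'I_n.+1, expR (tauC j) <= \prod_(i < n | (j <= i)%N)
    dC (x' i) (z' i) (y i)]) _)).
  by move=> b y /acceptC a /acceptC a'; apply/andP; split; apply/forallP => j;
    [case: (a j)|case: (a' j)].
rewrite (codebook_law_diff_satellite pvd kd m1' n1' (fun v x x' => \sum_t tree_law Q t *
   (\sum_y prod_law (fun i => W (x i) (tree_word x0 t m2 x i)) y *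
   ([forall j : 'I_n.+1, \prod_(i < n | (i < j)%N) q (x i) <= aC j] &&
  [forall j : 'I_n.+1, expR (tauC j) <= \prod_(i < n | (j <= i)%N)
    dC (x' i) (tree_word x0 t m2 x' i) (y i)])%:R)) mm').
apply: (@wrong_word_accept_same R V X1 X2 Y M2 n pv k Q W pvd kd Qd Wd x0 (fun=> dC) _ (fun=> q)) => //.
by move=> _ x; exact: marg1_ge0.
Qed.

(** One factor per message component, a neutral 1 included, lets the sum over [m'] factor. The terms
    with [errC] and [errB] also count a right message of Encoder 2; this only enlarges the bound. *)
Lemma crib_confusion_bound m m' : m' != m ->
  crib_confusion m m' <=
    ((m'.1.1 != m.1.1)%:R * 1 * 1 * errC +
     (m'.1.1 != m.1.1)%:R * 1 * (m'.2 == m.2)%:R * errC') +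
    ((m'.1.1 == m.1.1)%:R * (m'.1.2 != m.1.2)%:R * 1 * errB +
     (m'.1.1 == m.1.1)%:R * (m'.1.2 != m.1.2)%:R * (m'.2 == m.2)%:R * errB') +
    (m'.1.1 == m.1.1)%:R * (m'.1.2 == m.1.2)%:R * (m'.2 != m.2)%:R * errA.
Proof.
have eA : 0 <= errA by exact: expR_ge0.
have eB : 0 <= errB by exact: expR_ge0.
have eC : 0 <= errC by exact: expR_ge0.
have eB' : 0 <= errB' by apply: sumr_ge0 => j _; rewrite mulr_ge0 ?expR_ge0.
have eC' : 0 <= errC' by apply: sumr_ge0 => j _; rewrite mulr_ge0 ?expR_ge0.
case: m m' => [[m1 m1'] m2] [[n1 n1'] n2] /=; rewrite !xpair_eqE.
have [->|nm1] := eqVneq n1 m1; have [->|nm1'] := eqVneq n1' m1';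
  have [->|nm2] := eqVneq n2 m2; rewrite //= ?mul1r ?mul0r ?mulr0 ?mul0r ?add0r ?addr0 => _.
- by apply: confusion_cribber; rewrite eq_sym.
- apply: le_trans (confusion_satellite_same _ _ _) _; rewrite 1?eq_sym//.
  by rewrite lerDr.
- by apply: confusion_satellite; rewrite eq_sym.
- apply: le_trans (confusion_cloud_same _ _ _ _) _; rewrite 1?eq_sym//.
  by rewrite lerDr.
- by apply: confusion_cloud; rewrite eq_sym.
- apply: le_trans (confusion_cloud_same _ _ _ _) _; rewrite 1?eq_sym//.
  by rewrite lerDr.
- by apply: confusion_cloud; rewrite eq_sym.
Qed.

Lemma crib_error_le (m0 m : M1 * M1' * M2) (F : R) :
  \sum_v prod_law (fun=> pv) v * (\sum_x prod_law (fun i => k (v i)) x *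
    (\sum_z prod_law (fun i => Q (x i)) z *
      (\sum_y prod_law (fun i => W (x i) (z i)) y * (~~ accept v x z y)%:R))) <= F ->
  \sum_b crib_weight b *
    (\sum_y crib_output b m y * (decode m0 (crib_accept b y) != m)%:R) <=
  F + (((#|M1|%:R - 1) * #|M1'|%:R * #|M2|%:R * errC +
       (#|M1|%:R - 1) * #|M1'|%:R * errC') +
       ((#|M1'|%:R - 1) * #|M2|%:R * errB + (#|M1'|%:R - 1) * errB') +
       (#|M2|%:R - 1) * errA).
Proof.
move=> rej.
apply: (le_trans (random_decoding_error _ _ _ _ _)).
- exact: crib_weight_ge0.
- by move=> b y; exact: crib_output_ge0.
rewrite lerD ?sum_crib_reject//.
have conf m' := crib_confusion_bound (m := m) (m' := m').
apply: (le_trans (ler_sum _ conf)).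
rewrite big_mkcond/=.
pose S (f : M1 -> R) (g : M1' -> R) (h : M2 -> R) e :=
  \sum_(m' : M1 * M1' * M2) f m'.1.1 * g m'.1.2 * h m'.2 * e.
have SE f g h e : S f g h e = (\sum_a f a) * (\sum_a g a) * (\sum_a h a) * e.
  rewrite /S -mulr_suml (sum_pair_prod (fun a => f a.1 * g a.2)).
  by rewrite sum_pair_prod.
have one (M : finType) : \sum_(a : M) 1 = #|M|%:R :> R by rewrite sumr_const.
apply: (@le_trans _ _
  ((S (fun a => (a != m.1.1)%:R) (fun=> 1) (fun=> 1) errC +
    S (fun a => (a != m.1.1)%:R) (fun=> 1) (fun a => (a == m.2)%:R) errC') +
   (S (fun a => (a == m.1.1)%:R) (fun a => (a != m.1.2)%:R) (fun=> 1) errB +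
    S (fun a => (a == m.1.1)%:R) (fun a => (a != m.1.2)%:R) (fun a => (a == m.2)%:R) errB') +
   S (fun a => (a == m.1.1)%:R) (fun a => (a == m.1.2)%:R) (fun a => (a != m.2)%:R) errA)); last first.
  by rewrite !SE !sum_eq1 !sum_neq1 !one !mul1r !mulr1.
rewrite -!big_split/=; apply: ler_sum => m' _; case: ifP => // _.
have eB' : 0 <= errB' by apply: sumr_ge0 => j _; rewrite mulr_ge0 ?expR_ge0.
have eC' : 0 <= errC' by apply: sumr_ge0 => j _; rewrite mulr_ge0 ?expR_ge0.
by rewrite !addr_ge0// !mulr_ge0// expR_ge0.
Qed.

End cribbing_error.

Lemma exchange_weighted (R : realType) (A B : finType) (p : A -> R) (q : B -> R)
    (G : A -> B -> R) :
  \sum_a p a * (\sum_b q b * G a b) = \sum_b q b * (\sum_a p a * G a b).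
Proof.
under eq_bigr do rewrite mulr_sumr.
rewrite exchange_big/=; apply: eq_bigr => b _; rewrite mulr_sumr.
by apply: eq_bigr => a _; rewrite mulrCA.
Qed.

(** * Decoding error without cribbing *)

Section no_cribbing_error.
Variables (R : realType) (V X1 X2 Y M1 M1' M2 : finType) (n : nat).
Variables (pv : V -> R) (k : V -> X1 -> R) (p2 : X2 -> R) (W : X1 -> X2 -> Y -> R).
Hypotheses (pvd : is_dist pv) (kd : is_channel k) (p2d : is_dist p2) (Wd : is_mac W).

Local Notation word A := {ffun 'I_n -> A}.
Let P := letter_law pv k (fun=> p2) W.

Definition mac_book : finType :=
  ({ffun M1 -> word V} * {ffun M1 * M1' -> word X1} * {ffun M2 -> word X2})%type.

Definition input2_law (zb : {ffun M2 -> word X2}) : R :=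
  prod_law (fun=> prod_law (fun=> p2)) zb.

Definition mac_weight (b : mac_book) : R :=
  cloud_law pv b.1.1 * satellite_law k b.1.1 b.1.2 * input2_law b.2.

Definition mac_output (b : mac_book) (m : M1 * M1' * M2) (y : word Y) : R :=
  prod_law (fun i => W (b.1.2 m.1 i) (b.2 m.2 i)) y.

Lemma input2_law_ge0 zb : 0 <= input2_law zb.
Proof. by apply: prod_law_ge0 => m z; apply: prod_law_ge0 => i a; case: p2d. Qed.

Lemma mac_weight_ge0 b : 0 <= mac_weight b.
Proof. by rewrite !mulr_ge0 ?cloud_law_ge0 ?satellite_law_ge0 ?input2_law_ge0. Qed.

Lemma mac_output_ge0 b m y : 0 <= mac_output b m y.
Proof. by apply: prod_law_ge0 => i a; case: (Wd (b.1.2 m.1 i) (b.2 m.2 i)). Qed.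

Lemma sum_input2 : forall m : M2, \sum_(z : word X2) prod_law (fun=> p2) z = 1.
Proof. by move=> _; apply: sum_prod_law => _; case: p2d. Qed.

Lemma sum_mac_weight (F : mac_book -> R) :
  \sum_b mac_weight b * F b =
  \sum_vb cloud_law pv vb * (\sum_xb satellite_law k vb xb *
    (\sum_zb input2_law zb * F (vb, xb, zb))).
Proof.
rewrite sum_pair/= sum_pair/=; apply: eq_bigr => vb _; rewrite mulr_sumr.
apply: eq_bigr => xb _; rewrite mulrA mulr_sumr; apply: eq_bigr => t _.
by rewrite mulrA.
Qed.

Variable accept : word V -> word X2 -> word Y -> bool.

(** The test looks at the cloud alone: the choice of satellite acts as noise of the channel from V
    and X2 to Y. *)
Definition mac_accept (b : mac_book) (y : word Y) : pred (M1 * M2) :=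
  fun m => accept (b.1.1 m.1) (b.2 m.2) y.

Lemma sum_mac_reject m1 m1' m2 :
  \sum_b mac_weight b * (\sum_y mac_output b (m1, m1', m2) y *
     (~~ mac_accept b y (m1, m2))%:R) =
  \sum_v prod_law (fun=> pv) v * (\sum_x prod_law (fun i => k (v i)) x *
    (\sum_z prod_law (fun=> p2) z *
      (\sum_y prod_law (fun i => W (x i) (z i)) y * (~~ accept v z y)%:R))).
Proof.
rewrite sum_mac_weight -(codebook_law pvd kd m1 m1').
apply: eq_bigr => vb _; congr (_ * _); apply: eq_bigr => xb _; congr (_ * _).
exact: (sum_prod_law1 m2 (fun z : word X2 =>
  \sum_y prod_law (fun i => W (xb (m1, m1') i) (z i)) y * (~~ accept (vb m1) z y)%:R) sum_input2).
Qed.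

Variables (dD dE dF : V -> X2 -> Y -> R) (tauD tauE tauF : R).
Hypothesis dD0 : forall v z y, 0 <= dD v z y.
Hypothesis dE0 : forall v z y, 0 <= dE v z y.
Hypothesis dF0 : forall v z y, 0 <= dF v z y.
Hypothesis gainD :
  \sum_w P w * (\sum_a pv a * dD a (letX2 w) (letY w)) <= 1.
Hypothesis gainE :
  \sum_w P w * (\sum_a p2 a * dE (letV w) a (letY w)) <= 1.
Hypothesis gainF :
  \sum_w P w * (\sum_a (pv a.1 * p2 a.2) * dF a.1 a.2 (letY w)) <= 1.
Hypothesis acceptD : forall v z y, accept v z y ->
  expR tauD <= \prod_i dD (v i) (z i) (y i).
Hypothesis acceptE : forall v z y, accept v z y ->
  expR tauE <= \prod_i dE (v i) (z i) (y i).
Hypothesis acceptF : forall v z y, accept v z y ->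
  expR tauF <= \prod_i dF (v i) (z i) (y i).

Definition mac_confusion m1 m1' m2 m' : R :=
  \sum_b mac_weight b * (\sum_y mac_output b (m1, m1', m2) y *
     (mac_accept b y (m1, m2) && mac_accept b y m')%:R).

Lemma mac_confusion_le (F : word V -> word X2 -> word Y -> bool) m1 m1' m2 n1 n2 :
  (forall v z y, accept v z y -> F v z y) ->
  mac_confusion m1 m1' m2 (n1, n2) <=
  \sum_vb cloud_law pv vb * (\sum_xb satellite_law k vb xb *
    (\sum_zb input2_law zb * (\sum_y prod_law
       (fun i => W (xb (m1, m1') i) (zb m2 i)) y * (F (vb n1) (zb n2) y)%:R))).
Proof.
move=> FP; rewrite /mac_confusion sum_mac_weight.
apply: ler_sum => vb _; rewrite ler_wpM2l ?cloud_law_ge0//.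
apply: ler_sum => xb _; rewrite ler_wpM2l ?satellite_law_ge0//.
apply: ler_sum => zb _; rewrite ler_wpM2l ?input2_law_ge0//.
apply: ler_sum => y _; rewrite ler_wpM2l ?mac_output_ge0// ler_nat.
by case: andP => // -[_ /FP]; rewrite /mac_accept/= => ->.
Qed.

Lemma mac_confusion_cloud m1 m1' m2 n1 : m1 != n1 ->
  mac_confusion m1 m1' m2 (n1, m2) <= expR (- tauD).
Proof.
move=> mn; apply: (le_trans (mac_confusion_le _ _ _ _ _ acceptD)).
pose F v z y : R := (expR tauD <= \prod_(i < n) dD (v i) (z i) (y i))%R%:R.
rewrite -[X in X <= _]/(\sum_vb cloud_law pv vb * (\sum_xb satellite_law k vb xb *
    (\sum_zb input2_law zb * (\sum_y prod_law
       (fun i => W (xb (m1, m1') i) (zb m2 i)) y * F (vb n1) (zb m2) y)))).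
under eq_bigr => vb _ do under eq_bigr => xb _ do rewrite /input2_law (sum_prod_law1 m2 (fun z : word X2 => \sum_y prod_law
       (fun i => W (xb (m1, m1') i) (z i)) y * F (vb n1) z y) sum_input2).
rewrite (codebook_law_diff_cloud pvd kd m1' (fun _ v' x => \sum_z prod_law (fun=> p2) z *
  (\sum_y prod_law (fun i => W (x i) (z i)) y * F v' z y)) mn).
(* The wrong cloud is independent of everything transmitted, so its sum can be moved innermost; then
   the transmitted layers fuse into one word. *)
under eq_bigr => v _.
  rewrite exchange_weighted.
  under eq_bigr do (rewrite exchange_weighted; under eq_bigr do rewrite exchange_weighted).
  over.
rewrite (sum_word_letter_law pv k (fun=> p2) W
  (fun v x z y => \sum_v' prod_law (fun=> pv) v' * F v' z y)).
have := independent_word_accept n pvd kd (fun=> p2d) Wd tauD pvd.1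
  (fun a w => dD0 a (letX2 w) (letY w)) gainD.
apply: le_trans; apply: le_of_eq.
apply: eq_bigr => w _; congr (_ * _); apply: eq_bigr => v _; congr (_ * _).
by rewrite /F; congr (_ <= _)%R%:R; apply: eq_bigr => i _; rewrite !ffunE.
Qed.

Lemma mac_confusion_input2 m1 m1' m2 n2 : m2 != n2 ->
  mac_confusion m1 m1' m2 (m1, n2) <= expR (- tauE).
Proof.
move=> mn; apply: (le_trans (mac_confusion_le _ _ _ _ _ acceptE)).
pose F v z y : R := (expR tauE <= \prod_(i < n) dE (v i) (z i) (y i))%R%:R.
rewrite -[X in X <= _]/(\sum_vb cloud_law pv vb * (\sum_xb satellite_law k vb xb *
    (\sum_zb input2_law zb * (\sum_y prod_law
       (fun i => W (xb (m1, m1') i) (zb m2 i)) y * F (vb m1) (zb n2) y)))).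
under eq_bigr => vb _ do under eq_bigr => xb _ do rewrite /input2_law (sum_prod_law2 (fun z z' : word X2 => \sum_y prod_law
       (fun i => W (xb (m1, m1') i) (z i)) y * F (vb m1) z' y) sum_input2 mn).
rewrite (codebook_law pvd kd m1 m1' (fun v x => \sum_z prod_law (fun=> p2) z *
  (\sum_z' prod_law (fun=> p2) z' *
  (\sum_y prod_law (fun i => W (x i) (z i)) y * F v z' y)))).
under eq_bigr do under eq_bigr do under eq_bigr do rewrite exchange_weighted.
rewrite (sum_word_letter_law pv k (fun=> p2) W
  (fun v x z y => \sum_z' prod_law (fun=> p2) z' * F v z' y)).
have := independent_word_accept n pvd kd (fun=> p2d) Wd tauE p2d.1
  (fun a w => dE0 (letV w) a (letY w)) gainE.
apply: le_trans; apply: le_of_eq.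
apply: eq_bigr => w _; congr (_ * _); apply: eq_bigr => v _; congr (_ * _).
by rewrite /F; congr (_ <= _)%R%:R; apply: eq_bigr => i _; rewrite !ffunE.
Qed.

Lemma mac_confusion_both m1 m1' m2 n1 n2 : m1 != n1 -> m2 != n2 ->
  mac_confusion m1 m1' m2 (n1, n2) <= expR (- tauF).
Proof.
move=> mn mn2; apply: (le_trans (mac_confusion_le _ _ _ _ _ acceptF)).
pose F v z y : R := (expR tauF <= \prod_(i < n) dF (v i) (z i) (y i))%R%:R.
rewrite -[X in X <= _]/(\sum_vb cloud_law pv vb * (\sum_xb satellite_law k vb xb *
    (\sum_zb input2_law zb * (\sum_y prod_law
       (fun i => W (xb (m1, m1') i) (zb m2 i)) y * F (vb n1) (zb n2) y)))).
under eq_bigr => vb _ do under eq_bigr => xb _ do rewrite /input2_law (sum_prod_law2 (fun z z' : word X2 => \sum_y prod_law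
       (fun i => W (xb (m1, m1') i) (z i)) y * F (vb n1) z' y) sum_input2 mn2).
rewrite (codebook_law_diff_cloud pvd kd m1' (fun _ v' x => \sum_z prod_law (fun=> p2) z *
  (\sum_z' prod_law (fun=> p2) z' *
  (\sum_y prod_law (fun i => W (x i) (z i)) y * F v' z' y))) mn).
under eq_bigr => v _.
  rewrite exchange_weighted.
  under eq_bigr => x _.
    rewrite exchange_weighted.
    under eq_bigr => z _.
      under eq_bigr do rewrite exchange_weighted.
      rewrite exchange_weighted.
      over.
    over.
  over.
rewrite (sum_word_letter_law pv k (fun=> p2) W (fun v x z y =>
   \sum_v' prod_law (fun=> pv) v' * (\sum_z' prod_law (fun=> p2) z' * F v' z' y))).
have q0 (a : V * X2) : 0 <= pv a.1 * p2 a.2 by rewrite mulr_ge0 ?pvd.1 ?p2d.1.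
have := independent_word_accept n pvd kd (fun=> p2d) Wd tauF q0
  (fun a w => dF0 a.1 a.2 (letY w)) gainF.
apply: le_trans; apply: le_of_eq.
apply: eq_bigr => w _; congr (_ * _).
rewrite (sum_prod_law_pair (fun=> pv) (fun=> fun=> p2) (fun v' z' => F v' z' _)).
apply: eq_bigr => a _; congr (_ * _).
by rewrite /F; congr (_ <= _)%R%:R; apply: eq_bigr => i _; rewrite !ffunE.
Qed.

Lemma mac_confusion_bound m1 m1' m2 m' : m' != (m1, m2) ->
  mac_confusion m1 m1' m2 m' <=
    (m'.1 != m1)%:R * (m'.2 == m2)%:R * expR (- tauD) +
    (m'.1 == m1)%:R * (m'.2 != m2)%:R * expR (- tauE) +
    (m'.1 != m1)%:R * (m'.2 != m2)%:R * expR (- tauF).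
Proof.
case: m' => n1 n2 /=; rewrite !xpair_eqE.
have [->|nm1] := eqVneq n1 m1; have [->|nm2] := eqVneq n2 m2;
  rewrite //= ?mul1r ?mul0r ?mulr0 ?mul0r ?add0r ?addr0 => _.
- by apply: mac_confusion_input2; rewrite eq_sym.
- by apply: mac_confusion_cloud; rewrite eq_sym.
- by apply: mac_confusion_both; rewrite eq_sym.
Qed.

Lemma mac_error_le (m0 : M1 * M2) m1 m1' m2 (F : R) :
  \sum_v prod_law (fun=> pv) v * (\sum_x prod_law (fun i => k (v i)) x *
    (\sum_z prod_law (fun=> p2) z *
      (\sum_y prod_law (fun i => W (x i) (z i)) y * (~~ accept v z y)%:R))) <= F ->
  \sum_b mac_weight b * (\sum_y mac_output b (m1, m1', m2) y *
     (decode m0 (mac_accept b y) != (m1, m2))%:R) <=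
  F + ((#|M1|%:R - 1) * expR (- tauD) + (#|M2|%:R - 1) * expR (- tauE) +
       (#|M1|%:R - 1) * (#|M2|%:R - 1) * expR (- tauF)).
Proof.
move=> rej.
apply: (le_trans (random_decoding_error _ _ _ _ _)).
- exact: mac_weight_ge0.
- by move=> b y; exact: mac_output_ge0.
rewrite lerD ?sum_mac_reject//.
have conf m' := mac_confusion_bound (m1 := m1) m1' (m2 := m2) (m' := m').
apply: (le_trans (ler_sum _ conf)).
rewrite big_mkcond/=.
pose S (f : M1 -> R) (h : M2 -> R) e := \sum_(m' : M1 * M2) f m'.1 * h m'.2 * e.
have SE f h e : S f h e = (\sum_a f a) * (\sum_a h a) * e.
  by rewrite /S -mulr_suml sum_pair_prod.
apply: (@le_trans _ _
  (S (fun a => (a != m1)%:R) (fun a => (a == m2)%:R) (expR (- tauD)) +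
   S (fun a => (a == m1)%:R) (fun a => (a != m2)%:R) (expR (- tauE)) +
   S (fun a => (a != m1)%:R) (fun a => (a != m2)%:R) (expR (- tauF)))); last first.
  by rewrite !SE !sum_eq1 !sum_neq1 !mul1r !mulr1.
rewrite -!big_split/=; by apply: ler_sum => m' _; case: ifP.
Qed.

End no_cribbing_error.

(** * Single-letter bounds *)

Section rate_densities.
Variables (R : realType) (V X1 X2 Y : finType).
Variables (pv : V -> R) (k : V -> X1 -> R) (p2 : X2 -> R) (Q : X1 -> X2 -> R)
  (W : X1 -> X2 -> Y -> R).
Hypotheses (pvd : is_dist pv) (kd : is_channel k) (p2d : is_dist p2)
  (Qd : is_channel Q) (Wd : is_mac W).

Local Notation PC := (letter_law pv k Q W).
Local Notation PM := (letter_law pv k (fun=> p2) W).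
Let PCd : is_dist PC := letter_law_dist pvd kd Qd Wd.
Let PMd : is_dist PM := letter_law_dist pvd kd (fun=> p2d) Wd.

Definition dens_cribber v x z y : R :=
  cmi_density PC letX2 letY (fun w => (letV w, letX1 w)) z y (v, x).
Definition dens_satellite v x z y : R :=
  cmi_density PC (fun w => (letX1 w, letX2 w)) letY letV (x, z) y v.
Definition dens_cloud x z y : R :=
  mi_density PC (fun w => (letX1 w, letX2 w)) letY (x, z) y.
Definition dens_mac1 v z y : R := cmi_density PM letV letY letX2 v y z.
Definition dens_mac2 v z y : R := cmi_density PM letX2 letY letV z y v.
Definition dens_mac12 v z y : R :=
  mi_density PM (fun w => (letV w, letX2 w)) letY (v, z) y.

Lemma sum_letter_law_output (G : V -> X1 -> Y -> R) :
  \sum_w PC w * G (letV w) (letX1 w) (letY w) =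
  \sum_(c : V * X1) pv c.1 * k c.1 c.2 *
    \sum_y (\sum_z Q c.2 z * W c.2 z y) * G c.1 c.2 y.
Proof.
rewrite sum_letter_law [RHS]sum_pair/=; apply: eq_bigr => v _.
rewrite mulr_sumr; apply: eq_bigr => x _; rewrite mulrA; congr (_ * _).
under eq_bigr do rewrite mulr_sumr.
rewrite exchange_big/=; apply: eq_bigr => y _.
by rewrite mulr_suml; apply: eq_bigr => z _; rewrite mulrA.
Qed.

(** Change of measure with [Q], which is also the conditional law of X2'' given V and X1. *)
Lemma gain_cribber :
  \sum_(c : V * X1) pv c.1 * k c.1 c.2 *
    letter_gain Q W dens_cribber c.1 c.2 c.2 <= 1.
Proof.
have := @cmi_density_le1 _ _ _ PCd _ _ _ letX2 letY (fun w => (letV w, letX1 w))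
  (fun z c => Q c.2 z) (fun z c => (Qd c.2).1 z).
rewrite (sum_letter_law_output (fun v x y => \sum_z Q x z * dens_cribber v x z y)).
apply => z [v x]; by rewrite law_letX2_VX1// law_letVX1E.
Qed.

(** Change of measure with the conditional law [k v x * Q x z] of (X1, X2'') given V. *)
Lemma gain_satellite :
  \sum_(c : V * X1) pv c.1 * k c.1 c.2 *
    (\sum_x' k c.1 x' * letter_gain Q W dens_satellite c.1 c.2 x') <= 1.
Proof.
have q0 (a : X1 * X2) v : 0 <= k v a.1 * Q a.1 a.2.
  by rewrite mulr_ge0 ?(kd v).1 ?(Qd a.1).1.
apply: le_trans (cmi_density_le1 PCd (X := fun w => (letX1 w, letX2 w)) letY
  (Z := letV) q0 _); last first.
  by move=> [x z] v; rewrite law_letX1X2_V// law_letV// mulrA.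
apply: le_of_eq.
rewrite (sum_letter_law_output (fun v x y => \sum_a (k v a.1 * Q a.1 a.2) *
  cmi_density PC (fun w => (letX1 w, letX2 w)) letY letV a y v)).
apply: eq_bigr => c _; congr (_ * _); rewrite /letter_gain [LHS]exchange_weighted.
apply: eq_bigr => y _; congr (_ * _); rewrite sum_pair; apply: eq_bigr => x _.
by rewrite mulr_sumr; apply: eq_bigr => z _; rewrite mulrA.
Qed.

Lemma gain_cloud :
  \sum_(c : V * X1) pv c.1 * k c.1 c.2 *
    (\sum_x' marg1 pv k x' * letter_gain Q W (fun=> dens_cloud) c.1 c.2 x') <= 1.
Proof.
apply: le_trans (mi_density_le1 PCd (fun w => (letX1 w, letX2 w)) letY).
apply: le_of_eq.
rewrite (sum_letter_law_output (fun v x y => \sum_a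
  law PC (fun w => (letX1 w, letX2 w)) a *
  mi_density PC (fun w => (letX1 w, letX2 w)) letY a y)).
apply: eq_bigr => c _; congr (_ * _); rewrite /letter_gain [LHS]exchange_weighted.
apply: eq_bigr => y _; congr (_ * _); rewrite sum_pair; apply: eq_bigr => x _.
by rewrite mulr_sumr; apply: eq_bigr => z _; rewrite law_letX1X2// mulrA.
Qed.

(** V and X2 are independent, so [pv] is the conditional law of V given X2. *)
Lemma gain_mac1 :
  \sum_w PM w * (\sum_a pv a * dens_mac1 a (letX2 w) (letY w)) <= 1.
Proof.
apply: (@cmi_density_le1 _ _ _ PMd _ _ _ letV letY letX2 (fun v _ => pv v)).
  by move=> v _; exact: pvd.1.
by move=> v z; rewrite law_indep_letVX2// law_indep_letX2// mulrC.
Qed.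

Lemma gain_mac2 :
  \sum_w PM w * (\sum_a p2 a * dens_mac2 (letV w) a (letY w)) <= 1.
Proof.
apply: (@cmi_density_le1 _ _ _ PMd _ _ _ letX2 letY letV (fun z _ => p2 z)).
  by move=> z _; exact: p2d.1.
by move=> z v; rewrite law_indep_letX2V// law_letV.
Qed.

Lemma gain_mac12 :
  \sum_w PM w * (\sum_a (pv a.1 * p2 a.2) * dens_mac12 a.1 a.2 (letY w)) <= 1.
Proof.
have := mi_density_le1 PMd (fun w => (letV w, letX2 w)) letY.
apply: le_trans; apply: le_of_eq.
apply: eq_bigr => w _; congr (_ * _); apply: eq_bigr => -[v z] _.
by rewrite law_indep_letVX2.
Qed.

Lemma sum_letter_law_VX1 (G : V -> X1 -> R) (Q' : X1 -> X2 -> R) : is_channel Q' ->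
  \sum_w letter_law pv k Q' W w * G (letV w) (letX1 w) =
  \sum_v pv v * (\sum_x k v x * G v x).
Proof.
move=> Qd'; rewrite sum_letter_law /letV /letX1/=; apply: eq_bigr => v _; congr (_ * _).
apply: eq_bigr => x _; congr (_ * _).
under eq_bigr do rewrite -mulr_suml (Wd _ _).2 mul1r.
by rewrite -mulr_suml (Qd' x).2 mul1r.
Qed.

Lemma letter_law_gt0 w : 0 < PC w ->
  [/\ 0 < pv (letV w), 0 < k (letV w) (letX1 w) & 0 < marg1 pv k (letX1 w)].
Proof.
move=> Pw.
have ne : [&& pv (letV w) != 0 & k (letV w) (letX1 w) != 0].
  by move: (lt0r_neq0 Pw); rewrite /letter_law !mulf_eq0 !negb_or -!andbA => /and3P[-> ->].
have [pw kw] : 0 < pv (letV w) /\ 0 < k (letV w) (letX1 w).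
  by case/andP: ne; split; rewrite lt0r ?pvd.1 ?(kd _).1 andbT.
split=> //; rewrite /marg1 (bigD1 (letV w))//= ltr_wpDr ?mulr_gt0//.
by apply: sumr_ge0 => v _; rewrite mulr_ge0 ?pvd.1 ?(kd _).1.
Qed.

(** H(X1|V) as the mean logarithm of a density, so that the prefix tests obey the same concentration
    lemma as the others. *)
Definition entropyX1_V : R := mean_ln PC (fun w => (k (letV w) (letX1 w))^-1).
Definition entropyX1 : R := mean_ln PC (fun w => (marg1 pv k (letX1 w))^-1).

Lemma cond_entropy_letter_law : cond_entropy PC letX1 letV = entropyX1_V.
Proof.
rewrite /cond_entropy /entropyX1_V /mean_ln pair_bigA/=.
rewrite (eq_bigr (fun c => law PC (fun w => (letX1 w, letV w)) c *
   ln (law PC (fun w => (letX1 w, letV w)) (c.1, c.2) / law PC letV c.2))); last by case.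
rewrite (sum_law PC (fun w => (letX1 w, letV w)) (fun c =>
   ln (law PC (fun w => (letX1 w, letV w)) (c.1, c.2) / law PC letV c.2))).
rewrite -sumrN; apply: eq_bigr => w _.
have [->|Pw0] := eqVneq (PC w) 0; first by rewrite !mul0r oppr0.
have Pw : 0 < PC w by rewrite lt0r Pw0 PCd.1.
have [pw kw _] := letter_law_gt0 Pw.
rewrite /= law_letX1V// law_letV// [_ * _ / _]mulrAC divff ?gt_eqF// mul1r.
by rewrite lnV ?posrE// mulrN.
Qed.

(* I(V; Y | X2) <= I(V; X1), by ln t <= t - 1 applied to the ratio of the two
   information densities. *)
Lemma data_processing :
  cond_mutual_info PM letV letY letX2 + entropyX1_V <= entropyX1.
Proof.
rewrite cond_mutual_infoE /entropyX1_V /entropyX1 /mean_ln.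
(* The two entropies involve V and X1 only, whose law does not depend on cribbing; they are carried
   over to [PM], where the mutual information lives. *)
rewrite (sum_letter_law_VX1 (fun v x => ln (k v x)^-1) Qd).
rewrite (sum_letter_law_VX1 (fun v x => ln (marg1 pv k x)^-1) Qd).
rewrite -(sum_letter_law_VX1 (fun v x => ln (k v x)^-1) (fun=> p2d)).
rewrite -(sum_letter_law_VX1 (fun v x => ln (marg1 pv k x)^-1) (fun=> p2d)).
rewrite -subr_le0 -big_split/= -sumrB.
pose r w := marg1 pv k (letX1 w) * dens_mac1 (letV w) (letX2 w) (letY w) / k (letV w) (letX1 w).
apply: (@le_trans _ _ (\sum_w PM w * (r w - 1))).
  apply: ler_sum => w _.
  have [->|Pw0] := eqVneq (PM w) 0; first by rewrite !mul0r addr0 subr0.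
  have Pw : 0 < PM w by rewrite lt0r Pw0 PMd.1.
  have [pw kw] : 0 < pv (letV w) /\ 0 < k (letV w) (letX1 w).
    move: Pw0; rewrite /letter_law !mulf_eq0 !negb_or -!andbA => /and4P[p0 k0 _ _].
    by split; rewrite lt0r ?pvd.1 ?(kd _).1 andbT.
  have mw : 0 < marg1 pv k (letX1 w).
    rewrite /marg1 (bigD1 (letV w))//= ltr_wpDr ?mulr_gt0//.
    by apply: sumr_ge0 => v _; rewrite mulr_ge0 ?pvd.1 ?(kd _).1.
  have dw : 0 < dens_mac1 (letV w) (letX2 w) (letY w) by exact: cmi_density_gt0.
  rewrite -mulrDr -mulrBr ler_wpM2l ?PMd.1//.
  rewrite -/(dens_mac1 _ _ _).
  rewrite !lnV ?posrE// opprK.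
  have mdw := mulr_gt0 mw dw.
  have kVw : 0 < (k (letV w) (letX1 w))^-1 by rewrite invr_gt0.
  have -> : ln (dens_mac1 (letV w) (letX2 w) (letY w)) - ln (k (letV w) (letX1 w)) +
     ln (marg1 pv k (letX1 w)) = ln (r w).
    by rewrite /r lnM ?posrE// lnM ?posrE// lnV ?posrE//; ring.
  have rw : 0 < r w by exact: mulr_gt0 mdw kVw.
  have := expR_ge1Dx (ln (r w)); rewrite lnK ?posrE//; move: (ln _) => l; lra.
under eq_bigr do rewrite mulrBr mulr1.
rewrite sumrB PMd.2 subr_le0; apply: le_trans gain_mac1.
rewrite !sum_letter_law /letX2 /letY/=.
apply: (@le_trans _ _ (\sum_v pv v * \sum_x marg1 pv k x *
   \sum_z p2 z * \sum_y W x z y * dens_mac1 v z y)).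
  apply: ler_sum => v _; rewrite ler_wpM2l ?pvd.1//; apply: ler_sum => x _.
  have s0 : 0 <= \sum_z p2 z * \sum_y W x z y * dens_mac1 v z y.
    apply: sumr_ge0 => z _; rewrite mulr_ge0 ?p2d.1//; apply: sumr_ge0 => y _.
    by rewrite mulr_ge0 ?(Wd _ _).1 ?cmi_density_ge0.
  have m0 : 0 <= marg1 pv k x by case: (marg1_dist pvd kd).
  (* Where [k v x = 0] the left side vanishes; elsewhere [k v x] cancels the denominator of [r] and
     leaves the marginal of X1. *)
  have [->|k0] := eqVneq (k v x) 0; first by rewrite mul0r mulr_ge0.
  apply: le_of_eq.
  rewrite !mulr_sumr; apply: eq_bigr => z _; rewrite !mulr_sumr.
  by apply: eq_bigr => y _; rewrite /r/= /letX1/letX2/letY/letV/=; field.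
(* Reweighted by [r], the cloud letter is independent of the input and the output, so [v] becomes
   the averaged letter of [gain_mac1]. *)
apply: le_of_eq.
transitivity (\sum_x marg1 pv k x * \sum_v pv v *
    \sum_z p2 z * \sum_y W x z y * dens_mac1 v z y).
  under eq_bigr do rewrite mulr_sumr.
  rewrite exchange_big/=; apply: eq_bigr => x _; rewrite mulr_sumr.
  by apply: eq_bigr => v _; rewrite mulrCA.
transitivity (\sum_x marg1 pv k x * \sum_z p2 z * \sum_y W x z y *
   (\sum_a pv a * dens_mac1 a z y)).
  apply: eq_bigr => x _; congr (_ * _); rewrite /letter_gain [LHS]exchange_weighted.
  by apply: eq_bigr => z _; congr (_ * _); rewrite /letter_gain [LHS]exchange_weighted.
under [LHS]eq_bigr do rewrite /marg1 mulr_suml.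
rewrite exchange_big/=; apply: eq_bigr => v _; rewrite mulr_sumr.
by apply: eq_bigr => x _; rewrite -mulrA.
Qed.

End rate_densities.

(** * Typicality and rates *)

Section typical.
Variables (R : realType) (T I : finType) (P : T -> R) (d : I -> T -> R) (delta : R).

(* Suffix tests reject a codeword that leaves the true one at a given
   position; prefix tests bound the number of codewords that leave it there. *)
Definition typical n (w : {ffun 'I_n -> T}) : bool :=
  [forall l, [forall j : 'I_n.+1,
    (expR (\sum_(i < n | (j <= i)%N) mean_ln P (d l) - n%:R * delta) <=
       \prod_(i < n | (j <= i)%N) d l (w i)) &&
    (expR (\sum_(i < n | (i < j)%N) mean_ln P (d l) - n%:R * delta) <=
       \prod_(i < n | (i < j)%N) d l (w i))]].

Lemma typicalP n (w : {ffun 'I_n -> T}) : typical w -> forall l (j : 'I_n.+1),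
  expR (\sum_(i < n | (j <= i)%N) mean_ln P (d l) - n%:R * delta) <=
     \prod_(i < n | (j <= i)%N) d l (w i) /\
  expR (\sum_(i < n | (i < j)%N) mean_ln P (d l) - n%:R * delta) <=
     \prod_(i < n | (i < j)%N) d l (w i).
Proof. by move=> /forallP h l j; have /forallP/(_ j)/andP := h l. Qed.

Lemma eq_typical n (w w' : {ffun 'I_n -> T}) :
  (forall l i, d l (w i) = d l (w' i)) -> typical w = typical w'.
Proof.
move=> ww'; apply: eq_forallb => l; apply: eq_forallb => j.
by congr (_ && _); congr (_ <= _); apply: eq_bigr => i _; rewrite ww'.
Qed.

(** Union bound over two tests for each density and each position; the rate is the smallest of those
    given by [chernoff_density]. *)
Lemma typical_reject : is_dist P -> (forall l w, 0 < P w -> 0 < d l w) ->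
  0 < delta ->
  exists2 kappa : R, 0 < kappa & forall n,
    \sum_(w : {ffun 'I_n -> T}) prod_law (fun=> P) w * (~~ typical w)%:R
    <= (2 * #|I| * n.+1)%:R * expR (- (n%:R * kappa)).
Proof.
move=> Pd dpos delta0.
have /choice[kap kapP] (l : I) : exists kappa : R, 0 < kappa /\
   forall n (J : pred 'I_n),
    \sum_(w : {ffun 'I_n -> T}) prod_law (fun=> P) w *
      (~~ (expR (\sum_(i | J i) mean_ln P (d l) - n%:R * delta) <=
             \prod_(i | J i) d l (w i)))%:R
    <= expR (- (n%:R * kappa)).
  by have [kappa k0 kP] := chernoff_density Pd (dpos l) delta0; exists kappa.
exists (\big[Num.min/1]_l kap l).
  by apply: lt_bigmin => // l _; case: (kapP l).
move=> n; set kappa := \big[Num.min/1]_l _.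
have kb l (J : pred 'I_n) : \sum_(w : {ffun 'I_n -> T}) prod_law (fun=> P) w *
      (~~ (expR (\sum_(i | J i) mean_ln P (d l) - n%:R * delta) <=
             \prod_(i | J i) d l (w i)))%:R
    <= expR (- (n%:R * kappa)).
  apply: (le_trans ((kapP l).2 n J)); rewrite ler_expR lerN2 ler_wpM2l//.
  exact: bigmin_le.
pose t1 (w : {ffun 'I_n -> T}) l (j : 'I_n.+1) : bool :=
  (expR (\sum_(i < n | (j <= i)%N) mean_ln P (d l) - n%:R * delta) <=
     \prod_(i < n | (j <= i)%N) d l (w i)).
pose t2 (w : {ffun 'I_n -> T}) l (j : 'I_n.+1) : bool :=
  (expR (\sum_(i < n | (i < j)%N) mean_ln P (d l) - n%:R * delta) <=
     \prod_(i < n | (i < j)%N) d l (w i)).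
apply: (@le_trans _ _ (\sum_(w : {ffun 'I_n -> T}) prod_law (fun=> P) w *
   \sum_l \sum_(j : 'I_n.+1) ((~~ t1 w l j)%:R + (~~ t2 w l j)%:R))).
  apply: ler_sum => w _; rewrite ler_wpM2l//.
    by apply: prod_law_ge0 => i a; case: Pd.
  have s0 l j : 0 <= (~~ t1 w l j)%:R + (~~ t2 w l j)%:R :> R by rewrite addr_ge0.
  have [_|] := boolP (typical w); first by rewrite !sumr_ge0// => l _; rewrite sumr_ge0.
  rewrite negb_forall => /existsP[l]; rewrite negb_forall => /existsP[j].
  rewrite negb_and -/(t1 w l j) -/(t2 w l j) => tt.
  rewrite (bigD1 l)//= (bigD1 j)//= -[X in X <= _]addr0 lerD//; last first.
    by rewrite sumr_ge0// => l' _; rewrite sumr_ge0.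
  rewrite -[X in X <= _]addr0 lerD//; last by rewrite sumr_ge0.
  by rewrite -natrD ler_nat; case/orP: tt => ->; rewrite ?leq_addr ?leq_addl.
under eq_bigr do rewrite mulr_sumr.
rewrite exchange_big/=.
under eq_bigr do under eq_bigr do rewrite mulr_sumr.
under eq_bigr do rewrite exchange_big/=.
apply: (@le_trans _ _ (\sum_(l : I) \sum_(j : 'I_n.+1) 2 * expR (- (n%:R * kappa)))).
  apply: ler_sum => l _; apply: ler_sum => j _.
  under eq_bigr do rewrite mulrDr.
  by rewrite big_split/= mulr2n mulrDl !mul1r lerD// kb.
rewrite sumr_const sumr_const card_ord !natrM.
set e := expR _; rewrite -[2 * e *+ _]mulr_natl -[_ *+ #|I|]mulr_natl.
by apply: le_of_eq; ring.
Qed.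

End typical.

(** Half of the exponent absorbs [n.+1], the other half goes below [eps], both by [1 + t <= expR t].
    The constant [C] is such that [n.+1 <= C * (1 + n * c / 2)]. *)
Lemma linear_exp_le (R : realType) (K c eps : R) : 0 < K -> 0 < c -> 0 < eps ->
  \forall n \near \oo, K * n.+1%:R * expR (- (n%:R * c)) <= eps.
Proof.
move=> K0 c0 e0; pose C := 1 + 2 / c.
have C0 : 0 < C by rewrite addr_gt0// divr_gt0.
exists (Num.truncn (2 * (K * C / eps) / c)).+1 => // n /= Nn.
have nN : K * C / eps <= 1 + n%:R * c / 2.
  have : 2 * (K * C / eps) / c <= n%:R.
    by rewrite (le_trans (ltW (truncnS_gt _)))// ler_nat.
  rewrite ler_pdivrMr// => h.
  by rewrite -(ler_pM2l (ltr0n R 2)); lra.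
have e1 : 1 + n%:R * c / 2 <= expR (n%:R * c / 2) by exact: expR_ge1Dx.
have nc0 : 0 <= n%:R * c / 2 by rewrite divr_ge0// mulr_ge0// ltW.
have -> : expR (- (n%:R * c)) = (expR (n%:R * c / 2) * expR (n%:R * c / 2))^-1.
  by rewrite -expRD -expRN; congr expR; field.
rewrite ler_pdivrMr ?mulr_gt0 ?expR_gt0//.
have h1 : n.+1%:R <= C * expR (n%:R * c / 2).
  apply: (@le_trans _ _ (C * (1 + n%:R * c / 2))); last by rewrite ler_pM2l.
  rewrite -addn1 natrD /C.
  have -> : (1 + 2 / c) * (1 + n%:R * c / 2) = 1 + 2 / c + n%:R * c / 2 + n%:R.
    by field; rewrite gt_eqF.
  have c2 : 0 <= 2 / c by rewrite divr_ge0// ltW.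
  by lra.
have h2 : K * C <= eps * expR (n%:R * c / 2).
  by rewrite [eps * _]mulrC -ler_pdivrMr// (le_trans nN).
apply: (@le_trans _ _ (K * (C * expR (n%:R * c / 2)))).
  by rewrite ler_pM2l.
by rewrite mulrA [X in _ <= X]mulrA ler_wpM2r ?expR_ge0.
Qed.

(** Wherever the words diverge, the positions after [j] pay [r] through a mutual information and
    those before it pay [r] through an entropy: this is why a rate must lie below both. *)
Lemma split_sum_ge (R : realType) n j (r a b : R) : r <= a -> r <= b ->
  n%:R * r <= \sum_(i < n | (j <= i)%N) a + \sum_(i < n | (i < j)%N) b.
Proof.
move=> ra rb.
have -> : n%:R * r = \sum_(i < n) r by rewrite sumr_const card_ord mulr_natl.
rewrite (bigID (fun i : 'I_n => (j <= i)%N))/= lerD//; first exact: ler_sum.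
under eq_bigl do rewrite -ltnNge.
exact: ler_sum.
Qed.

Lemma sum_suffix0 (R : realType) n (a : R) : \sum_(i < n | (0 <= i)%N) a = n%:R * a.
Proof. by rewrite sumr_const card_ord mulr_natl. Qed.

(** [N - 1] counts the wrong messages and carries the margin [gamma]. [N] itself cannot when
    [r < gamma], being at least 1, so it is bounded at the full rate; the factor 2 is for rounding
    up. *)
Definition fits_rate (R : realType) (n : nat) (gamma r N : R) : Prop :=
  [/\ 1 <= N, N - 1 <= expR (n%:R * (r - gamma)) & N <= 2 * expR (n%:R * r)].

Section random_rates.
Variables (R : realType) (V X1 X2 Y : finType).
Variables (pv : V -> R) (k : V -> X1 -> R) (p2 : X2 -> R) (Q : X1 -> X2 -> R)
  (W : X1 -> X2 -> Y -> R).
Hypotheses (pvd : is_dist pv) (kd : is_channel k) (p2d : is_dist p2)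
  (Qd : is_channel Q) (Wd : is_mac W).
Variables (R1 R1' R2 R2'' gamma : R).
Hypotheses (R2''_ge0 : 0 <= R2'') (gamma0 : 0 < gamma).
Variable x0 : X1.

Local Notation PC := (letter_law pv k Q W).
Local Notation PM := (letter_law pv k (fun=> p2) W).
Local Notation delta := (gamma / 4).
Local Notation word n A := {ffun 'I_n -> A}.

(** The last two have mean logarithms H(X1|V) and H(X1). Their prefix tests cap the probability that
    a satellite of the same or of another cloud repeats the true prefix. *)
Definition crib_densities : seq (V * X1 * X2 * Y -> R) :=
  [:: (fun w => dens_cribber pv k Q W (letV w) (letX1 w) (letX2 w) (letY w));
      (fun w => dens_satellite pv k Q W (letV w) (letX1 w) (letX2 w) (letY w));
      (fun w => dens_cloud pv k Q W (letX1 w) (letX2 w) (letY w));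
      (fun w => (k (letV w) (letX1 w))^-1);
      (fun w => (marg1 pv k (letX1 w))^-1)].

Definition crib_density (l : 'I_5) := nth (fun=> 0) crib_densities l.

Definition mac_densities : seq (V * X1 * X2 * Y -> R) :=
  [:: (fun w => dens_mac1 pv k p2 W (letV w) (letX2 w) (letY w));
      (fun w => dens_mac2 pv k p2 W (letV w) (letX2 w) (letY w));
      (fun w => dens_mac12 pv k p2 W (letV w) (letX2 w) (letY w))].

Definition mac_density (l : 'I_3) := nth (fun=> 0) mac_densities l.

Lemma crib_density_gt0 l w : 0 < PC w -> 0 < crib_density l w.
Proof.
move=> Pw; have Pd := letter_law_dist pvd kd Qd Wd.
have [_ kw mw] := letter_law_gt0 pvd kd Pw.
case: l => -[|[|[|[|[|//]]]]] ?; rewrite /crib_density/= ?invr_gt0//.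
- exact: (cmi_density_gt0 Pd letX2 letY (fun w => (letV w, letX1 w))).
- exact: (cmi_density_gt0 Pd (fun w => (letX1 w, letX2 w)) letY letV).
- exact: (mi_density_gt0 Pd (fun w => (letX1 w, letX2 w)) letY).
Qed.

Lemma mac_density_gt0 l w : 0 < PM w -> 0 < mac_density l w.
Proof.
move=> Pw; have Pd := letter_law_dist pvd kd (fun=> p2d) Wd.
case: l => -[|[|[|//]]] ?; rewrite /mac_density/=.
- exact: (cmi_density_gt0 Pd letV letY letX2).
- exact: (cmi_density_gt0 Pd letX2 letY letV).
- exact: (mi_density_gt0 Pd (fun w => (letV w, letX2 w)) letY).
Qed.

Definition crib_test n (v : word n V) (x : word n X1) (z : word n X2) (y : word n Y) :=
  typical PC crib_density delta [ffun i => (v i, x i, z i, y i)].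

(* The densities ignore the first input, so the dummy letter [x0] is harmless. *)
Definition mac_test n (v : word n V) (z : word n X2) (y : word n Y) :=
  typical PM mac_density delta [ffun i => (v i, x0, z i, y i)].

(** The constant 10 counts two tests for each of the five densities. *)
Lemma crib_test_reject : exists2 kappa : R, 0 < kappa & forall n,
  \sum_(v : word n V) prod_law (fun=> pv) v *
   (\sum_(x : word n X1) prod_law (fun i => k (v i)) x *
    (\sum_(z : word n X2) prod_law (fun i => Q (x i)) z *
      (\sum_(y : word n Y) prod_law (fun i => W (x i) (z i)) y *
         (~~ crib_test v x z y)%:R))) <=
  10 * n.+1%:R * expR (- (n%:R * kappa)).
Proof.
have d0 : 0 < delta by rewrite divr_gt0.
have [kappa k0 kP] := typical_reject (letter_law_dist pvd kd Qd Wd) crib_density_gt0 d0.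
exists kappa => // n; have := kP n; rewrite card_ord natrM; apply: le_trans.
rewrite sum_word_letter_law; apply: le_of_eq.
apply: eq_bigr => w _; congr (_ * (~~ _)%:R); congr typical.
by apply/ffunP => i; rewrite !ffunE; case: (w i) => [[[]]].
Qed.

Lemma mac_test_reject : exists2 kappa : R, 0 < kappa & forall n,
  \sum_(v : word n V) prod_law (fun=> pv) v *
   (\sum_(x : word n X1) prod_law (fun i => k (v i)) x *
    (\sum_(z : word n X2) prod_law (fun=> p2) z *
      (\sum_(y : word n Y) prod_law (fun i => W (x i) (z i)) y *
         (~~ mac_test v z y)%:R))) <=
  6 * n.+1%:R * expR (- (n%:R * kappa)).
Proof.
have d0 : 0 < delta by rewrite divr_gt0.
have [kappa k0 kP] := typical_reject (letter_law_dist pvd kd (fun=> p2d) Wd) mac_density_gt0 d0.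
exists kappa => // n; have := kP n; rewrite card_ord natrM; apply: le_trans.
rewrite (sum_word_letter_law pv k (fun=> p2) W (fun v x z y => (~~ mac_test v z y)%:R)).
apply: le_of_eq.
apply: eq_bigr => w _; congr (_ * (~~ _)%:R); apply: eq_typical => l i.
by rewrite !ffunE; case: l => -[|[|[|//]]] ?.
Qed.

Hypothesis (rate1 : R1 <= cond_mutual_info PM letV letY letX2)
  (rate2 : R2 <= cond_mutual_info PM letX2 letY letV)
  (rate12 : R1 + R2 <= mutual_info PM (fun w => (letV w, letX2 w)) letY).
Hypothesis (rate1' : R1' <= cond_entropy PC letX1 letV)
  (rate2'' : R2'' <= cond_mutual_info PC letX2 letY (fun w => (letV w, letX1 w)))
  (rate1'2'' : R1' + R2'' <= cond_mutual_info PC (fun w => (letX1 w, letX2 w)) letY letV)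
  (rate11'2'' : R1 + R1' + R2'' <= mutual_info PC (fun w => (letX1 w, letX2 w)) letY).

(** The constant 20 stands for five error patterns at 4 each: the factor 2 of [fits_rate] enters for
    at most two components counted in full. *)
Lemma crib_random_code (kappa : R) n (M1 M1' M2 : finType) (m0 m : M1 * M1' * M2) :
  (\sum_(v : word n V) prod_law (fun=> pv) v *
   (\sum_(x : word n X1) prod_law (fun i => k (v i)) x *
    (\sum_(z : word n X2) prod_law (fun i => Q (x i)) z *
      (\sum_(y : word n Y) prod_law (fun i => W (x i) (z i)) y *
         (~~ crib_test v x z y)%:R))) <=
  10 * n.+1%:R * expR (- (n%:R * kappa))) ->
  fits_rate n gamma R1 #|M1|%:R -> fits_rate n gamma R1' #|M1'|%:R ->
  fits_rate n gamma R2'' #|M2|%:R ->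
  \sum_b crib_weight pv k Q b *
    (\sum_y crib_output W x0 b m y *
       (decode m0 (crib_accept x0 (@crib_test n) b y) != m)%:R) <=
  10 * n.+1%:R * expR (- (n%:R * kappa)) +
  20 * n.+1%:R * expR (- (n%:R * (gamma / 2))).
Proof.
move=> rej [N1 N1m N1M] [N1' N1'm N1'M] [N2 N2m N2M].
have Pd := letter_law_dist pvd kd Qd Wd.
pose mu (l : 'I_5) := mean_ln PC (crib_density l).
pose tau l (j : 'I_n.+1) := \sum_(i < n | (j <= i)%N) mu l - n%:R * delta.
pose a l (j : 'I_n.+1) := expR (- (\sum_(i < n | (i < j)%N) mu l - n%:R * delta)).
pose lA : 'I_5 := @Ordinal 5 0 isT.
pose lB : 'I_5 := @Ordinal 5 1 isT.
pose lC : 'I_5 := @Ordinal 5 2 isT.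
pose lH : 'I_5 := @Ordinal 5 3 isT.
pose lG : 'I_5 := @Ordinal 5 4 isT.
have muA : R2'' <= mu lA by move: rate2''; rewrite cond_mutual_infoE.
have muB : R1' + R2'' <= mu lB by move: rate1'2''; rewrite cond_mutual_infoE.
have muC : R1 + R1' + R2'' <= mu lC by move: rate11'2''; rewrite mutual_infoE.
have muH : R1' <= mu lH by move: rate1'; rewrite cond_entropy_letter_law.
have muG : R1 + R1' <= mu lG.
  have := data_processing pvd kd p2d Qd Wd.
  move: rate1 muH; rewrite /mu /crib_density/= -/(entropyX1_V pv k Q W) -/(entropyX1 pv k Q W).
  by lra.
(* The tests bound products of inverses from below, while the error analysis wants the probabilities
   themselves from above. A zero product is treated apart, since its inverse is 0. *)
have inv_prod l (F : 'I_n -> R) (j : 'I_n.+1) : (forall i, 0 <= F i) ->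
    expR (\sum_(i < n | (i < j)%N) mu l - n%:R * delta) <=
      \prod_(i < n | (i < j)%N) (F i)^-1 ->
    \prod_(i < n | (i < j)%N) F i <= a l j.
  move=> F0 h; rewrite /a expRN.
  have : 0 <= \prod_(i < n | (i < j)%N) F i by apply: prodr_ge0 => i _; exact: F0.
  rewrite le_eqVlt => /orP[/eqP <-|p0]; first by rewrite invr_ge0 expR_ge0.
  rewrite -[X in X <= _]invrK lef_pV2 ?posrE ?expR_gt0 ?invr_gt0//.
  by rewrite -prodfV.
have q0 x : 0 <= marg1 pv k x by case: (marg1_dist pvd kd).
apply: (le_trans (crib_error_le pvd kd Qd Wd x0 (dA := dens_cribber pv k Q W)
  (dB := dens_satellite pv k Q W) (dC := dens_cloud pv k Q W)
  (tauA := tau lA ord0) (tauB := tau lB) (tauC := tau lC) (aB := a lH) (aC := a lG)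
  _ _ _ _ _ _ _ _ _ _ _ m0 m rej)).
- by move=> *; exact: cmi_density_ge0.
- by move=> *; exact: cmi_density_ge0.
- by move=> *; exact: mi_density_ge0.
- by move=> j; exact: expR_ge0.
- by move=> j; exact: expR_ge0.
- exact: gain_cribber.
- exact: gain_satellite.
- exact: gain_cloud.
- move=> v x z y /typicalP/(_ lA ord0)[+ _]; rewrite -/(mu lA) -/(tau lA ord0).
  move/le_trans; apply; apply: le_of_eq; apply: eq_bigr => i _; by rewrite ffunE.
- move=> v x z y /typicalP T j; split.
    have [+ _] := T lB j; rewrite -/(mu lB) -/(tau lB j).
    move/le_trans; apply; apply: le_of_eq; apply: eq_bigr => i _; by rewrite ffunE.
  apply: inv_prod => [i|]; first exact: (kd _).1.
  have [_ /le_trans] := T lH j; apply; apply: le_of_eq; apply: eq_bigr => i _; by rewrite ffunE.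
- move=> v x z y /typicalP T j; split.
    have [+ _] := T lC j; rewrite -/(mu lC) -/(tau lC j).
    move/le_trans; apply; apply: le_of_eq; apply: eq_bigr => i _; by rewrite ffunE.
  apply: inv_prod => [i|]; first exact: q0.
  have [_ /le_trans] := T lG j; apply; apply: le_of_eq; apply: eq_bigr => i _; by rewrite ffunE.
rewrite lerD2l.
(* The wrong messages leave a margin [n * gamma]. A prefix and a suffix test together use up
   [2 * n * delta], that is half of it; the other half is the exponent of [e]. *)
pose e := expR (- (n%:R * (gamma / 2))).
have n0 : 0 <= n%:R :> R by [].
have n1 : 1 <= n.+1%:R :> R by rewrite ler1n.
have e0 : 0 <= e by exact: expR_ge0.
have ng : 0 <= n%:R * gamma by rewrite mulr_ge0// ltW.
have mulE (c c' u v x y : R) : 0 <= u -> 0 <= v -> u <= c * expR x ->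
    v <= c' * expR y -> u * v <= c * c' * expR (x + y).
  by move=> u0 v0 ux vy; rewrite expRD mulrACA ler_pM.
have mule (c u x t : R) : 0 <= c -> u <= c * expR x ->
    x + t <= - (n%:R * (gamma / 2)) -> u * expR t <= c * e.
  move=> c0 ux xt; apply: (@le_trans _ _ (c * expR x * expR t)).
    by rewrite ler_wpM2r ?expR_ge0.
  by rewrite -mulrA -expRD ler_wpM2l// ler_expR.
have prefix_le lX lY r : r <= mu lX -> r <= mu lY ->
    \sum_(j < n.+1) expR (- tau lX j) * a lY j <=
    n.+1%:R * expR (- (n%:R * r) + 2 * (n%:R * delta)).
  move=> rX rY.
  have -> : n.+1%:R = \sum_(j < n.+1) 1 :> R by rewrite sumr_const card_ord.
  rewrite mulr_suml; apply: ler_sum => j _; rewrite mul1r -expRD ler_expR.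
  by have := split_sum_ge n j rX rY; rewrite /tau; lra.
have p1 : 0 <= (#|M1|%:R - 1 : R) by lra.
have p1' : 0 <= (#|M1'|%:R - 1 : R) by lra.
have p2_ : 0 <= (#|M2|%:R - 1 : R) by lra.
have N1m1 : #|M1|%:R - 1 <= 1 * expR (n%:R * (R1 - gamma)) by rewrite mul1r.
have N1'm1 : #|M1'|%:R - 1 <= 1 * expR (n%:R * (R1' - gamma)) by rewrite mul1r.
have N2m1 : #|M2|%:R - 1 <= 1 * expR (n%:R * (R2'' - gamma)) by rewrite mul1r.
have nle (r s : R) : r <= s -> n%:R * r <= n%:R * s by exact: ler_wpM2l.
have tC : (#|M1|%:R - 1) * #|M1'|%:R * #|M2|%:R * expR (- tau lC ord0) <= 4 * e.
  have h : (#|M1|%:R - 1) * #|M1'|%:R * #|M2|%:R <=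
      1 * 2 * 2 * expR (n%:R * (R1 - gamma) + n%:R * R1' + n%:R * R2'').
    by apply: (mulE (1 * 2) 2) => //; [rewrite mulr_ge0|exact: (mulE 1 2)].
  have -> : 4 * e = 1 * 2 * 2 * e by ring.
  apply: (mule _ _ _ _ _ h) => //.
  by have := nle _ _ muC; rewrite /tau sum_suffix0; lra.
have tC' : (#|M1|%:R - 1) * #|M1'|%:R * (\sum_(j < n.+1) expR (- tau lC j) * a lG j)
    <= 4 * n.+1%:R * e.
  have h : (#|M1|%:R - 1) * #|M1'|%:R <=
      1 * 2 * expR (n%:R * (R1 - gamma) + n%:R * R1') by exact: mulE.
  (* With the message of Encoder 2 right, the suffix test has to reject at rate R1 + R1' only; this
     uses [0 <= R2'']. *)
  have RC : R1 + R1' <= mu lC by apply: le_trans muC; rewrite lerDl.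
  apply: le_trans (ler_wpM2l _ (prefix_le lC lG (R1 + R1') RC muG)) _.
    by rewrite mulr_ge0.
  rewrite mulrCA -mulrA [X in _ <= X]mulrCA ler_wpM2l//.
  apply: le_trans (mule _ _ _ _ _ h _) _ => //; first by lra.
  by rewrite ler_wpM2r//; lra.
have tB : (#|M1'|%:R - 1) * #|M2|%:R * expR (- tau lB ord0) <= 4 * e.
  have h : (#|M1'|%:R - 1) * #|M2|%:R <=
      1 * 2 * expR (n%:R * (R1' - gamma) + n%:R * R2'') by exact: mulE.
  apply: le_trans (mule _ _ _ _ _ h _) _ => //.
    by have := nle _ _ muB; rewrite /tau sum_suffix0; lra.
  by rewrite ler_wpM2r//; lra.
have tB' : (#|M1'|%:R - 1) * (\sum_(j < n.+1) expR (- tau lB j) * a lH j)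
    <= 4 * n.+1%:R * e.
  have RB : R1' <= mu lB by apply: le_trans muB; rewrite lerDl.
  apply: le_trans (ler_wpM2l _ (prefix_le lB lH R1' RB muH)) _ => //.
  rewrite mulrCA -mulrA [X in _ <= X]mulrCA ler_wpM2l//.
  apply: le_trans (mule _ _ _ _ _ N1'm1 _) _ => //; first by lra.
  by rewrite ler_wpM2r//; lra.
have tA : (#|M2|%:R - 1) * expR (- tau lA ord0) <= 4 * e.
  apply: le_trans (mule _ _ _ _ _ N2m1 _) _ => //.
    by have := nle _ _ muA; rewrite /tau sum_suffix0; lra.
  by rewrite ler_wpM2r//; lra.
have ene : e <= n.+1%:R * e by rewrite -[X in X <= _]mul1r ler_wpM2r.
by rewrite -/e; lra.
Qed.

Lemma mac_random_code (kappa : R) n (M1 M1' M2 : finType) (m0 : M1 * M2) m1 m1' m2 :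
  (\sum_(v : word n V) prod_law (fun=> pv) v *
   (\sum_(x : word n X1) prod_law (fun i => k (v i)) x *
    (\sum_(z : word n X2) prod_law (fun=> p2) z *
      (\sum_(y : word n Y) prod_law (fun i => W (x i) (z i)) y *
         (~~ mac_test v z y)%:R))) <=
  6 * n.+1%:R * expR (- (n%:R * kappa))) ->
  fits_rate n gamma R1 #|M1|%:R -> fits_rate n gamma R2 #|M2|%:R ->
  \sum_b mac_weight pv k p2 b *
    (\sum_y mac_output W b (m1, m1', m2) y *
       (decode m0 (mac_accept (M1' := M1') (@mac_test n) b y) != (m1, m2))%:R) <=
  6 * n.+1%:R * expR (- (n%:R * kappa)) +
  20 * n.+1%:R * expR (- (n%:R * (gamma / 2))).
Proof.
move=> rej [N1 N1m N1M] [N2 N2m N2M].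
pose mu (l : 'I_3) := mean_ln PM (mac_density l).
pose tau l := n%:R * mu l - n%:R * delta.
pose lD : 'I_3 := @Ordinal 3 0 isT.
pose lE : 'I_3 := @Ordinal 3 1 isT.
pose lF : 'I_3 := @Ordinal 3 2 isT.
have muD : R1 <= mu lD by move: rate1; rewrite cond_mutual_infoE.
have muE : R2 <= mu lE by move: rate2; rewrite cond_mutual_infoE.
have muF : R1 + R2 <= mu lF by move: rate12; rewrite mutual_infoE.
have Pd := letter_law_dist pvd kd (fun=> p2d) Wd.
apply: (le_trans (mac_error_le pvd kd p2d Wd (dD := dens_mac1 pv k p2 W)
  (dE := dens_mac2 pv k p2 W) (dF := dens_mac12 pv k p2 W)
  (tauD := tau lD) (tauE := tau lE) (tauF := tau lF)
  _ _ _ _ _ _ _ _ _ m0 m1 m1' m2 rej)).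
- by move=> *; exact: cmi_density_ge0.
- by move=> *; exact: cmi_density_ge0.
- by move=> *; exact: mi_density_ge0.
- exact: gain_mac1.
- exact: gain_mac2.
- exact: gain_mac12.
- move=> v z y /typicalP/(_ lD ord0)[+ _]; rewrite -/(mu lD) sum_suffix0 -/(tau lD).
  move/le_trans; apply; apply: le_of_eq; apply: eq_bigr => i _; by rewrite ffunE.
- move=> v z y /typicalP/(_ lE ord0)[+ _]; rewrite -/(mu lE) sum_suffix0 -/(tau lE).
  move/le_trans; apply; apply: le_of_eq; apply: eq_bigr => i _; by rewrite ffunE.
- move=> v z y /typicalP/(_ lF ord0)[+ _]; rewrite -/(mu lF) sum_suffix0 -/(tau lF).
  move/le_trans; apply; apply: le_of_eq; apply: eq_bigr => i _; by rewrite ffunE.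
rewrite lerD2l.
pose e := expR (- (n%:R * (gamma / 2))).
have n0 : 0 <= n%:R :> R by [].
have n1 : 1 <= n.+1%:R :> R by rewrite ler1n.
have e0 : 0 <= e by exact: expR_ge0.
have ng : 0 <= n%:R * gamma by rewrite mulr_ge0// ltW.
have mule (u x t : R) : u <= expR x ->
    x + t <= - (n%:R * (gamma / 2)) -> u * expR t <= e.
  move=> ux xt; apply: (@le_trans _ _ (expR x * expR t)).
    by rewrite ler_wpM2r ?expR_ge0.
  by rewrite -expRD ler_expR.
have p1 : 0 <= (#|M1|%:R - 1 : R) by lra.
have p2_ : 0 <= (#|M2|%:R - 1 : R) by lra.
have nle (r s : R) : r <= s -> n%:R * r <= n%:R * s by exact: ler_wpM2l.
have tD : (#|M1|%:R - 1) * expR (- tau lD) <= e.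
  by apply: (mule _ _ _ N1m); have := nle _ _ muD; rewrite /tau; lra.
have tE : (#|M2|%:R - 1) * expR (- tau lE) <= e.
  by apply: (mule _ _ _ N2m); have := nle _ _ muE; rewrite /tau; lra.
have tF : (#|M1|%:R - 1) * (#|M2|%:R - 1) * expR (- tau lF) <= e.
  apply: (mule _ (n%:R * (R1 - gamma) + n%:R * (R2 - gamma))).
    by rewrite expRD ler_pM.
  by have := nle _ _ muF; rewrite /tau; lra.
have ene : e <= n.+1%:R * e by rewrite -[X in X <= _]mul1r ler_wpM2r.
by rewrite -/e; lra.
Qed.

End random_rates.

(** * From random codebooks to codes *)

Lemma exists_le_mean (R : realType) (B : finType) (w F : B -> R) (c : R) :
  (forall b, 0 <= w b) -> \sum_b w b = 1 -> \sum_b w b * F b <= c ->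
  exists b, F b <= c.
Proof.
move=> w0 w1 Fc; apply: contrapT => /forallNP Fgt.
have gt b : c < F b by rewrite ltNge; apply/negP; exact: Fgt.
have s0 : \sum_b w b * (F b - c) <= 0.
  under eq_bigr do rewrite mulrBr.
  by rewrite sumrB -mulr_suml w1 mul1r subr_le0.
have s0' : \sum_b w b * (F b - c) = 0.
  apply/eqP; rewrite eq_le s0 sumr_ge0// => b _.
  by rewrite mulr_ge0// subr_ge0 ltW.
have nn b : true -> 0 <= w b * (F b - c) by rewrite mulr_ge0// subr_ge0 ltW.
have wz b : w b = 0.
  have /eqP := psumr_eq0P nn s0' (i := b) isT.
  by rewrite mulf_eq0 subr_eq0 [F b == c]gt_eqF// orbF => /eqP.
move: w1; rewrite big1 => [/esym/eqP|b _]; first by rewrite oner_eq0.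
exact: wz.
Qed.

Lemma sum_tuple_word (R : nmodType) (n : nat) (Y : finType)
    (F : {ffun 'I_n -> Y} -> R) :
  \sum_(y : n.-tuple Y) F [ffun i => tnth y i] = \sum_w F w.
Proof.
rewrite [RHS](reindex (fun y : n.-tuple Y => [ffun i => tnth y i]))//.
exists (fun w : {ffun 'I_n -> Y} => [tuple w i | i < n]) => [y|w] _.
  by apply: eq_from_tnth => i; rewrite tnth_mktuple ffunE.
by apply/ffunP => i; rewrite ffunE tnth_mktuple.
Qed.

Section code_of_book.
Variables (R : realType) (V X1 X2 Y : finType) (W : X1 -> X2 -> Y -> R) (x0 : X1).
Variables (n nu1 nu1' nu2 nu2'' : nat).

Local Notation word A := {ffun 'I_n -> A}.
Local Notation M1 := 'I_nu1.
Local Notation M1' := 'I_nu1'.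
Local Notation M2 := 'I_nu2.
Local Notation M2'' := 'I_nu2''.

Variables (m0 : M1 * M2) (m0' : M1 * M1' * M2'').
Variables (accept : word V -> word X2 -> word Y -> bool)
  (accept' : word V -> word X1 -> word X2 -> word Y -> bool).
Variables (vb : {ffun M1 -> word V}) (xb : {ffun M1 * M1' -> word X1})
  (tb : {ffun tree_index X1 M2'' n -> X2}) (zb : {ffun M2 -> word X2}).

(** Beyond the cribbed prefix [nth] returns its default [x0], so the tree is read exactly at the
    masked word. *)
Definition book_code : cribbing_code X1 X2 Y n nu1 nu1' nu2 nu2'' := {|
  enc1 := fun m1 m1' => [tuple xb (m1, m1') i | i < n];
  enc2 := fun m2 => [tuple zb m2 i | i < n];
  enc2'' := fun i m2 p => tb (m2, i, [ffun l : 'I_n => nth x0 p l]);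
  dec := fun y => decode m0 (mac_accept (M1' := M1') accept (vb, xb, zb) [ffun i => tnth y i]);
  dec' := fun y => decode m0' (crib_accept x0 accept' (vb, xb, tb) [ffun i => tnth y i]) |}.

Lemma book_code_error : error_prob W book_code =
  (nu1 * nu1' * nu2)%:R^-1 *
  \sum_(m1 : M1) \sum_(m1' : M1') \sum_(m2 : M2)
    \sum_(y : word Y) mac_output W (vb, xb, zb) (m1, m1', m2) y *
     (decode m0 (mac_accept (M1' := M1') accept (vb, xb, zb) y) != (m1, m2))%:R.
Proof.
congr (_ * _); apply: eq_bigr => m1 _; apply: eq_bigr => m1' _.
apply: eq_bigr => m2 _; rewrite -sum_tuple_word big_mkcond/=.
apply: eq_bigr => y _; case: ifP => _; rewrite ?mulr1 ?mulr0//.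
by apply: eq_bigr => i _; rewrite !tnth_mktuple ffunE.
Qed.

Lemma book_code_error' : error_prob' W book_code =
  (nu1 * nu1' * nu2'')%:R^-1 *
  \sum_(m1 : M1) \sum_(m1' : M1') \sum_(m2 : M2'')
    \sum_(y : word Y) crib_output W x0 (vb, xb, tb) (m1, m1', m2) y *
     (decode m0' (crib_accept x0 accept' (vb, xb, tb) y) != (m1, m1', m2))%:R.
Proof.
congr (_ * _); apply: eq_bigr => m1 _; apply: eq_bigr => m1' _.
apply: eq_bigr => m2 _; rewrite -sum_tuple_word big_mkcond/=.
apply: eq_bigr => y _; case: ifP => _; rewrite ?mulr1 ?mulr0//.
apply: eq_bigr => i _; rewrite !tnth_mktuple !ffunE/=; congr (W _ (tb _) _).
congr (_, _); apply/ffunP => l; rewrite !ffunE.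
have [li|il] := leqP l i.
  rewrite (nth_map (Ordinal (li : (l < i.+1)%N))) ?size_enum_ord// tnth_mktuple.
  by congr (xb _ _); apply: val_inj; rewrite /= nth_enum_ord.
by rewrite nth_default// size_map size_enum_ord.
Qed.

End code_of_book.

Lemma average_le_bound (R : realType) (B : finType) (a b c : nat) (w : B -> R)
    (F : 'I_a -> 'I_b -> 'I_c -> B -> R) (e : R) : (0 < a * b * c)%N ->
  (forall i j k, \sum_s w s * F i j k s <= e) ->
  \sum_s w s * ((a * b * c)%:R^-1 * \sum_i \sum_j \sum_k F i j k s) <= e.
Proof.
move=> abc0 Fe; under eq_bigr do rewrite mulrCA mulr_sumr.
rewrite -mulr_sumr exchange_big/=.
rewrite ler_pdivrMl ?ltr0n//.
apply: (@le_trans _ _ (\sum_(i < a) \sum_(j < b) \sum_(k < c) e)).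
  apply: ler_sum => i _; under eq_bigr do rewrite mulr_sumr.
  rewrite exchange_big/=; apply: ler_sum => j _.
  under eq_bigr do rewrite mulr_sumr.
  by rewrite exchange_big/=; apply: ler_sum => k _.
rewrite !sumr_const !card_ord -!mulrnA mulr_natl; apply: le_of_eq.
by congr (_ *+ _); lia.
Qed.

Section existence.
Variables (R : realType) (V X1 X2 Y : finType).
Variables (pv : V -> R) (k : V -> X1 -> R) (p2 : X2 -> R) (Q : X1 -> X2 -> R)
  (W : X1 -> X2 -> Y -> R).
Hypotheses (pvd : is_dist pv) (kd : is_channel k) (p2d : is_dist p2)
  (Qd : is_channel Q) (Wd : is_mac W).

(** Clouds and satellites must suit both decoders, so the sum of the two errors is averaged over
    them; being nonnegative, each error is then below [e + e']. Once they are fixed, the tree and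
    the codebook of [X2] words affect one error each and are chosen separately. *)
Lemma exists_good_books (n : nat) (M1 M1' M2 M2'' : finType)
    (F : crib_book V X1 X2 M1 M1' M2'' n -> R)
    (G : mac_book V X1 X2 M1 M1' M2 n -> R) (e e' : R) :
  (forall b, 0 <= F b) -> (forall b, 0 <= G b) ->
  \sum_b crib_weight pv k Q b * F b <= e ->
  \sum_b mac_weight pv k p2 b * G b <= e' ->
  exists vb xb tb zb, F (vb, xb, tb) <= e + e' /\ G (vb, xb, zb) <= e + e'.
Proof.
move=> F0 G0; rewrite sum_crib_weight sum_mac_weight => Fe Ge.
pose f vb xb := \sum_t tree_law Q t * F (vb, xb, t).
pose g vb xb := \sum_zb input2_law p2 zb * G (vb, xb, zb).
have f0 vb xb : 0 <= f vb xb by apply: sumr_ge0 => t _; rewrite mulr_ge0 ?tree_law_ge0.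
have g0 vb xb : 0 <= g vb xb by apply: sumr_ge0 => t _; rewrite mulr_ge0 ?input2_law_ge0.
have [vb vbP] : exists vb, \sum_xb satellite_law k vb xb * (f vb xb + g vb xb) <= e + e'.
  apply: (exists_le_mean (w := cloud_law pv)).
  - by move=> b; exact: cloud_law_ge0.
  - by apply: (@sum_prod_law _ _ _ (fun _ : M1 => prod_law (fun _ : 'I_n => pv))); exact: sum_cloud.
  - under eq_bigr do under eq_bigr do rewrite mulrDr.
    under eq_bigr do rewrite big_split/= mulrDr.
    by rewrite big_split/= lerD.
have [xb xbP] : exists xb, f vb xb + g vb xb <= e + e'.
  apply: (exists_le_mean (w := satellite_law k vb)) => //.
  - by move=> b; exact: satellite_law_ge0.
  - by apply: (@sum_prod_law _ _ _ (fun m : M1 * M1' => prod_law (fun i : 'I_n => k (vb m.1 i)))); exact: sum_satellite.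
have [t tP] : exists t, F (vb, xb, t) <= f vb xb.
  apply: (exists_le_mean (w := tree_law Q)) => //.
  - by move=> b; exact: tree_law_ge0.
  - by apply: (@sum_prod_law _ _ _ (fun s : tree_index X1 M2'' n => Q (s.2 s.1.2))); exact: sum_tree_law.
have [zb zbP] : exists zb, G (vb, xb, zb) <= g vb xb.
  apply: (exists_le_mean (w := input2_law p2)) => //.
  - by move=> b; exact: input2_law_ge0.
  - by apply: (@sum_prod_law _ _ _ (fun _ : M2 => prod_law (fun _ : 'I_n => p2))); exact: sum_input2.
exists vb, xb, t, zb; split.
  by apply: (le_trans tP); apply: le_trans xbP; rewrite lerDl.
by apply: (le_trans zbP); apply: le_trans xbP; rewrite lerDr.
Qed.

End existence.

Lemma fits_rate_ex (R : realType) n (gamma r : R) : 0 <= r -> 0 < gamma ->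
  exists2 nu : nat, (0 < nu)%N &
    expR (n%:R * (r - gamma)) <= nu%:R /\ fits_rate n gamma r (nu%:R).
Proof.
move=> r0 g0; set x := expR _.
have x0 : 0 <= x by exact: expR_ge0.
have /andP[tx xt] := truncn_itv x0.
exists (Num.truncn x).+1 => //; split; first exact: ltW.
split.
- by rewrite ler1n.
- by rewrite -addn1 natrD addrK.
- rewrite -addn1 natrD mulr2n mulrDl mul1r; apply: lerD.
    apply: (le_trans tx); rewrite ler_expR ler_wpM2l//; lra.
  by rewrite -[X in X <= _]expR0 ler_expR mulr_ge0.
Qed.

Section single_letter_achievable.
Variables (R : realType) (V X1 X2 Y : finType).
Variables (pv : V -> R) (k : V -> X1 -> R) (p2 : X2 -> R) (Q : X1 -> X2 -> R)
  (W : X1 -> X2 -> Y -> R).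
Hypotheses (pvd : is_dist pv) (kd : is_channel k) (p2d : is_dist p2)
  (Qd : is_channel Q) (Wd : is_mac W).
Variables (R1 R1' R2 R2'' : R).
Local Notation PC := (letter_law pv k Q W).
Local Notation PM := (letter_law pv k (fun=> p2) W).

Lemma letter_law_achievable : X1 ->
  [/\ 0 <= R1, 0 <= R1', 0 <= R2 & 0 <= R2''] ->
  [/\ R1 <= cond_mutual_info PM letV letY letX2,
      R2 <= cond_mutual_info PM letX2 letY letV &
      R1 + R2 <= mutual_info PM (fun w => (letV w, letX2 w)) letY] ->
  [/\ R1' <= cond_entropy PC letX1 letV,
      R2'' <= cond_mutual_info PC letX2 letY (fun w => (letV w, letX1 w)),
      R1' + R2'' <= cond_mutual_info PC (fun w => (letX1 w, letX2 w)) letY letV &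
      R1 + R1' + R2'' <= mutual_info PC (fun w => (letX1 w, letX2 w)) letY] ->
  achievable W R1 R1' R2 R2''.
Proof.
move=> x0 Rge0 [r1 r2 r12] [r1' r2'' r1'2'' r11'2'']; split=> //.
move: Rge0 => [R1_ge0 R1'_ge0 R2_ge0 R2''_ge0] eps gamma eps0 gamma0.
have [kC kC0 rejC] := crib_test_reject pvd kd Qd Wd gamma0.
have [kM kM0 rejM] := mac_test_reject pvd kd p2d Wd gamma0 x0.
pose c := Num.min (Num.min kC kM) (gamma / 2).
have c0 : 0 < c by rewrite !lt_min kC0 kM0 divr_gt0.
(* 56 = 10 + 20 + 6 + 20, the constants of the two random coding bounds; [c] is the least of their
   exponents. *)
have K0 : 0 < 56 :> R by [].
have := linear_exp_le K0 c0 eps0; apply: filterS => n small.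
have [nu1 nu1_gt0 [b1 s1]] := fits_rate_ex n R1_ge0 gamma0.
have [nu1' nu1'_gt0 [b1' s1']] := fits_rate_ex n R1'_ge0 gamma0.
have [nu2 nu2_gt0 [b2 s2]] := fits_rate_ex n R2_ge0 gamma0.
have [nu2'' nu2''_gt0 [b2'' s2'']] := fits_rate_ex n R2''_ge0 gamma0.
exists nu1, nu1', nu2, nu2''; split=> //; split=> //.
pose m0 := (Ordinal nu1_gt0, Ordinal nu2_gt0).
pose m0' := (Ordinal nu1_gt0, Ordinal nu1'_gt0, Ordinal nu2''_gt0).
pose eC := 10 * n.+1%:R * expR (- (n%:R * kC)) +
  20 * n.+1%:R * expR (- (n%:R * (gamma / 2))).
pose eM := 6 * n.+1%:R * expR (- (n%:R * kM)) +
  20 * n.+1%:R * expR (- (n%:R * (gamma / 2))).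
have eCM : eC + eM <= eps.
  apply: le_trans small; rewrite /eC /eM.
  have ec d : c <= d -> n.+1%:R * expR (- (n%:R * d)) <= n.+1%:R * expR (- (n%:R * c)).
    by move=> cd; rewrite ler_wpM2l// ler_expR lerN2 ler_wpM2l.
  have := ec kC; have := ec kM; have := ec (gamma / 2).
  rewrite /c !ge_min !lexx !orbT -/c => /(_ isT) h1 /(_ isT) h2 /(_ isT) h3.
  by rewrite -!mulrA; lra.
pose F (b : crib_book V X1 X2 'I_nu1 'I_nu1' 'I_nu2'' n) := (nu1 * nu1' * nu2'')%:R^-1 *
  \sum_(m1 < nu1) \sum_(m1' < nu1') \sum_(m2 < nu2'')
    \sum_y crib_output W x0 b (m1, m1', m2) y *
     (decode m0' (crib_accept x0 (@crib_test _ _ _ _ _ pv k Q W gamma n) b y) != (m1, m1', m2))%:R.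
pose G (b : mac_book V X1 X2 'I_nu1 'I_nu1' 'I_nu2 n) := (nu1 * nu1' * nu2)%:R^-1 *
  \sum_(m1 < nu1) \sum_(m1' < nu1') \sum_(m2 < nu2)
    \sum_y mac_output W b (m1, m1', m2) y *
     (decode m0 (mac_accept (@mac_test _ _ _ _ _ pv k p2 W gamma x0 n) b y) != (m1, m2))%:R.
have FE : \sum_b crib_weight pv k Q b * F b <= eC.
  apply: average_le_bound; first by rewrite !muln_gt0 nu1_gt0 nu1'_gt0.
  move=> i j l.
  by apply: (crib_random_code pvd kd p2d Qd Wd R2''_ge0 gamma0 x0 r1 r1' r2'' r1'2'' r11'2'');
    rewrite ?card_ord.
have GE : \sum_b mac_weight pv k p2 b * G b <= eM.
  apply: average_le_bound; first by rewrite !muln_gt0 nu1_gt0 nu1'_gt0.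
  move=> i j l.
  by apply: (mac_random_code pvd kd p2d Wd gamma0 r1 r2 r12); rewrite ?card_ord.
have F0 b : 0 <= F b.
  rewrite mulr_ge0 ?invr_ge0// !sumr_ge0// => i _; rewrite sumr_ge0// => j _.
  by rewrite sumr_ge0// => l _; rewrite sumr_ge0// => y _; rewrite mulr_ge0 ?crib_output_ge0.
have G0 b : 0 <= G b.
  rewrite mulr_ge0 ?invr_ge0// !sumr_ge0// => i _; rewrite sumr_ge0// => j _.
  by rewrite sumr_ge0// => l _; rewrite sumr_ge0// => y _; rewrite mulr_ge0 ?mac_output_ge0.
have [vb [xb [tb [zb [Fb Gb]]]]] := exists_good_books pvd kd p2d Qd F0 G0 FE GE.
exists (book_code x0 m0 m0' (@mac_test _ _ _ _ _ pv k p2 W gamma x0 n)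
  (@crib_test _ _ _ _ _ pv k Q W gamma n) vb xb tb zb).
by rewrite book_code_error book_code_error'; split;
  [apply: (le_trans Gb)|apply: (le_trans Fb)].
Qed.

End single_letter_achievable.

(** * From the joint distribution of the region to kernels *)

Section single_letter_region.
Variables (R : realType) (X1 X2 Y V : finType) (W : X1 -> X2 -> Y -> R).
Variables (PVX1 : V * X1 -> R) (PX2 : X2 -> R) (Q : X1 -> X2 -> R).
Hypotheses (Wd : is_mac W) (pd : is_dist PVX1) (p2d : is_dist PX2) (Qd : is_channel Q).

Definition margV (v : V) : R := \sum_x PVX1 (v, x).

(* Where [margV v = 0] any distribution would do. *)
Definition kernX1 (v : V) (x : X1) : R :=
  if margV v == 0 then \sum_u PVX1 (u, x) else PVX1 (v, x) / margV v.

Lemma margV_dist : is_dist margV.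
Proof.
split=> [v|]; first by apply: sumr_ge0 => x _; exact: pd.1.
by rewrite -pd.2 sum_pair.
Qed.

Lemma margV_eq0 v x : margV v = 0 -> PVX1 (v, x) = 0.
Proof. by move=> h; exact: (psumr_eq0P (fun x _ => pd.1 (v, x)) h). Qed.

Lemma kernX1_channel : is_channel kernX1.
Proof.
move=> v; rewrite /kernX1; case: eqVneq => [_|mv]; split=> [x|].
- by apply: sumr_ge0 => u _; exact: pd.1.
- by rewrite exchange_big/= -pd.2 sum_pair.
- by rewrite divr_ge0 ?pd.1 ?margV_dist.1.
- by rewrite -mulr_suml divff.
Qed.

Lemma margV_kernX1 v x : margV v * kernX1 v x = PVX1 (v, x).
Proof.
rewrite /kernX1; case: eqVneq => [mv|mv]; first by rewrite mv mul0r margV_eq0.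
by rewrite mulrCA divff// mulr1.
Qed.

Local Notation J := (joint W PVX1 PX2 Q).

(** Given X1, the pair (X2, Y) is independent of (X2'', Y'') and sums to 1. Each rate bound involves
    only one of the two pairs, so the joint law may be split in this way. *)
Lemma sum_joint_cribbing (F : V * X1 * X2 * Y -> R) :
  \sum_w J w * F (rvV w, rvX1 w, rvX2'' w, rvY'' w) =
  \sum_t letter_law margV kernX1 Q W t * F t.
Proof.
rewrite 5!sum_pair [RHS]sum_pair/= [RHS]sum_pair/= [RHS]sum_pair/=.
apply: eq_bigr => v _; apply: eq_bigr => x _.
rewrite exchange_big/=; apply: eq_bigr => z _.
transitivity (\sum_x2 PX2 x2 * \sum_y W x x2 y * \sum_y''
    PVX1 (v, x) * Q x z * W x z y'' * F (v, x, z, y'')).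
  apply: eq_bigr => x2 _; rewrite mulr_sumr; apply: eq_bigr => y _.
  by rewrite !mulr_sumr; apply: eq_bigr => y'' _; rewrite /=; ring.
under [LHS]eq_bigr do rewrite -mulr_suml (Wd _ _).2 mul1r.
rewrite -mulr_suml p2d.2 mul1r; apply: eq_bigr => y _.
by rewrite /letter_law/= margV_kernX1.
Qed.

Lemma sum_joint_mac (F : V * X1 * X2 * Y -> R) :
  \sum_w J w * F (rvV w, rvX1 w, rvX2 w, rvY w) =
  \sum_t letter_law margV kernX1 (fun=> PX2) W t * F t.
Proof.
rewrite 5!sum_pair [RHS]sum_pair/= [RHS]sum_pair/= [RHS]sum_pair/=.
apply: eq_bigr => v _; apply: eq_bigr => x _; apply: eq_bigr => x2 _.
transitivity (\sum_z Q x z * \sum_y (\sum_y'' W x z y'') *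
    (PVX1 (v, x) * PX2 x2 * W x x2 y * F (v, x, x2, y))).
  apply: eq_bigr => z _; rewrite mulr_sumr; apply: eq_bigr => y _.
  by rewrite mulr_suml mulr_sumr; apply: eq_bigr => y'' _; rewrite /=; ring.
under [LHS]eq_bigr do under eq_bigr do rewrite (Wd _ _).2 mul1r.
rewrite -mulr_suml (Qd _).2 mul1r; apply: eq_bigr => y _.
by rewrite /letter_law/= margV_kernX1.
Qed.

Lemma rate_bounds_achievable (R1 R1' R2 R2'' : R) :
  [/\ 0 <= R1, 0 <= R1', 0 <= R2 & 0 <= R2''] ->
  rate_bounds W PVX1 PX2 Q R1 R1' R2 R2'' -> achievable W R1 R1' R2 R2''.
Proof.
move=> R0 [rM rC].
(* A mass function of total 1 cannot live on an empty set; this provides the padding letter [x0]. *)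
have [[v0 x0] _] : exists c : V * X1, true.
  apply: contrapT => /forallNP e; have [_ /esym] := pd.
  by rewrite big1 => [/eqP|c _]; [rewrite oner_eq0|case: (e c)].
apply: (@letter_law_achievable _ _ _ _ _ margV kernX1 PX2 Q W) => //.
- exact: margV_dist.
- exact: kernX1_channel.
- case: rM => r1 r2 r12; split.
  + apply: (le_trans r1); apply: le_of_eq; by apply: (cond_mutual_info_pushforward sum_joint_mac) => -[[[[[]]]]].
  + apply: (le_trans r2); apply: le_of_eq; by apply: (cond_mutual_info_pushforward sum_joint_mac) => -[[[[[]]]]].
  + apply: (le_trans r12); apply: le_of_eq; by apply: (mutual_info_pushforward sum_joint_mac) => -[[[[[]]]]].
- case: rC => r1 r2 r12 r3; split.
  + apply: (le_trans r1); apply: le_of_eq; congr (- _).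
    apply: eq_bigr => x _; apply: eq_bigr => v _.
    rewrite (law_pushforward sum_joint_cribbing (X := fun w => (rvX1 w, rvV w))
      (X' := fun t => (letX1 t, letV t))); last by move=> [[[[[]]]]].
    by rewrite (law_pushforward sum_joint_cribbing (X' := letV)) => [//|[[[[[]]]]]].
  + apply: (le_trans r2); apply: le_of_eq; by apply: (cond_mutual_info_pushforward sum_joint_cribbing) => -[[[[[]]]]].
  + apply: (le_trans r12); apply: le_of_eq; by apply: (cond_mutual_info_pushforward sum_joint_cribbing) => -[[[[[]]]]].
  + apply: (le_trans r3); apply: le_of_eq; by apply: (mutual_info_pushforward sum_joint_cribbing) => -[[[[[]]]]].
Qed.

End single_letter_region.

(** * Time sharing *)

Section split_words.
Variables (R : realType) (Y : finType) (n1 n2 : nat).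

Definition left_word (y : (n1 + n2).-tuple Y) : n1.-tuple Y :=
  [tuple tnth y (lshift n2 i) | i < n1].
Definition right_word (y : (n1 + n2).-tuple Y) : n2.-tuple Y :=
  [tuple tnth y (rshift n1 i) | i < n2].

Lemma left_word_cat (a : n1.-tuple Y) (b : n2.-tuple Y) :
  left_word [tuple of a ++ b] = a.
Proof. by apply: eq_from_tnth => i; rewrite tnth_mktuple tnth_lshift. Qed.

Lemma right_word_cat (a : n1.-tuple Y) (b : n2.-tuple Y) :
  right_word [tuple of a ++ b] = b.
Proof. by apply: eq_from_tnth => i; rewrite tnth_mktuple tnth_rshift. Qed.

Lemma cat_left_right y : [tuple of left_word y ++ right_word y] = y.
Proof.
apply: eq_from_tnth => i; case: (split_ordP i) => j ->.
  by rewrite tnth_lshift tnth_mktuple.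
by rewrite tnth_rshift tnth_mktuple.
Qed.

Lemma sum_split_word (F : (n1 + n2).-tuple Y -> R) :
  \sum_y F y = \sum_(a : n1.-tuple Y) \sum_(b : n2.-tuple Y) F [tuple of a ++ b].
Proof.
rewrite pair_bigA (reindex (fun c : n1.-tuple Y * n2.-tuple Y => [tuple of c.1 ++ c.2]))//.
exists (fun y => (left_word y, right_word y)) => [[a b]|y] _ /=.
  by rewrite left_word_cat right_word_cat.
exact: cat_left_right.
Qed.

(** Union bound over the two blocks: the other block of the output sums to 1. *)
Lemma split_word_error (La : n1.-tuple Y -> R) (Lb : n2.-tuple Y -> R)
    (Da : pred (n1.-tuple Y)) (Db : pred (n2.-tuple Y)) (D : pred ((n1 + n2).-tuple Y)) :
  (forall a, 0 <= La a) -> (forall b, 0 <= Lb b) ->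
  \sum_a La a = 1 -> \sum_b Lb b = 1 ->
  (forall y, Da (left_word y) -> Db (right_word y) -> D y) ->
  \sum_(y | ~~ D y) La (left_word y) * Lb (right_word y) <=
  \sum_(a | ~~ Da a) La a + \sum_(b | ~~ Db b) Lb b.
Proof.
move=> La0 Lb0 La1 Lb1 DD.
rewrite big_mkcond sum_split_word.
have -> : \sum_(a | ~~ Da a) La a = \sum_a \sum_b (~~ Da a)%:R * La a * Lb b.
  rewrite big_mkcond; apply: eq_bigr => a _; rewrite -mulr_sumr Lb1 mulr1.
  by case: (Da a); rewrite ?mul0r ?mul1r.
have -> : \sum_(b | ~~ Db b) Lb b = \sum_a \sum_b (~~ Db b)%:R * La a * Lb b.
  rewrite exchange_big big_mkcond; apply: eq_bigr => b _.
  rewrite -mulr_suml -mulr_sumr La1 mulr1.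
  by case: (Db b); rewrite ?mul0r ?mul1r.
rewrite -big_split; apply: ler_sum => a _; rewrite -big_split; apply: ler_sum => b _.
have ab : 0 <= La a * Lb b by rewrite mulr_ge0.
have := DD [tuple of a ++ b]; rewrite left_word_cat right_word_cat.
case: (D _) => [_|] /=.
  by rewrite addr_ge0// -mulrA mulr_ge0.
case: (Da a) => /=; last by rewrite mul1r lerDl -mulrA mulr_ge0.
by case: (Db b) => [/(_ isT isT)//|_] /=; rewrite !mul0r mul1r add0r.
Qed.

End split_words.

Lemma word_law_dist (R : realType) (X1 X2 Y : finType) (W : X1 -> X2 -> Y -> R)
    n (x : n.-tuple X1) (z : n.-tuple X2) : is_mac W -> is_dist (word_law W x z).
Proof.
move=> Wd; split=> [y|]; first by apply: prodr_ge0 => i _; case: (Wd (tnth x i) (tnth z i)).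
have -> : \sum_y word_law W x z y =
    \sum_(w : {ffun 'I_n -> Y}) prod_law (fun i => W (tnth x i) (tnth z i)) w.
  rewrite -sum_tuple_word; apply: eq_bigr => y _.
  by apply: eq_bigr => i _; rewrite ffunE.
by apply: sum_prod_law => i; case: (Wd (tnth x i) (tnth z i)).
Qed.

Lemma pair_of_product (a b : nat) :
  exists (f : 'I_(a * b) -> 'I_a * 'I_b) (g : 'I_a * 'I_b -> 'I_(a * b)),
    cancel f g /\ cancel g f.
Proof.
have e : #|{: 'I_a * 'I_b}| = (a * b)%N by rewrite card_prod !card_ord.
exists (fun i => enum_val (cast_ord (esym e) i)), (fun p => cast_ord e (enum_rank p)).
split=> [i|p]; first by rewrite enum_valK cast_ordKV.
by rewrite cast_ordK enum_rankK.
Qed.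

Lemma sum_fst (R : realType) (A B : finType) (F : A -> R) :
  \sum_(p : A * B) F p.1 = #|B|%:R * \sum_a F a.
Proof.
rewrite sum_pair/= mulr_sumr; apply: eq_bigr => a _.
by rewrite sumr_const mulr_natl.
Qed.

Lemma sum_snd (R : realType) (A B : finType) (F : B -> R) :
  \sum_(p : A * B) F p.2 = #|A|%:R * \sum_b F b.
Proof. by rewrite sum_pair/= sumr_const mulr_natl. Qed.

(** Uniform messages of the product code have uniform components, and each term sees only one
    component of each message. *)
Lemma average_split (R : realType) (a b a' b' a2 b2 : nat)
    (f : 'I_(a * b) -> 'I_a * 'I_b) (f' : 'I_(a' * b') -> 'I_a' * 'I_b')
    (f2 : 'I_(a2 * b2) -> 'I_a2 * 'I_b2)
    (A : 'I_a -> 'I_a' -> 'I_a2 -> R) (B : 'I_b -> 'I_b' -> 'I_b2 -> R) :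
  bijective f -> bijective f' -> bijective f2 ->
  (0 < a * a' * a2)%N -> (0 < b * b' * b2)%N ->
  ((a * b) * (a' * b') * (a2 * b2))%:R^-1 *
    \sum_i \sum_j \sum_l (A (f i).1 (f' j).1 (f2 l).1 + B (f i).2 (f' j).2 (f2 l).2) =
  (a * a' * a2)%:R^-1 * (\sum_i \sum_j \sum_l A i j l) +
  (b * b' * b2)%:R^-1 * (\sum_i \sum_j \sum_l B i j l).
Proof.
move=> bf bf' bf2 pa pb.
have re (I J : finType) (h : I -> J) (F : J -> R) : bijective h -> \sum_i F (h i) = \sum_j F j.
  by move=> bh; rewrite [RHS](reindex h)//; exact: onW_bij.
have -> : \sum_i \sum_j \sum_l (A (f i).1 (f' j).1 (f2 l).1 + B (f i).2 (f' j).2 (f2 l).2) =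
    (b * b' * b2)%:R * (\sum_i \sum_j \sum_l A i j l) +
    (a * a' * a2)%:R * (\sum_i \sum_j \sum_l B i j l).
  under eq_bigr do under eq_bigr do rewrite big_split.
  under eq_bigr do rewrite big_split.
  rewrite big_split/=; congr (_ + _).
    rewrite (re _ _ f (fun p => \sum_j \sum_l A p.1 (f' j).1 (f2 l).1))//.
    under [LHS]eq_bigr => p _.
      rewrite (re _ _ f' (fun q => \sum_l A p.1 q.1 (f2 l).1))//.
      under eq_bigr => q _.
        rewrite (re _ _ f2 (fun r => A p.1 q.1 r.1))//.
        rewrite (@sum_fst _ _ _ (A p.1 q.1)).
        over.
      rewrite (@sum_fst _ _ _ (fun q => #|'I_b2|%:R * \sum_l A p.1 q l)) -mulr_sumr.
      over.
    rewrite (@sum_fst _ _ _ (fun p => #|'I_b'|%:R * (#|'I_b2|%:R * \sum_j \sum_l A p j l))).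
    by rewrite -!mulr_sumr !card_ord !natrM !mulrA.
  rewrite (re _ _ f (fun p => \sum_j \sum_l B p.2 (f' j).2 (f2 l).2))//.
  under [LHS]eq_bigr => p _.
    rewrite (re _ _ f' (fun q => \sum_l B p.2 q.2 (f2 l).2))//.
    under eq_bigr => q _.
      rewrite (re _ _ f2 (fun r => B p.2 q.2 r.2))//.
      rewrite (@sum_snd _ _ _ (B p.2 q.2)).
      over.
    rewrite (@sum_snd _ _ _ (fun q => #|'I_a2|%:R * \sum_l B p.2 q l)) -mulr_sumr.
    over.
  rewrite (@sum_snd _ _ _ (fun p => #|'I_a'|%:R * (#|'I_a2|%:R * \sum_j \sum_l B p j l))).
  by rewrite -!mulr_sumr !card_ord !natrM !mulrA.
have pa' : (a * a' * a2)%:R != 0 :> R by rewrite pnatr_eq0 -lt0n.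
have pb' : (b * b' * b2)%:R != 0 :> R by rewrite pnatr_eq0 -lt0n.
have -> : (a * b * (a' * b') * (a2 * b2))%N = ((a * a' * a2) * (b * b' * b2))%N by lia.
rewrite natrM; move: ((a * a' * a2)%:R : R) ((b * b' * b2)%:R : R) pa' pb' => p q p0 q0.
by field; rewrite p0 q0.
Qed.

(** * Concatenation of two codes *)

Section concatenation.
Variables (R : realType) (X1 X2 Y : finType) (W : X1 -> X2 -> Y -> R).
Hypothesis Wd : is_mac W.
Variables (n1 n2 a a' a2 a2'' b b' b2 b2'' : nat).
Variables (ca : cribbing_code X1 X2 Y n1 a a' a2 a2'')
          (cb : cribbing_code X1 X2 Y n2 b b' b2 b2'').
Variable x0 : X1.
Variables (f : 'I_(a * b) -> 'I_a * 'I_b) (g : 'I_a * 'I_b -> 'I_(a * b)).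
Variables (f' : 'I_(a' * b') -> 'I_a' * 'I_b') (g' : 'I_a' * 'I_b' -> 'I_(a' * b')).
Variables (f2 : 'I_(a2 * b2) -> 'I_a2 * 'I_b2) (g2 : 'I_a2 * 'I_b2 -> 'I_(a2 * b2)).
Variables (f2'' : 'I_(a2'' * b2'') -> 'I_a2'' * 'I_b2'')
  (g2'' : 'I_a2'' * 'I_b2'' -> 'I_(a2'' * b2'')).
Hypotheses (fK : cancel f g) (fK' : cancel f' g') (fK2 : cancel f2 g2)
  (fK2'' : cancel f2'' g2'').
Hypotheses (gK : cancel g f) (gK' : cancel g' f') (gK2 : cancel g2 f2)
  (gK2'' : cancel g2'' f2'').

(** In the second block the cribbed prefix has length [n1 + j + 1]; the inner code receives its last
    [j + 1] letters, so all indices are in range and the default [x0] is never returned. *)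
Definition concat_code :
    cribbing_code X1 X2 Y (n1 + n2) (a * b) (a' * b') (a2 * b2) (a2'' * b2'') := {|
  enc1 := fun m m' => [tuple of enc1 ca (f m).1 (f' m').1 ++ enc1 cb (f m).2 (f' m').2];
  enc2 := fun m => [tuple of enc2 ca (f2 m).1 ++ enc2 cb (f2 m).2];
  enc2'' := fun i m p =>
    match fintype.split i with
    | inl j => enc2'' ca (f2'' m).1 [tuple nth x0 p s | s < j.+1]
    | inr j => enc2'' cb (f2'' m).2 [tuple nth x0 p (n1 + s) | s < j.+1]
    end;
  dec := fun y => let u := dec ca (left_word y) in let v := dec cb (right_word y) in
    (g (u.1, v.1), g2 (u.2, v.2));
  dec' := fun y => let u := dec' ca (left_word y) in let v := dec' cb (right_word y) in
    (g (u.1.1, v.1.1), g' (u.1.2, v.1.2), g2'' (u.2, v.2)) |}.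

Lemma word_law_cat (xa : n1.-tuple X1) (xb : n2.-tuple X1) (za : n1.-tuple X2)
    (zb : n2.-tuple X2) y :
  word_law W [tuple of xa ++ xb] [tuple of za ++ zb] y =
  word_law W xa za (left_word y) * word_law W xb zb (right_word y).
Proof.
rewrite /word_law big_split_ord/=; congr (_ * _); apply: eq_bigr => i _.
  by rewrite !tnth_lshift tnth_mktuple.
by rewrite !tnth_rshift tnth_mktuple.
Qed.

Lemma concat_cribbing_word m (xa : n1.-tuple X1) (xb : n2.-tuple X1) :
  cribbing_word concat_code m [tuple of xa ++ xb] =
  [tuple of cribbing_word ca (f2'' m).1 xa ++ cribbing_word cb (f2'' m).2 xb].
Proof.
apply: eq_from_tnth => i; rewrite [LHS]tnth_mktuple/=.
case: (split_ordP i) => j ij; rewrite ij.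
  rewrite tnth_lshift tnth_mktuple; congr (enc2'' _ _).
  apply: eq_from_tnth => s; rewrite !tnth_mktuple.
  rewrite (nth_map s) ?size_enum_ord// nth_ord_enum -(tnth_lshift xa xb); congr tnth.
  exact: val_inj.
rewrite tnth_rshift tnth_mktuple; congr (enc2'' _ _).
apply: eq_from_tnth => s; rewrite !tnth_mktuple.
have ltsj : (n1 + s < (rshift n1 j).+1)%N by rewrite /= ltnS leq_add2l -ltnS.
rewrite (nth_map (Ordinal ltsj)) ?size_enum_ord//.
rewrite -(tnth_rshift xa xb); congr tnth; apply: val_inj => /=.
by rewrite nth_enum_ord.
Qed.

Hypotheses (pa : (0 < a * a' * a2)%N) (pb : (0 < b * b' * b2)%N).
Hypotheses (pa'' : (0 < a * a' * a2'')%N) (pb'' : (0 < b * b' * b2'')%N).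

Lemma concat_error : error_prob W concat_code <= error_prob W ca + error_prob W cb.
Proof.
rewrite /error_prob -(average_split (f := f) (f' := f') (f2 := f2))//;
  [|by exists g|by exists g'|by exists g2].
rewrite ler_wpM2l ?invr_ge0//.
apply: ler_sum => m _; apply: ler_sum => m' _; apply: ler_sum => m2 _ /=.
under eq_bigr do rewrite word_law_cat.
apply: split_word_error.
- by move=> y; case: (word_law_dist (enc1 ca (f m).1 (f' m').1) (enc2 ca (f2 m2).1) Wd).
- by move=> y; case: (word_law_dist (enc1 cb (f m).2 (f' m').2) (enc2 cb (f2 m2).2) Wd).
- by case: (word_law_dist (enc1 ca (f m).1 (f' m').1) (enc2 ca (f2 m2).1) Wd).
- by case: (word_law_dist (enc1 cb (f m).2 (f' m').2) (enc2 cb (f2 m2).2) Wd).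
- by move=> y /eqP -> /eqP -> /=; rewrite -!surjective_pairing fK fK2.
Qed.

Lemma concat_error' : error_prob' W concat_code <= error_prob' W ca + error_prob' W cb.
Proof.
rewrite /error_prob' -(average_split (f := f) (f' := f') (f2 := f2''))//;
  [|by exists g|by exists g'|by exists g2''].
rewrite ler_wpM2l ?invr_ge0//.
apply: ler_sum => m _; apply: ler_sum => m' _; apply: ler_sum => m2 _ /=.
under eq_bigr do rewrite concat_cribbing_word word_law_cat.
set xa := enc1 ca _ _; set xb := enc1 cb _ _.
set za := cribbing_word ca _ _; set zb := cribbing_word cb _ _.
apply: split_word_error.
- by move=> y; case: (word_law_dist xa za Wd).
- by move=> y; case: (word_law_dist xb zb Wd).
- by case: (word_law_dist xa za Wd).
- by case: (word_law_dist xb zb Wd).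
- by move=> y /eqP -> /eqP -> /=; rewrite -!surjective_pairing fK fK' fK2''.
Qed.

End concatenation.

Lemma exists_code_concat (R : realType) (X1 X2 Y : finType) (W : X1 -> X2 -> Y -> R)
    (n1 n2 a a' a2 a2'' b b' b2 b2'' : nat) (eps1 eps2 : R) :
  is_mac W -> (0 < n1)%N ->
  exists_code W n1 a a' a2 a2'' eps1 -> exists_code W n2 b b' b2 b2'' eps2 ->
  exists_code W (n1 + n2) (a * b) (a' * b') (a2 * b2) (a2'' * b2'') (eps1 + eps2).
Proof.
move=> Wd n1_gt0 [[a0 a0' a20 a20''] [ca [ea ea']]] [[b0 b0' b20 b20''] [cb [eb eb']]].
split; first by rewrite !muln_gt0 a0 a0' a20 a20'' b0 b0' b20.
have [f [g [fK gK]]] := pair_of_product a b.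
have [f' [g' [fK' gK']]] := pair_of_product a' b'.
have [f2 [g2 [fK2 gK2]]] := pair_of_product a2 b2.
have [f2'' [g2'' [fK2'' gK2'']]] := pair_of_product a2'' b2''.
(* Any letter will do as the default of [nth]; a nonempty codeword supplies one. *)
pose x0 := tnth (enc1 ca (Ordinal a0) (Ordinal a0')) (Ordinal n1_gt0).
exists (concat_code ca cb x0 f g f' g' f2 g2 f2'' g2''); split.
  apply: (le_trans (concat_error Wd ca cb x0 f2'' g2'' fK fK' fK2 gK gK' gK2 _ _));
    by rewrite ?lerD// !muln_gt0 ?a0 ?a0' ?a20 ?b0 ?b0' ?b20.
apply: (le_trans (concat_error' Wd ca cb x0 f2 g2 fK fK' fK2'' gK gK' gK2'' _ _));
  by rewrite ?lerD// !muln_gt0 ?a0 ?a0' ?a20'' ?b0 ?b0' ?b20''.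
Qed.

Lemma achievable_time_sharing (R : realType) (X1 X2 Y : finType)
    (W : X1 -> X2 -> Y -> R) (l r1 r1' r2 r2'' s1 s1' s2 s2'' : R) :
  is_mac W -> 0 < l -> l < 1 ->
  achievable W r1 r1' r2 r2'' -> achievable W s1 s1' s2 s2'' ->
  achievable W (l * r1 + (1 - l) * s1) (l * r1' + (1 - l) * s1')
    (l * r2 + (1 - l) * s2) (l * r2'' + (1 - l) * s2'').
Proof.
move=> Wd l0 l1 [[r10 r1'0 r20 r2''0] rA] [[s10 s1'0 s20 s2''0] sA].
have l10 : 0 <= 1 - l by rewrite subr_ge0 ltW.
have l0' := ltW l0.
split; first by split; rewrite addr_ge0// mulr_ge0.
move=> eps gamma eps0 gamma0.
have eps2 : 0 < eps / 2 by rewrite divr_gt0.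
have gamma2 : 0 < gamma / 2 by rewrite divr_gt0.
have [Na _ Pa] := rA _ _ eps2 gamma2.
have [Nb _ Pb] := sA _ _ eps2 gamma2.
(* The first block gets [l * n] letters rounded down. The terms over [l] make it nonempty and at
   least [Na] long, the term over [1 - l] makes the second at least [Nb] long, and the last lets
   [n * gamma / 2] absorb the rate of the letter lost by rounding. *)
pose N := (Na.+1)%:R / l + Nb%:R / (1 - l) + 1 / l + 2 * (r1 + r1' + r2 + r2'') / gamma.
have l1' : 0 < 1 - l by rewrite subr_gt0.
have t1 : 0 <= (Na.+1)%:R / l by rewrite divr_ge0.
have t2 : 0 <= Nb%:R / (1 - l) by rewrite divr_ge0.
have t3 : 0 <= 1 / l by rewrite divr_ge0.
have t4 : 0 <= 2 * (r1 + r1' + r2 + r2'') / gamma.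
  by rewrite divr_ge0 ?mulr_ge0 ?addr_ge0// ltW.
exists (Num.truncn N).+1 => // n /= nN.
have Nn : N <= n%:R by rewrite (le_trans (ltW (truncnS_gt _)))// ler_nat.
have ln0 : 0 <= l * n%:R by rewrite mulr_ge0.
pose n1 := Num.truncn (l * n%:R).
have /andP[n1le n1gt] := truncn_itv ln0.
have n1n : (n1 <= n)%N.
  rewrite -(ler_nat R) (le_trans n1le)//.
  by rewrite -[X in _ <= X]mul1r ler_wpM2r// ltW.
pose n2 := (n - n1)%N.
have n12 : (n1 + n2)%N = n by rewrite subnKC.
have n12R : n1%:R + n2%:R = n%:R :> R by rewrite -natrD n12.
rewrite -/n1 -[n1.+1]addn1 natrD in n1le n1gt.
have Nan1 : (Na.+1 <= n1)%N.
  rewrite -(ler_nat R).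
  have : (Na.+1)%:R / l + 1 / l <= n%:R by rewrite /N in Nn; lra.
  rewrite -mulrDl ler_pdivrMr// [n%:R * l]mulrC => h.
  by lra.
have Nbn2 : (Nb <= n2)%N.
  rewrite -(ler_nat R).
  have : Nb%:R / (1 - l) <= n%:R by rewrite /N in Nn; lra.
  rewrite ler_pdivrMr// => h.
  by lra.
have [a [a' [a2 [a2'' [codea [ba ba' ba2 ba2'']]]]]] := Pa n1 (ltnW Nan1).
have [b [b' [b2 [b2'' [codeb [bb bb' bb2 bb2'']]]]]] := Pb n2 Nbn2.
have rate r s p q : 0 <= r -> 0 <= s -> r <= r1 + r1' + r2 + r2'' ->
    expR (n1%:R * (r - gamma / 2)) <= p%:R -> expR (n2%:R * (s - gamma / 2)) <= q%:R ->
    expR (n%:R * (l * r + (1 - l) * s - gamma)) <= (p * q)%:R.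
  move=> r0 s0 rr hp hq; rewrite natrM.
  apply: (@le_trans _ _ (expR (n1%:R * (r - gamma / 2)) * expR (n2%:R * (s - gamma / 2)))); last first.
    by rewrite ler_pM ?expR_ge0.
  rewrite -expRD ler_expR.
  have h1 : 2 * r <= n%:R * gamma.
    rewrite -ler_pdivrMr//; apply: (@le_trans _ _ (2 * (r1 + r1' + r2 + r2'') / gamma)).
      by rewrite ler_wpM2r ?invr_ge0 ?(ltW gamma0)// ler_wpM2l.
    by rewrite /N in Nn; lra.
  (* Rounding down costs the first block at most one letter and can only lengthen the second. *)
  have h2 : (l * n%:R - 1) * r <= n1%:R * r by rewrite ler_wpM2r//; lra.
  have h3 : ((1 - l) * n%:R) * s <= n2%:R * s by rewrite ler_wpM2r//; lra.
  have h4 : n1%:R * gamma + n2%:R * gamma = n%:R * gamma by rewrite -mulrDl n12R.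
  by lra.
exists (a * b)%N, (a' * b')%N, (a2 * b2)%N, (a2'' * b2'')%N; split.
  have -> : eps = eps / 2 + eps / 2 by field.
  rewrite -n12; apply: exists_code_concat => //.
  exact: leq_ltn_trans Nan1.
split; apply: rate => //; lra.
Qed.

Lemma inner_rates_achievable (R : realType) (X1 X2 Y : finType)
    (W : X1 -> X2 -> Y -> R) : is_mac W -> inner_rates W `<=` achievable_rates W.
Proof.
move=> Wd [[[R1 R1'] R2] R2''] [R0 [V [_ [PVX1 [PX2 [Q [pd p2d Qd rb]]]]]]].
exact: rate_bounds_achievable rb.
Qed.

Lemma achievable_rates_convex (R : realType) (X1 X2 Y : finType)
    (W : X1 -> X2 -> Y -> R) : is_mac W -> convex_set (achievable_rates W).
Proof.
(* Only weights strictly between 0 and 1 remain, for which both block lengths grow without bound. *)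
move=> Wd; apply/convex_setW => -[[[r1 r1'] r2] r2''] [[[s1 s1'] s2] s2''].
rewrite !inE => rA sA l l0 l1.
rewrite inE; exact: (achievable_time_sharing Wd l0 l1 rA sA).
Qed.

Theorem theorem3 (R : realType) (X1 X2 Y : finType) (W : X1 -> X2 -> Y -> R)
    (W_mac : is_mac W) :
  inner_region W `<=` capacity_region W.
Proof.
(* Achievability allows a loss [gamma] in each rate, so quadruples that meet the bounds with
   equality are achievable themselves. *)
apply: (@subset_trans _ (achievable_rates W)); last exact: subset_closure.
apply: smallest_sub; last exact: inner_rates_achievable.
exact: achievable_rates_convex.
Qed.
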